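(* Let $d\ge2$ and $0<a<2$. Let $A$ be a real symmetric positive definite $d\times d$ matrix, and put $v_j=A^{-1/2}e_j$, $w_j=A^{1/2}e_j$ for $1\le j\le d$. For $f\in L^2(\mathbb{R}^d)$ and $\lambda>0$, consider the condition that, for $1\le j\le d$, $$|f(x)|\lesssim e^{-\frac12|\langle Ax,v_j\rangle|^2+\lambda|\langle Ax,v_j\rangle|^a}\quad\text{and}\quad|\widehat f(\xi)|\lesssim e^{-\frac12|\langle A^{-1}\xi,w_j\rangle|^2+\lambda|\langle A^{-1}\xi,w_j\rangle|^a}.\qquad( * )_\lambda$$ (i) If $f\in L^2(\mathbb{R}^d)$ satisfies $( * )_\lambda$ for some $\lambda>0$, then $$|H_A(f,\alpha)|\lesssim h^{|\alpha|}(\alpha!)^{-\frac1d\left(\frac1a-\frac12\right)},\qquad h>d^{\frac1d\left(\frac1a+\frac12\right)}\Big(a\max\{2^{a-1},1\}\sec\big(\tfrac{a\pi}4\big)\lambda\Big)^{\frac1{ad}}.$$ (ii) For any $\lambda>0$, there exists $f\in L^2(\mathbb{R}^d)$ satisfying $( * )_\lambda$ such that, for some $h>0$, $$\limsup_{|\alpha|\to\infty}\frac{|H_A(f,\alpha)|}{h^{|\alpha|}(\alpha!)^{-\frac1d\left(\frac1a-\frac12\right)}}>0.$$ (iii) There exists $f\in L^2(\mathbb{R}^d)$ satisfying $( * )_\lambda$ for any $\lambda>0$ and for which $$\sup_{\alpha\in\mathbb{N}^d}\frac{|H_A(f,\alpha)|}{h^{|\alpha|}(\alpha!)^{-b}}=\infty,\qquad\text{for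 all }b>\frac1d\Big(\frac1a-\frac12\Big)\text{ and }h>0.$$
   Context: $\langle\cdot,\cdot\rangle$ is the Euclidean inner product and $\{e_j\}$ the standard basis of $\mathbb{R}^d$. $\widehat f(\xi)=(2\pi)^{-d/2}\int_{\mathbb{R}^d}f(x)e^{-i\langle x,\xi\rangle}dx$. For $\alpha\in\mathbb{N}^d$ ($0\in\mathbb{N}$), $|\alpha|=\sum\alpha_j$, $\alpha!=\prod\alpha_j!$. Hermite functions: $h_\alpha(x)=(-1)^{|\alpha|}\pi^{-d/4}(2^{|\alpha|}\alpha!)^{-1/2}e^{\frac12|x|^2}\partial^\alpha[e^{-|x|^2}]$; $h_{A,\alpha}(x)=(\det A)^{1/4}h_\alpha(A^{1/2}x)$ (an orthonormal basis of $L^2(\mathbb{R}^d)$); $H_A(f,\alpha)=(f,h_{A,\alpha})_{L^2}$. $\lesssim$ means $\le$ up to a positive multiplicative constant independent of $x,\xi,\alpha$ (possibly depending on $\lambda$, $h$). Pointwise bounds are understood almost everywhere. *)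

(* Defs.v *)
From HB Require Import structures.
From mathcomp Require Import all_boot all_order all_algebra.
From mathcomp Require Import all_classical all_reals all_analysis.
From mathcomp Require Import complex.

Set Implicit Arguments.
Unset Strict Implicit.
Unset Printing Implicit Defensive.

Import Order.TTheory GRing.Theory Num.Theory.
Import numFieldNormedType.Exports.
Import Normc.

Local Open Scope classical_set_scope.
Local Open Scope ring_scope.
Local Open Scope complex_scope.

(* Product sigma-algebra on 'cV[R]_n, as the library does for n.-tuple. *)
Section measurable_cV.
Context {R : realType} (n : nat).

Let coors : 'I_n -> 'cV[R]_n -> R := fun i x => x i 0.

Let cV_set0 : g_sigma_preimage coors set0.
Proof. exact: sigma_algebra0. Qed.

Let cV_setC A : g_sigma_preimage coors A -> g_sigma_preimage coors (~` A).
Proof. exact: sigma_algebraC. Qed.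

Let cV_bigcup (F : _^nat) : (forall i, g_sigma_preimage coors (F i)) ->
  g_sigma_preimage coors (\bigcup_i (F i)).
Proof. exact: sigma_algebra_bigcup. Qed.

HB.instance Definition _ :=
  @isMeasurable.Build (measure_tuple_display default_measure_display)
    'cV[R]_n (g_sigma_preimage coors) cV_set0 cV_setC cV_bigcup.

End measurable_cV.

Lemma measurable_coord (R : realType) n (i : 'I_n) :
  measurable_fun [set: 'cV[R]_n] (fun x : 'cV[R]_n => x i 0).
Proof.
move=> _ Y mY; rewrite setTI; apply: sub_sigma_algebra => /=.
rewrite -bigcup_seq/=; exists i => /=; first by rewrite mem_index_enum.
by exists Y => //; rewrite setTI.
Qed.

Lemma measurable_fun_cVP d (T : measurableType d) (R : realType) n
    (f : T -> 'cV[R]_n) :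
  measurable_fun [set: T] f <->
  forall i, measurable_fun [set: T] (fun x => f x i 0).
Proof.
split=> [mf i|mf].
  exact: (measurableT_comp (measurable_coord i) mf).
have : g_sigma_preimage (fun i => (fun x : 'cV[R]_n => x i 0) \o f)
    `<=` measurable.
  apply: smallest_sub; first exact: sigma_algebra_measurable.
  case: n => [|n] in f mf *; first by rewrite big_ord0.
  rewrite -bigcup_mkord_ord; apply: bigcup_sub => i Ii.
  by move=> A [B mB <-]; exact: mf.
rewrite g_sigma_preimage_comp => sub _ A mA.
by apply: sub; exists A.
Qed.

Section lebesgue_cV.
Variable R : realType.

Definition cons_cV n (p : R * 'cV[R]_n) : 'cV[R]_n.+1 :=
  col_mx (p.1%:M : 'cV_1) p.2.

Definition uncons_cV n (x : 'cV[R]_n.+1) : R * 'cV[R]_n :=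
  (x ord0 0, \col_i x (lift ord0 i) 0).

Lemma cons_cV0 n p : @cons_cV n p ord0 0 = p.1.
Proof.
rewrite /cons_cV (_ : ord0 = lshift n (ord0 : 'I_1)); last exact/val_inj.
by rewrite (col_mxEu (p.1%:M : 'cV_1)) mxE eqxx mulr1n.
Qed.

Lemma cons_cVS n p i : @cons_cV n p (lift ord0 i) 0 = p.2 i 0.
Proof.
rewrite /cons_cV (_ : lift ord0 i = rshift 1 i); last exact/val_inj.
by rewrite (col_mxEd (p.1%:M : 'cV_1)).
Qed.

Lemma cons_cVK n : cancel (@cons_cV n) (@uncons_cV n).
Proof.
move=> [t x]; rewrite /uncons_cV cons_cV0; congr (_, _).
by apply/colP => i; rewrite mxE cons_cVS.
Qed.

Lemma uncons_cVK n : cancel (@uncons_cV n) (@cons_cV n).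
Proof.
move=> x; apply/colP => i; have [j ->|->] := unliftP ord0 i.
  by rewrite cons_cVS mxE.
by rewrite cons_cV0.
Qed.

Lemma measurable_cons_cV n : measurable_fun setT (@cons_cV n).
Proof.
apply/measurable_fun_cVP => i; have [j ->|->] := unliftP ord0 i.
  under eq_fun do rewrite cons_cVS.
  exact: (measurableT_comp (measurable_coord j) measurable_snd).
by under eq_fun do rewrite cons_cV0; exact: measurable_fst.
Qed.

Lemma measurable_uncons_cV n : measurable_fun setT (@uncons_cV n).
Proof.
apply: measurable_fun_pair; first exact: measurable_coord.
apply/measurable_fun_cVP => i; under eq_fun do rewrite mxE.
exact: measurable_coord.
Qed.

Section step.
Variables (n : nat) (mu : {sigma_finite_measure set 'cV[R]_n -> \bar R}).

Definition cons_measure : set 'cV[R]_n.+1 -> \bar R :=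
  pushforward (@lebesgue_measure R \x mu)%E (@cons_cV n).

Let cons_measure0 : cons_measure set0 = 0%E.
Proof. by rewrite /cons_measure /pushforward preimage_set0 measure0. Qed.

Let cons_measure_ge0 A : (0 <= cons_measure A)%E.
Proof. exact: (measure_ge0 (@lebesgue_measure R \x mu)%E). Qed.

Let cons_measure_sigma_additive : semi_sigma_additive cons_measure.
Proof.
exact: (@measure_semi_sigma_additive _ _ _
  (measure_function_pushforward__canonical__measure_function_Measure
    (@lebesgue_measure R \x mu)%E (@measurable_cons_cV n))).
Qed.

HB.instance Definition _ := isMeasure.Build _ _ _ cons_measure
  cons_measure0 cons_measure_ge0 cons_measure_sigma_additive.

Lemma cons_measureE (A : set R) (B : set 'cV[R]_n) :
  measurable A -> measurable B ->
  cons_measure [set cons_cV p | p in A `*` B] = (lebesgue_measure A * mu B)%E.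
Proof.
move=> mA mB; rewrite /cons_measure /pushforward -product_measure1E//.
congr (_ _); apply/seteqP; split=> [p [q ABq /(can_inj (@cons_cVK n)) <-]//|].
by move=> p ABp; exists p.
Qed.

Let cons_measure_sigma_finite : sigma_finite setT cons_measure.
Proof.
have /sigma_finiteP[F [TF ndF Foo]] := sigma_finiteT (@lebesgue_measure R).
have /sigma_finiteP[G [TG ndG Goo]] := sigma_finiteT mu.
exists (fun k => @uncons_cV n @^-1` (F k `*` G k)).
  rewrite -preimage_bigcup -(preimage_setT (@uncons_cV n)); congr (_ @^-1` _).
  rewrite -setXTT TF TG predeqE => -[x y]; split.
    move=> [/= [i _ Fix] [k _ Gky]]; exists (maxn i k) => //; split.
    - by move: x Fix; exact/subsetPset/ndF/leq_maxl.
    - by move: y Gky; exact/subsetPset/ndG/leq_maxr.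
  by move=> [i _ []/= ? ?]; split; exists i.
move=> k; have [mF Fk] := Foo k; have [mG Gk] := Goo k; split.
  rewrite -[X in measurable X]setTI; apply: measurable_uncons_cV => //.
  exact: measurableX.
rewrite /cons_measure /pushforward -comp_preimage.
rewrite (_ : @uncons_cV n \o _ = id); last exact/funext/cons_cVK.
by rewrite preimage_id product_measure1E// lte_mul_pinfty// ge0_fin_numE.
Qed.

HB.instance Definition _ := Measure_isSigmaFinite.Build _ _ _ cons_measure
  cons_measure_sigma_finite.

End step.

(* Lebesgue measure on R^n: the unit mass on R^0, and on R^(n+1) the image of
   the product of the Lebesgue measures on R and R^n under the identification
   R * R^n = R^(n+1). *)
Fixpoint lebesgue_cV n : {sigma_finite_measure set 'cV[R]_n -> \bar R} :=
  match n with
  | 0 => @dirac _ 'cV[R]_0 0 R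
  | m.+1 => @cons_measure m (lebesgue_cV m)
  end.

Lemma lebesgue_cV_box n (A : 'I_n -> set R) : (forall i, measurable (A i)) ->
  lebesgue_cV n [set x | forall i, A i (x i 0)] =
  (\prod_(i < n) lebesgue_measure (A i))%E.
Proof.
elim: n A => [|n IH] A mA /=.
  by rewrite big_ord0 diracE mem_set// => -[].
have mB : measurable
    [set x : 'cV[R]_n | forall i, A (lift ord0 i) (x i 0)].
  rewrite (_ : [set _ | _] = \bigcap_i
      ((fun x : 'cV[R]_n => x i 0) @^-1` A (lift ord0 i))); last first.
    by apply/seteqP; split=> x /= h i; [move=> _|]; exact: h.
  apply: fin_bigcap_measurable => [|i _]; first exact: finite_finset.
  by rewrite -[X in measurable X]setTI; exact: measurable_coord.
rewrite big_ord_recl -(IH (fun i => A (lift ord0 i)))//.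
rewrite -(cons_measureE _ (mA ord0) mB).
congr (_ _); apply/seteqP; split=> x /=.
  move=> h; exists (uncons_cV x); last exact: uncons_cVK.
  by split=> [|i] /=; rewrite ?mxE; exact: h.
move=> [p [hp0 hp] <-] i; have [j ->|->] := unliftP ord0 i.
  by rewrite cons_cVS; exact: hp.
by rewrite cons_cV0.
Qed.

End lebesgue_cV.

Section euclidean.
Variable R : realType.

Definition dot d (x y : 'cV[R]_d) : R := \sum_(i < d) x i 0 * y i 0.

Definition basis_vec d (j : 'I_d) : 'cV[R]_d := delta_mx j 0.

Definition spd d (A : 'M[R]_d) : Prop :=
  A^T = A /\ forall x : 'cV[R]_d, x != 0 -> 0 < dot x (A *m x).

(* A^(1/2): for A symmetric positive definite, there is exactly one symmetric
   positive definite B with B^2 = A. *)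
Definition sqrtmx d (A : 'M[R]_d) : 'M[R]_d :=
  xget 0 [set B | spd B /\ B *m B = A].

End euclidean.

Section hermite.
Variable R : realType.

Definition mi_size d (alpha : 'I_d -> nat) : nat := (\sum_(j < d) alpha j)%N.

Definition mi_fact d (alpha : 'I_d -> nat) : nat := (\prod_(j < d) (alpha j)`!)%N.

Definition pderiv d (j : 'I_d) (g : 'cV[R]_d -> R) : 'cV[R]_d -> R :=
  fun x => 'D_(basis_vec R j) g x.

Definition mi_deriv d (alpha : 'I_d -> nat) (g : 'cV[R]_d -> R) :
    'cV[R]_d -> R :=
  foldr (fun j => iter (alpha j) (pderiv j)) g (enum 'I_d).

Definition hermite d (alpha : 'I_d -> nat) (x : 'cV[R]_d) : R :=
  (-1) ^+ mi_size alpha * pi `^ (- (d%:R / 4))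
  * ((2 ^ mi_size alpha * mi_fact alpha)%N%:R) `^ (- 2^-1)
  * expR (2^-1 * dot x x)
  * mi_deriv alpha (fun y => expR (- dot y y)) x.

Definition hermiteA d (A : 'M[R]_d) (alpha : 'I_d -> nat) (x : 'cV[R]_d) : R :=
  (\det A) `^ 4^-1 * hermite alpha (sqrtmx A *m x).

End hermite.

Section complex_L2.
Variables (R : realType) (d : nat).
Implicit Types f g : 'cV[R]_d -> R[i].

Definition in_L2 f : Prop :=
  [/\ measurable_fun setT (fun x => complex.Re (f x)),
      measurable_fun setT (fun x => complex.Im (f x)) &
      (\int[lebesgue_cV R d]_x ((normc (f x)) ^+ 2)%:E < +oo)%E].

Definition cintegral f : R[i] :=
  (\int[lebesgue_cV R d]_x complex.Re (f x)) +i*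
  (\int[lebesgue_cV R d]_x complex.Im (f x)).

Definition L2_inner f g : R[i] := cintegral (fun x => f x * (g x)^*).

Definition fourier f (xi : 'cV[R]_d) : R[i] :=
  ((2 * pi) `^ (- (d%:R / 2)))%:C *
  cintegral (fun x => f x * (cos (- dot x xi) +i* sin (- dot x xi))).

Definition hermite_coef (A : 'M[R]_d) f (alpha : 'I_d -> nat) : R[i] :=
  L2_inner f (fun x => (hermiteA A alpha x)%:C).

Definition v_vec (A : 'M[R]_d) j : 'cV[R]_d := invmx (sqrtmx A) *m basis_vec R j.

Definition w_vec (A : 'M[R]_d) j : 'cV[R]_d := sqrtmx A *m basis_vec R j.

Definition gauss_bound (a lambda : R) (l : 'cV[R]_d -> R) (g : 'cV[R]_d -> R[i])
    : Prop :=
  exists2 C : R, 0 < C &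
  {ae lebesgue_cV R d, forall x,
    normc (g x) <= C * expR (- (2^-1 * `|l x| ^+ 2) + lambda * `|l x| `^ a)}.

(* The bounds on f, taken over all j, force f to be integrable, so the Fourier
   transform is given by its integral formula whenever this holds for an f in
   L^2. *)
Definition decay_cond (A : 'M[R]_d) (a lambda : R) f : Prop :=
  forall j : 'I_d,
    gauss_bound a lambda (fun x => dot (A *m x) (v_vec A j)) f /\
    gauss_bound a lambda (fun xi => dot (invmx A *m xi) (w_vec A j)) (fourier f).

End complex_L2.

Definition mi_limsup (R : realType) d (u : ('I_d -> nat) -> \bar R) : \bar R :=
  ereal_inf (range (fun N : nat =>
    ereal_sup (u @` [set alpha | (N <= mi_size alpha)%N]))).

(* Main.v *)
Require Import Defs.
From mathcomp Require Import all_boot all_order all_algebra.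
From mathcomp Require Import all_classical all_reals all_analysis.
From mathcomp Require Import complex.
From mathcomp Require Import measurable_realfun spectral sesquilinear zify ring lra.

(** In the coordinates y = A^(1/2) x the matrix A becomes the identity
    ([change_of_frame]), and the hypothesis says that, for every j, a function g
    and its Fourier transform are bounded by exp (- y_j^2 / 2 + lambda |y_j|^a).

    Upper bound. The generating function of the Hermite functions is the kernel
    of the Bargmann transform, so that the Hermite coefficients of g are the
    Taylor coefficients of the entire function G(t) = int g(y) prod_k K(t_k, y_k),
    where K is [bargK]. The bound on g in the direction j shows that, as a
    function of t_j = u + iv, G grows at most like
    exp (v^2 + 2^a lambda |u|^a). The Fourier transform acts on Bargmann
    transforms as a rotation by a right angle, so the bound on the Fourier
    transform exchanges the roles of u and v. By the Phragmen-Lindelof principle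
    in each quadrant ([phragmen_lindelof]), G is then of order a in t_j, of type
    2^a lambda sec (a pi / 4), and of order 2 in the other variables
    ([barg_growth]). Cauchy's estimates with optimal radii ([hcoef_cauchy],
    [hsize_bound_along]) bound the coefficient of index alpha by
    ((a L)^(1/a) / 2^(1/2))^alpha_j (alpha_j!)^(-(1/a - 1/2)), where L is that
    type, up to a factor rho^|alpha| with rho > 1
    arbitrary, and the geometric mean over j of these bounds gives the claim
    ([hsize_decay]); the constants leave room for rho because
    2^(1/a - 1/2) < d^(1/a + 1/2).

    Optimality. Consider the series of the tensor powers of the n-th normalized
    Hermite function with the coefficients gamma_n (n!)^(-(1/a - 1/2)). The n-th
    Hermite function is at most C^n kappa^(-n) (n!)^(1/a - 1/2) times
    exp (- x^2 / 2 + kappa^a |x|^a / a) for every kappa in (0, 1]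
    ([hfun_bound_subgauss]), and it is an eigenfunction of the Fourier transform.
    Hence the sum satisfies both bounds as soon as gamma_n decreases at a
    suitable geometric rate ([diag_term_le], [eft_diag_series_le]). Its Hermite
    coefficients on the diagonal are known exactly ([hsize_diag_series]): a
    geometric gamma_n shows that the rate is attained, and
    gamma_n = (1 + ln (n + 1))^(-n), which decreases faster than every geometric
    sequence but slower than every negative power of n!, gives a single function
    that defeats every larger power of alpha!. *)

Set Implicit Arguments.
Unset Strict Implicit.
Unset Printing Implicit Defensive.

Import Order.TTheory GRing.Theory Num.Theory.
Import numFieldNormedType.Exports.
Import Normc.

Local Open Scope classical_set_scope.
Local Open Scope ring_scope.
Local Open Scope complex_scope.

Local Notation Re := complex.Re.
Local Notation Im := complex.Im.

(** * Complex exponential and Taylor's formula *)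

Section complex_basics.
Variable R : realType.
Implicit Types z w : R[i].

Lemma normc_ge0 z : 0 <= normc z.
Proof. by case: z => x y; exact: sqrtr_ge0. Qed.

Lemma normc_sqr z : normc z ^+ 2 = Re z ^+ 2 + Im z ^+ 2.
Proof. by case: z => x y /=; rewrite sqr_sqrtr// addr_ge0 ?sqr_ge0. Qed.

Lemma normc_real (x : R) : normc x%:C = `|x|.
Proof. by rewrite /= expr0n /= addr0 sqrtr_sqr. Qed.

Lemma creM z w : Re (z * w) = Re z * Re w - Im z * Im w.
Proof. by case: z => ? ?; case: w. Qed.
Lemma cimM z w : Im (z * w) = Re z * Im w + Im z * Re w.
Proof. by case: z => ? ?; case: w. Qed.
Lemma creD z w : Re (z + w) = Re z + Re w.
Proof. by case: z => ? ?; case: w. Qed.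
Lemma cimD z w : Im (z + w) = Im z + Im w.
Proof. by case: z => ? ?; case: w. Qed.
Lemma creN z : Re (- z) = - Re z. Proof. by case: z. Qed.
Lemma cimN z : Im (- z) = - Im z. Proof. by case: z. Qed.
Lemma complex_ext z w : Re z = Re w -> Im z = Im w -> z = w.
Proof. by case: z => x y; case: w => x' y' /= -> ->. Qed.

Definition reimE := (creM, cimM, creD, cimD, creN, cimN).

Lemma normc_sum (I : Type) (r : seq I) (P : pred I) (F : I -> R[i]) :
  normc (\sum_(i <- r | P i) F i) <= \sum_(i <- r | P i) normc (F i).
Proof.
elim/big_rec2: _ => [|i y z _ h]; first by rewrite normc0.
by rewrite (le_trans (le_normcD _ _))// lerD2l.
Qed.

Lemma normc_prod (I : Type) (r : seq I) (P : pred I) (F : I -> R[i]) :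
  normc (\prod_(i <- r | P i) F i) = \prod_(i <- r | P i) normc (F i).
Proof.
elim/big_rec2: _ => [|i y z _ h]; first by rewrite normc1.
by rewrite normcM h.
Qed.

Lemma normcX z n : normc (z ^+ n) = normc z ^+ n.
Proof. by elim: n => [|n IH]; rewrite ?expr0 ?normc1// !exprS normcM IH. Qed.

Lemma ler_Re_normc z : `|Re z| <= normc z.
Proof.
rewrite -(ler_pXn2r (_ : 0 < 2)%N) ?nnegrE ?normr_ge0 ?normc_ge0//.
by rewrite normc_sqr real_normK ?num_real// lerDl sqr_ge0.
Qed.

Lemma ler_Im_normc z : `|Im z| <= normc z.
Proof.
rewrite -(ler_pXn2r (_ : 0 < 2)%N) ?nnegrE ?normr_ge0 ?normc_ge0//.
by rewrite normc_sqr real_normK ?num_real// lerDr sqr_ge0.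
Qed.

Lemma ler_normc_add z : normc z <= `|Re z| + `|Im z|.
Proof.
rewrite -(ler_pXn2r (_ : 0 < 2)%N) ?nnegrE ?addr_ge0 ?normr_ge0 ?normc_ge0//.
rewrite normc_sqr sqrrD !real_normK ?num_real//.
by rewrite addrAC lerDl mulrn_wge0// mulr_ge0.
Qed.

Lemma normcB z w : normc (z - w) = normc (w - z).
Proof. by rewrite -normcN opprB. Qed.

Lemma normc_eq0P z : normc z = 0 -> z = 0.
Proof. exact: eq0_normc. Qed.

Definition cexp z : R[i] := (expR (Re z) * cos (Im z)) +i* (expR (Re z) * sin (Im z)).

Lemma cexp0 : cexp 0 = 1.
Proof. by rewrite /cexp /= expR0 cos0 sin0 !mul1r. Qed.

Lemma cexpD z w : cexp (z + w) = cexp z * cexp w.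
Proof.
apply: complex_ext; rewrite !reimE /= !reimE expRD ?cosD ?sinD; ring.
Qed.

Lemma normc_cexp z : normc (cexp z) = expR (Re z).
Proof.
rewrite /= !exprMn -mulrDr cos2Dsin2 mulr1 sqrtr_sqr ger0_norm//.
Qed.

Lemma cexp_real (x : R) : cexp x%:C = (expR x)%:C.
Proof. by rewrite /cexp /= cos0 sin0 mulr1 mulr0. Qed.

Lemma cexp_neq0 z : cexp z != 0.
Proof.
apply/eqP => h; have := normc_cexp z; rewrite h normc0 => /esym/eqP.
by rewrite gt_eqF ?expR_gt0.
Qed.

Lemma cexpX z n : cexp z ^+ n = cexp (n%:R * z).
Proof.
elim: n => [|n IH]; first by rewrite mul0r cexp0.
by rewrite exprS IH -cexpD -nat1r mulrDl mul1r.
Qed.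

Lemma cexp_sum (I : Type) (r : seq I) (P : pred I) (F : I -> R[i]) :
  cexp (\sum_(i <- r | P i) F i) = \prod_(i <- r | P i) cexp (F i).
Proof.
by elim/big_rec2: _ => [|i y z _ <-]; rewrite ?cexp0// cexpD.
Qed.

Lemma is_derive1_eq (x : R) (f : R -> R) df df' :
  is_derive x (1 : R) f df -> df = df' -> is_derive x (1 : R) f df'.
Proof. by move=> ? <-. Qed.

Lemma ler_of_derive_ge0 (f df : R -> R) (x y : R) : x <= y ->
  (forall t, is_derive t (1 : R) f (df t)) ->
  (forall t, x <= t <= y -> 0 <= df t) -> f x <= f y.
Proof.
move=> xy fD df0.
have fc : {within `[x, y], continuous f}.
  apply: derivable_within_continuous => t _.
  by have [] := fD t.
have [c + e] := MVT_segment xy (fun t _ => fD t) fc.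
rewrite in_itv /= => /df0 c0; rewrite -subr_ge0 e mulr_ge0// subr_ge0//.
Qed.

Lemma is_derive_exp_fact k (y : R) :
  is_derive y (1 : R) (fun t => t ^+ k.+1 / (k.+1)`!%:R) (y ^+ k / k`!%:R).
Proof.
have e : (fun t : R => t ^+ k.+1 / (k.+1)`!%:R) =
  (fun t => (k.+1`!%:R)^-1 *: (t ^+ k.+1)).
  by apply/funext => t; rewrite /GRing.scale /= mulrC.
have eX : (fun t : R => t ^+ k.+1) = (@id R) ^+ k.+1.
  by apply/funext => t; rewrite exprfctE.
rewrite e; apply: (@is_derive1_eq _ _ ( (k.+1`!%:R)^-1 *: (k.+1%:R * y ^+ k *: 1))).
  by apply: is_deriveZ; rewrite eX; exact: is_deriveX.
rewrite /GRing.scale /= mulr1.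
rewrite factS natrM invfM mulrCA -!mulrA mulrCA mulKf ?pnatr_eq0//.
by rewrite mulrC.
Qed.

(** Taylor's formula with Lagrange's remainder bound, for a chain [e] of
    successive derivatives, as obtained when the derivatives have a closed
    form. *)
Lemma taylor_bound N (e : nat -> R -> R) (M : R) :
  (forall k (x : R), is_derive x (1 : R) (e k) (e k.+1 x)) ->
  (forall x, 0 <= x <= 1 -> `|e N x| <= M) ->
  forall x, 0 <= x <= 1 ->
  `|e 0%N x - \sum_(k < N) e k 0 * (x ^+ k / k`!%:R)| <= M * (x ^+ N / N`!%:R).
Proof.
elim: N e => [|N IH] e De eM x x01.
  by rewrite big_ord0 subr0 expr0 divr1 mulr1; exact: eM.
pose D y := e 0%N y - \sum_(k < N.+1) e k 0 * (y ^+ k / k`!%:R).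
pose D' y := e 1%N y - \sum_(k < N) e k.+1 0 * (y ^+ k / k`!%:R).
have ID (y : R) : is_derive y (1 : R) D (D' y).
  have -> : D = (fun y => e 0%N y) - ((cst (e 0%N 0)) +
      \sum_(k < N) (e k.+1 0 \*: (fun y => y ^+ k.+1 / k.+1`!%:R))).
    apply/funext => t; rewrite /D big_ord_recl /= expr0 divr1 mulr1.
    by rewrite fctE /= fctE fct_sumE.
  rewrite /D' -[\sum_(k < N) _ in X in is_derive _ _ _ X]add0r.
  apply: is_deriveB; first exact: De.
  apply: is_deriveD; apply: is_derive_sum => k.
  by apply: is_deriveZ; exact: is_derive_exp_fact.
have D'M y : 0 <= y <= 1 -> `|D' y| <= M * (y ^+ N / N`!%:R).
  exact: (IH (fun k => e k.+1)).
have D0 : D 0 = 0.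
  rewrite /D big_ord_recl /= expr0 divr1 mulr1 big1 ?addr0 ?subrr// => i _.
  by rewrite expr0n /= mul0r mulr0.
have G y : is_derive y (1 : R) (fun y => M * (y ^+ N.+1 / N.+1`!%:R))
   (M * (y ^+ N / N`!%:R)).
  by apply: is_deriveZ; exact: is_derive_exp_fact.
have [x0 x1] := andP x01.
have le1 t : 0 <= t <= x -> 0 <= t <= 1.
  by move=> /andP[-> zx]; rewrite (le_trans zx).
have := @ler_of_derive_ge0 _ _ 0 x x0 (fun y => is_deriveB (G y) (ID y)).
have := @ler_of_derive_ge0 _ _ 0 x x0 (fun y => is_deriveD (G y) (ID y)).
rewrite !fctE D0 expr0n /= mul0r mulr0 subrr addr0.
move=> H1 H2; rewrite ler_norml; apply/andP; split.
  rewrite lerNl -subr_ge0 opprK; apply: H1 => t /le1 /D'M.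
  by rewrite ler_norml => /andP[+ _]; rewrite lerNl -subr_ge0 opprK.
rewrite -subr_ge0; apply: H2 => t /le1 /D'M.
by rewrite ler_norml subr_ge0 => /andP[_].
Qed.

(** Derivatives of complex-valued functions of a real variable, taken
    componentwise. *)
Definition is_cderive (x : R) (f : R -> R[i]) (df : R[i]) :=
  is_derive x (1 : R) (fun y => Re (f y)) (Re df) /\
  is_derive x (1 : R) (fun y => Im (f y)) (Im df).

Lemma is_cderive_eq (x : R) f df df' :
  is_cderive x f df -> df = df' -> is_cderive x f df'.
Proof. by move=> ? <-. Qed.

Lemma is_cderive_cst (x : R) z : is_cderive x (fun=> z) 0.
Proof. by split; exact: is_derive_cst. Qed.

Lemma is_cderiveD (x : R) f g df dg :
  is_cderive x f df -> is_cderive x g dg ->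
  is_cderive x (fun y => f y + g y) (df + dg).
Proof.
move=> [f1 f2] [g1 g2]; split.
  under eq_fun do rewrite creD; rewrite creD; exact: is_deriveD.
under eq_fun do rewrite cimD; rewrite cimD; exact: is_deriveD.
Qed.

Lemma is_cderiveN (x : R) f df :
  is_cderive x f df -> is_cderive x (fun y => - f y) (- df).
Proof.
move=> [f1 f2]; split.
  under eq_fun do rewrite creN; rewrite creN; exact: is_deriveN.
under eq_fun do rewrite cimN; rewrite cimN; exact: is_deriveN.
Qed.

Lemma is_cderiveM (x : R) f g df dg :
  is_cderive x f df -> is_cderive x g dg ->
  is_cderive x (fun y => f y * g y) (f x * dg + df * g x).
Proof.
move=> [f1 f2] [g1 g2]; split.
  under eq_fun do rewrite creM.
  apply: (is_derive1_eq (is_deriveB (is_deriveM f1 g1) (is_deriveM f2 g2))).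
  rewrite !reimE /GRing.scale /=; ring.
under eq_fun do rewrite cimM.
apply: (is_derive1_eq (is_deriveD (is_deriveM f1 g2) (is_deriveM f2 g1))).
by rewrite !reimE /GRing.scale /=; ring.
Qed.

Lemma is_cderiveZ (x : R) c f df :
  is_cderive x f df -> is_cderive x (fun y => c * f y) (c * df).
Proof.
move=> h; apply: is_cderive_eq; first exact: (is_cderiveM (is_cderive_cst x c) h).
by rewrite mul0r addr0.
Qed.

Lemma is_cderive_id (x : R) : is_cderive x (fun y => y%:C) 1.
Proof. by split; [exact: is_derive_id|exact: is_derive_cst]. Qed.

Lemma is_cderive_cexp (x : R) f df :
  is_cderive x f df -> is_cderive x (fun y => cexp (f y)) (df * cexp (f x)).
Proof.
move=> [f1 f2].
have he := is_derive1_comp (is_derive_expR (Re (f x))) f1.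
have hc := is_derive1_comp (is_derive_cos (Im (f x))) f2.
have hs := is_derive1_comp (is_derive_sin (Im (f x))) f2.
split.
  apply: (is_derive1_eq (is_deriveM he hc)).
  by rewrite !reimE /GRing.scale /=; ring.
apply: (is_derive1_eq (is_deriveM he hs)).
by rewrite !reimE /GRing.scale /=; ring.
Qed.

Lemma ctaylor_bound N (e : nat -> R -> R[i]) (M : R) :
  (forall k (x : R), is_cderive x (e k) (e k.+1 x)) ->
  (forall x, 0 <= x <= 1 -> normc (e N x) <= M) ->
  normc (e 0%N 1 - \sum_(k < N) e k 0 / k`!%:R) <= 2 * M / N`!%:R.
Proof.
move=> De eM.
have i1 : 0 <= (1 : R) <= 1 by rewrite ler01 lexx.
have ReS (F : 'I_N -> R[i]) : Re (\sum_(k < N) F k) = \sum_(k < N) Re (F k).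
  by elim/big_rec2: _ => // i y1 y2 _ <-; rewrite creD.
have ImS (F : 'I_N -> R[i]) : Im (\sum_(k < N) F k) = \sum_(k < N) Im (F k).
  by elim/big_rec2: _ => // i y1 y2 _ <-; rewrite cimD.
have fE n : (n`!%:R : R[i])^-1 = ((n`!%:R : R)^-1)%:C.
  by rewrite fmorphV rmorph_nat.
have h1 := @taylor_bound N (fun k x => Re (e k x)) M (fun k x => (De k x).1)
  (fun x h => le_trans (ler_Re_normc _) (eM x h)) 1 i1.
have h2 := @taylor_bound N (fun k x => Im (e k x)) M (fun k x => (De k x).2)
  (fun x h => le_trans (ler_Im_normc _) (eM x h)) 1 i1.
apply: (le_trans (ler_normc_add _)).
rewrite !reimE ReS ImS [2 * M]mulr_natl mulr2n mulrDl; apply: lerD.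
  apply: le_trans (le_trans h1 _); last by rewrite expr1n mul1r.
  rewrite le_eqVlt; apply/orP; left; apply/eqP; congr (`|_ - _|).
  by apply: eq_bigr => k _; rewrite fE creM /= mulr0 subr0 expr1n mul1r.
apply: le_trans (le_trans h2 _); last by rewrite expr1n mul1r.
rewrite le_eqVlt; apply/orP; left; apply/eqP; congr (`|_ - _|).
by apply: eq_bigr => k _; rewrite fE cimM /= mulr0 add0r expr1n mul1r.
Qed.

Lemma cexp_taylor2 z :
  normc (cexp z - (1 + z + z ^+ 2 / 2)) <= normc z ^+ 3 * expR (normc z).
Proof.
pose e k (t : R) := z ^+ k * cexp (t%:C * z).
have De k (x : R) : is_cderive x (e k) (e k.+1 x).
  apply: is_cderive_eq.
    apply: is_cderiveZ; apply: is_cderive_cexp.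
    by apply: is_cderiveM; [exact: is_cderive_id|exact: is_cderive_cst].
  by rewrite /e exprS; ring.
have eM x : 0 <= x <= 1 -> normc (e 3%N x) <= normc z ^+ 3 * expR (normc z).
  move=> /andP[x0 x1].
  rewrite /e normcM normcX ler_wpM2l ?exprn_ge0 ?normc_ge0// normc_cexp ler_expR.
  rewrite creM /= mul0r subr0 (le_trans (ler_norm _))// normrM (ger0_norm x0).
  by rewrite (le_trans (ler_wpM2l x0 (ler_Re_normc _)))// ler_piMl ?normc_ge0.
have := ctaylor_bound De eM.
rewrite !big_ord_recl big_ord0 /e /bump /= !mul0r cexp0 !mulr1 mul1r divr1 addr0.
rewrite expr0 expr1 divr1 addrA (rmorph1 (real_complex R)) mul1r => h.
apply: (le_trans h).
rewrite ler_pdivrMr ?ltr0n// mulrC ler_wpM2l//.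
  by rewrite mulr_ge0 ?expR_ge0 ?exprn_ge0 ?normc_ge0.
by rewrite ler_nat.
Qed.

End complex_basics.

(** * Complex differentiability and the maximum principle *)

Section taylor_class.
Variable R : realType.
Local Notation C := R[i].
Implicit Types (E F G : C -> C) (z h : C).

Definition bigO_at0 n E := exists K d : R, [/\ 0 <= K, 0 < d, d <= 1 &
  forall h, normc h <= d -> normc (E h) <= K * normc h ^+ n].

Lemma bigO_ext n E G : (forall h, E h = G h) -> bigO_at0 n E -> bigO_at0 n G.
Proof. by move=> /funext ->. Qed.

Lemma bigOD n E G : bigO_at0 n E -> bigO_at0 n G ->
  bigO_at0 n (fun h => E h + G h).
Proof.
move=> [K [d [K0 d0 d1 H]]] [K' [d' [K0' d0' d1' H']]].
exists (K + K'), (Num.min d d'); split.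
- exact: addr_ge0.
- by rewrite lt_min d0.
- by rewrite ge_min d1.
- move=> h; rewrite le_min => /andP[hd hd'].
  by rewrite (le_trans (le_normcD _ _))// mulrDl lerD ?H ?H'.
Qed.

Lemma bigOM n m E G : bigO_at0 n E -> bigO_at0 m G ->
  bigO_at0 (n + m) (fun h => E h * G h).
Proof.
move=> [K [d [K0 d0 d1 H]]] [K' [d' [K0' d0' d1' H']]].
exists (K * K'), (Num.min d d'); split.
- exact: mulr_ge0.
- by rewrite lt_min d0.
- by rewrite ge_min d1.
- move=> h; rewrite le_min => /andP[hd hd'].
  by rewrite normcM exprD mulrACA ler_pM ?normc_ge0 ?H ?H'.
Qed.

Lemma bigO_cst c : bigO_at0 0 (fun=> c).
Proof.
exists (normc c), 1; split => //; first exact: normc_ge0.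
by move=> h _; rewrite expr0 mulr1.
Qed.

Lemma bigO_id : bigO_at0 1 id.
Proof. by exists 1, 1; split => // h _; rewrite expr1 mul1r. Qed.

Lemma bigO_le n m E : (n <= m)%N -> bigO_at0 m E -> bigO_at0 n E.
Proof.
move=> nm [K [d [K0 d0 d1 H]]]; exists K, d; split => // h hd.
rewrite (le_trans (H _ hd))// ler_wpM2l//.
by apply: ler_wiXn2l => //; [exact: normc_ge0|exact: le_trans d1].
Qed.

Lemma bigOZ n c E : bigO_at0 n E -> bigO_at0 n (fun h => c * E h).
Proof. by move=> h; have := bigOM (bigO_cst c) h. Qed.

Lemma bigOX n : bigO_at0 n (fun h => h ^+ n).
Proof.
elim: n => [|n IH]; first exact: bigO_cst.
apply: bigO_ext (bigOM bigO_id IH) => h; exact: (esym (exprS _ _)).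
Qed.

Lemma bigO_comp n E (k : C -> C) : bigO_at0 n E -> bigO_at0 1 k ->
  bigO_at0 n (fun h => E (k h)).
Proof.
move=> [K [d [K0 d0 d1 H]]] [K' [d' [K0' d0' d1' H']]].
exists (K * K' ^+ n), (Num.min d' (d / (K' + 1))); split.
- by rewrite mulr_ge0// exprn_ge0.
- by rewrite lt_min d0' divr_gt0// ltr_wpDl.
- by rewrite ge_min d1'.
- move=> h; rewrite le_min => /andP[hd' hd].
  have kh := H' _ hd'; rewrite expr1 in kh.
  have kd : normc (k h) <= d.
    rewrite (le_trans kh)//.
    have K1 : 0 < K' + 1 by rewrite ltr_wpDl.
    move: hd; rewrite ler_pdivlMr// mulrC; apply: le_trans.
    by rewrite ler_wpM2r ?normc_ge0// lerDl.
  rewrite (le_trans (H _ kd))// -mulrA ler_wpM2l// -exprMn.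
  by rewrite lerXn2r ?nnegrE ?normc_ge0 ?mulr_ge0// normc_ge0.
Qed.

(** Second-order complex differentiability at a point: all that the maximum
    principle needs to know about holomorphy. *)
Definition tay2 F z := exists F1 F2 : C,
  bigO_at0 3 (fun h => F (z + h) - (F z + F1 * h + F2 * h ^+ 2)).

Lemma tay2_cst c z : tay2 (fun=> c) z.
Proof.
exists 0, 0; apply: (@bigO_ext _ (fun=> 0)) => [h|]; first by ring.
apply: (@bigO_ext _ (fun h => 0 * h ^+ 3)) => [h|]; first by ring.
exact/bigOZ/bigOX.
Qed.

Lemma tay2_id z : tay2 id z.
Proof.
exists 1, 0; apply: (@bigO_ext _ (fun h => 0 * h ^+ 3)) => [h|]; first by ring.
exact/bigOZ/bigOX.
Qed.

Lemma tay2D F G z : tay2 F z -> tay2 G z -> tay2 (fun w => F w + G w) z.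
Proof.
move=> [F1 [F2 HF]] [G1 [G2 HG]]; exists (F1 + G1), (F2 + G2).
by apply: bigO_ext (bigOD HF HG) => h; ring.
Qed.

Lemma tay2M F G z : tay2 F z -> tay2 G z -> tay2 (fun w => F w * G w) z.
Proof.
move=> [F1 [F2 HF]] [G1 [G2 HG]].
exists (F z * G1 + F1 * G z), (F z * G2 + F1 * G1 + F2 * G z).
set EF := (fun h => _) in HF; set EG := (fun h => _) in HG.
apply: (@bigO_ext _ (fun h => (F1 * G2 + F2 * G1) * h ^+ 3 +
  (F2 * G2) * h ^+ 4 +
  (F z + F1 * h + F2 * h ^+ 2) * EG h + EF h * G (z + h))) => [h|].
  by rewrite /EF /EG; ring.
have P0 c0 c1 c2 : bigO_at0 0 (fun h => c0 + c1 * h + c2 * h ^+ 2).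
  apply: bigOD; first apply: bigOD.
  - exact: bigO_cst.
  - by apply: bigOZ; apply: bigO_le bigO_id.
  - by apply: bigOZ; apply: bigO_le (bigOX 2).
have G0 : bigO_at0 0 (fun h => G (z + h)).
  apply: (@bigO_ext _ (fun h => EG h + (G z + G1 * h + G2 * h ^+ 2))) => [h|].
    by rewrite /EG subrK.
  by apply: bigOD => //; apply: bigO_le HG.
apply: bigOD; first apply: bigOD; first apply: bigOD.
- exact/bigOZ/bigOX.
- by apply: bigOZ; apply: bigO_le (bigOX 4).
- exact: (bigOM (P0 _ _ _) HG).
- exact: (bigOM HF G0).
Qed.

Lemma tay2Z c F z : tay2 F z -> tay2 (fun w => c * F w) z.
Proof. by move=> h; exact: tay2M (tay2_cst c z) h. Qed.

Lemma tay2_comp F G z : tay2 G z -> tay2 F (G z) -> tay2 (fun w => F (G w)) z.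
Proof.
move=> [G1 [G2 HG]] [F1 [F2 HF]].
exists (F1 * G1), (F1 * G2 + F2 * G1 ^+ 2).
set EF := (fun h => _) in HF; set EG := (fun h => _) in HG.
pose k h := G (z + h) - G z.
have k2 : bigO_at0 2 (fun h => k h - G1 * h).
  apply: (@bigO_ext _ (fun h => G2 * h ^+ 2 + EG h)) => [h|].
    by rewrite /EG /k; ring.
  by apply: bigOD; [exact/bigOZ/bigOX|apply: bigO_le HG].
have k1 : bigO_at0 1 k.
  apply: (@bigO_ext _ (fun h => G1 * h + (k h - G1 * h))) => [h|]; first by ring.
  by apply: bigOD; [exact/bigOZ/bigO_id|apply: bigO_le k2].
have k1' : bigO_at0 1 (fun h => k h + G1 * h).
  by apply: bigOD => //; exact/bigOZ/bigO_id.
apply: (@bigO_ext _ (fun h => EF (k h) + F1 * EG h +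
   F2 * ((k h - G1 * h) * (k h + G1 * h)))) => [h|].
  rewrite /EF /EG /k (_ : G z + (_ - G z) = G (z + h)); last by rewrite addrC subrK.
  by ring.
apply: bigOD; first apply: bigOD.
- exact: bigO_comp HF k1.
- exact: bigOZ.
- by apply: bigOZ; exact: (bigOM k2 k1').
Qed.

Lemma tay2_cexp z : tay2 (@cexp R) z.
Proof.
exists (cexp z), (cexp z / 2).
apply: (@bigO_ext _ (fun h => cexp z * (cexp h - (1 + h + h ^+ 2 / 2)))) => [h|].
  by rewrite cexpD; ring.
apply: bigOZ; exists (expR 1), 1; split => //.
move=> h h1; rewrite (le_trans (cexp_taylor2 h))// mulrC ler_wpM2r ?exprn_ge0 ?normc_ge0//.
by rewrite ler_expR.
Qed.

Lemma tay2_continuous F z : tay2 F z -> forall e : R, 0 < e ->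
  exists2 d : R, 0 < d & forall w, normc (w - z) < d -> normc (F w - F z) < e.
Proof.
move=> [F1 [F2 H]] e e0.
have [K [d [K0 d0 d1 H']]] : bigO_at0 1 (fun h => F (z + h) - F z).
  apply: (@bigO_ext _ (fun h => (F (z + h) - (F z + F1 * h + F2 * h ^+ 2)) +
    F1 * h + F2 * h ^+ 2)) => [h|]; first by ring.
  apply: bigOD; first apply: bigOD.
  - by apply: bigO_le H.
  - exact/bigOZ/bigO_id.
  - by apply: bigOZ; apply: bigO_le (bigOX 2).
have K1 : 0 < K + 1 by rewrite ltr_wpDl.
exists (Num.min d (e / (K + 1))); first by rewrite lt_min d0 divr_gt0.
move=> w; rewrite lt_min => /andP[wd we].
have := H' (w - z) (ltW wd); rewrite addrCA subrr addr0 expr1 => /le_lt_trans.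
apply; move: we; rewrite ltr_pdivlMr// mulrC; apply: le_lt_trans.
by rewrite ler_wpM2r ?normc_ge0// lerDl.
Qed.

(** The second-order mean value estimate: over the four points z + i^k t the
    terms of degree 1 and 2 cancel. *)
Lemma tay2_mean4 F z : tay2 F z -> exists K d : R, [/\ 0 <= K, 0 < d &
  forall t : R, 0 < t <= d -> 4 * normc (F z) <=
   normc (F (z + t%:C)) + normc (F (z - t%:C)) +
   normc (F (z + (0 +i* 1) * t%:C)) + normc (F (z - (0 +i* 1) * t%:C)) + 4 * K * t ^+ 3].
Proof.
move=> [F1 [F2 [K [d [K0 d0 _ H]]]]]; exists K, d; split => // t /andP[t0 td].
have H4 u : normc u = 1 -> normc (F (z + u * t%:C) -
    (F z + F1 * (u * t%:C) + F2 * (u * t%:C) ^+ 2)) <= K * t ^+ 3.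
  move=> u1; have nt : normc (u * t%:C) = t.
    by rewrite normcM u1 mul1r normc_real ger0_norm// ltW.
  by have := H (u * t%:C); rewrite nt; exact.
have n1 : normc 1 = 1 :> R by rewrite normc1.
have nN1 : normc (-1) = 1 :> R by rewrite normcN normc1.
have ni : normc (0 +i* 1) = 1 :> R by rewrite /= expr0n expr1n add0r sqrtr1.
have nNi : normc (- (0 +i* 1)) = 1 :> R by rewrite normcN ni.
have := H4 _ n1; have := H4 _ nN1; have := H4 _ ni; have := H4 _ nNi.
rewrite !mulNr !mul1r.
set A1 := F (z + t%:C); set A2 := F (z - t%:C); set A3 := F (z + (0 +i* 1) * _).
set A4 := F (z - (0 +i* 1) * _) => h4 h3 h2 h1.
have -> : 4 * normc (F z) = normc (4 * F z).
  rewrite normcM; congr (_ * _).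
  by rewrite -(rmorph_nat (real_complex R) 4) normc_real ger0_norm.
set B1 := A1 - _ in h1; set B2 := A2 - _ in h2.
set B3 := A3 - _ in h3; set B4 := A4 - _ in h4.
have -> : 4 * F z = (A1 + A2 + A3 + A4) - (B1 + B2 + B3 + B4).
  have i2 : (0 +i* 1) ^+ 2 = -1 :> C by exact: sqr_i.
  rewrite /B1 /B2 /B3 /B4 !sqrrN exprMn i2; ring.
have tri4 (a b c e : C) : normc (a + b + c + e) <= normc a + normc b + normc c + normc e.
  rewrite (le_trans (le_normcD _ _))// lerD2r (le_trans (le_normcD _ _))// lerD2r.
  exact: le_normcD.
rewrite (le_trans (le_normcD _ _))// normcN lerD ?tri4//.
rewrite (le_trans (tri4 _ _ _ _))//.
by move: h1 h2 h3 h4; lra.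
Qed.

(** At an interior maximum of |F| + eta |z - corner|^2, the four-point mean value
    estimate is violated: the quadratic term contributes a positive multiple of
    t^2, and the error is only of order t^3. *)
Lemma max_principle_rect F (a b c d M : R) : a < b -> c < d ->
  (forall z, tay2 F z) ->
  (forall x y, a <= x <= b -> c <= y <= d ->
     [|| x == a, x == b, y == c | y == d] -> normc (F (x +i* y)) <= M) ->
  forall x y, a <= x <= b -> c <= y <= d -> normc (F (x +i* y)) <= M.
Proof.
move=> ab cd HF HM x0 y0 hx0 hy0; rewrite leNgt; apply/negP => Mlt.
pose q (p : R * R) := (p.1 - a) ^+ 2 + (p.2 - c) ^+ 2.
pose D := (b - a) ^+ 2 + (d - c) ^+ 2.
have D0 : 0 < D by rewrite ltr_wpDr ?sqr_ge0// exprn_gt0// subr_gt0.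
pose eta := (normc (F (x0 +i* y0)) - M) / (2 * D).
have eta0 : 0 < eta by rewrite divr_gt0 ?subr_gt0 ?mulr_gt0.
have etaD : M + eta * D < normc (F (x0 +i* y0)).
  have -> : eta * D = (normc (F (x0 +i* y0)) - M) / 2.
    by rewrite /eta invfM mulrA mulfVK// gt_eqF.
  by move: Mlt; lra.
pose phi (p : R * R) := normc (F (p.1 +i* p.2)) + eta * q p.
pose A : set (R * R) := `[a, b]%classic `*` `[c, d]%classic.
have cA : compact A by apply: compact_setX; exact: segment_compact.
have A0 : A !=set0.
  by exists (a, c); split; rewrite /= in_itv /= lexx ltW.
have cphi : continuous phi.
  move=> p; apply: cvgD; last first.
    apply: cvgMr; apply: cvgD.
      apply: (@continuous_comp _ _ _ (fun p : R * R => p.1 - a) (fun x => x ^+ 2)).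
        by apply: cvgB; [exact: cvg_fst|exact: cvg_cst].
      exact: exprn_continuous.
    apply: (@continuous_comp _ _ _ (fun p : R * R => p.2 - c) (fun x => x ^+ 2)).
      by apply: cvgB; [exact: cvg_snd|exact: cvg_cst].
    exact: exprn_continuous.
  apply/cvgrPdist_lt => e e0.
  have [dl dl0 Hd] := tay2_continuous (HF (p.1 +i* p.2)) e0.
  have nb : nbhs (p : (R * R)%type) (ball (p : (R * R)%type) (dl / 2)).
    by apply: nbhsx_ballx; rewrite divr_gt0.
  near=> p'.
  have [p1 p2] : ball p (dl / 2) p'.
    by near: p'; exact: nb.
  rewrite /ball /= in p1 p2.
  have : normc (F (p'.1 +i* p'.2) - F (p.1 +i* p.2)) < e.
    apply: Hd; apply: (le_lt_trans (ler_normc_add _)) => /=.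
    by rewrite distrC [X in _ + X]distrC; move: p1 p2; lra.
  set u := F _; set v := F _ => huv.
  have := le_normcD (u - v) v; have := le_normcD (v - u) u; rewrite !subrK.
  by rewrite (normcB v u) ltr_norml; move: huv; lra.
have [[xm ym] /set_mem [/= xmA ymA] Hm] :=
  compact_EVT_max A0 cA (continuous_subspaceT cphi).
rewrite !in_itv /= in xmA ymA.
have inA x y : a <= x <= b -> c <= y <= d -> phi (x, y) <= phi (xm, ym).
  by move=> h1 h2; apply: Hm; rewrite inE; split; rewrite /= in_itv.
have qD x y : a <= x <= b -> c <= y <= d -> q (x, y) <= D.
  move=> /andP[h1 h2] /andP[h3 h4].
  by rewrite /q /D /= lerD// lerXn2r ?nnegrE ?subr_ge0 ?lerD2r// ltW.
have phim : M + eta * D < phi (xm, ym).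
  apply: lt_le_trans (inA _ _ hx0 hy0).
  rewrite (lt_le_trans etaD)// /phi lerDl mulr_ge0 ?(ltW eta0)//.
  by rewrite /q addr_ge0 ?sqr_ge0.
have nb : ~~ [|| xm == a, xm == b, ym == c | ym == d].
  apply/negP => h; have := HM _ _ xmA ymA h => hM.
  move: phim; rewrite ltNge => /negP; apply.
  by rewrite /phi lerD//= ler_wpM2l ?(ltW eta0)// qD.
move: nb; rewrite !negb_or => /and4P[xa xb ya yb].
have xma : a < xm by rewrite lt_neqAle eq_sym xa; case/andP: xmA.
have xmb : xm < b by rewrite lt_neqAle xb; case/andP: xmA.
have ymc : c < ym by rewrite lt_neqAle eq_sym ya; case/andP: ymA.
have ymd : ym < d by rewrite lt_neqAle yb; case/andP: ymA.
have [K [dl [K0 dl0 Hmean]]] := tay2_mean4 (HF (xm +i* ym)).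
pose t := Num.min (Num.min (Num.min (xm - a) (b - xm)) (Num.min (ym - c) (d - ym)))
  (Num.min dl (eta / (2 * (K + 1)))).
have K1 : 0 < K + 1 by rewrite ltr_wpDl.
have t0 : 0 < t.
  by rewrite /t !lt_min !subr_gt0 xma xmb ymc ymd dl0 /= divr_gt0// mulr_gt0.
have : t <= t by [].
rewrite {2}/t !le_min => /and3P[/andP[/andP[ta tb] /andP[tc td]] tdl teta].
have := Hmean t; rewrite t0 tdl => /(_ isT).
have e1 : xm +i* ym + t%:C = (xm + t) +i* ym by apply: complex_ext => /=; ring.
have e2 : xm +i* ym - t%:C = (xm - t) +i* ym by apply: complex_ext => /=; ring.
have e3 : xm +i* ym + (0 +i* 1) * t%:C = xm +i* (ym + t) by apply: complex_ext => /=; ring.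
have e4 : xm +i* ym - (0 +i* 1) * t%:C = xm +i* (ym - t) by apply: complex_ext => /=; ring.
rewrite e1 e2 e3 e4.
have := inA (xm + t) ym; have := inA (xm - t) ym.
have := inA xm (ym + t); have := inA xm (ym - t).
rewrite xmA ymA.
have i1 : a <= xm + t <= b by lra.
have i2 : a <= xm - t <= b by lra.
have i3 : c <= ym + t <= d by lra.
have i4 : c <= ym - t <= d by lra.
rewrite i1 i2 i3 i4 /phi /q /= => /(_ isT isT) h1 /(_ isT isT) h2 /(_ isT isT) h3 /(_ isT isT) h4 h5.
have h6 : K * t ^+ 3 < eta * t ^+ 2.
  rewrite exprSr mulrA [_ * t]mulrAC ltr_pM2r ?exprn_gt0//.
  move: teta; rewrite ler_pdivlMr ?mulr_gt0// => teta.
  have := mulr_ge0 (ltW t0) K0; move: t0 teta; nra.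
by move: h1 h2 h3 h4 h5 h6; lra.
Unshelve. all: by end_near.
Qed.

End taylor_class.

(** * A Phragmen-Lindelof theorem *)

Section phragmen_lindelof.
Variable R : realType.
Local Notation C := R[i].

Lemma ler_cos_abs (s t : R) : `|s| <= t -> t <= pi -> cos t <= cos s.
Proof.
move=> st tpi.
have -> : cos s = cos `|s| by case: (ger0P s) => // _; rewrite cosN.
rewrite -lerN2; apply: (@ler_of_derive_ge0 _ (fun x => - cos x) (@sin R)) => //.
  move=> x; apply: is_derive1_eq.
  by rewrite opprK.
move=> x /andP[sx xt]; apply: sin_ge0_pi.
by rewrite (le_trans _ sx)//= (le_trans xt).
Qed.

Lemma sin_le_id (t : R) : 0 <= t -> sin t <= t.
Proof.
move=> t0.
have := @ler_of_derive_ge0 _ (fun x => x - sin x) (fun x => 1 - cos x) 0 t t0.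
rewrite sin0 subrr subr_ge0; apply.
by move=> x _; rewrite subr_ge0 cos_le1.
Qed.

Lemma pi_le4 : pi <= 4 :> R.
Proof. by have [/andP[_ h] _] := pihalf_02_cos_pihalf R; move: h; lra. Qed.

(** The sector estimate in logarithmic coordinates z = e^(x + iy), where the
    comparison functions r^q cos (q (y - pi/4)) are the real parts of
    exponentials. *)
Lemma sector_estimate_log (G : C -> C) (a mu M eps x0 y0 : R) :
  0 < a < 2 -> 0 <= mu -> 0 <= M ->
  (forall z, tay2 G z) ->
  (forall u v, normc (G (u +i* v)) <= M * expR (v ^+ 2 + mu * `|u| `^ a)) ->
  (forall u v, normc (G (u +i* v)) <= M * expR (u ^+ 2 + mu * `|v| `^ a)) ->
  0 < eps <= 1 -> eps < y0 -> y0 < pi / 2 - eps -> 0 <= x0 ->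
  normc (G (cexp (x0 +i* y0))) <= M * expR (1 + mu) *
   expR (mu / cos (a * pi / 4) * expR (a * x0)
     + eps * (expR (2 * x0) / (2 * cos 1) + expR (4 * x0))).
Proof.
move=> /andP[a0 a2] mu0 M0 GT H1 H2 /andP[e0 e1] ey0 y0e x00.
have pi0 := pi_gt0 R; have pi4 := pi_le4.
pose p := 2 + eps; pose Lam := mu / cos (a * pi / 4).
(* for this c the term c sin (2 y) equals sin^2 y on the side y = eps *)
pose c := sin eps / (2 * cos eps).
pose kap := cos (p * (pi / 4 - eps)).
have ce1 : cos 1 <= cos eps by apply: ler_cos_abs; [rewrite ger0_norm// ltW|have := pi_ge2 R; lra].
have c10 := cos1_gt0 R.
have ce0 : 0 < cos eps by exact: lt_le_trans ce1.
have ca0 : 0 < cos (a * pi / 4) by apply: cos_gt0_pihalf; nra.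
have kap0 : 0 < kap by apply: cos_gt0_pihalf; rewrite /p; nra.
have Lam0 : 0 <= Lam by rewrite divr_ge0// ltW.
have se0 : 0 <= sin eps by apply: sin_ge0_pi; lra.
have c0 : 0 <= c by rewrite divr_ge0// mulr_ge0// ltW.
have csin : c * sin (2 * eps) = sin eps ^+ 2.
  rewrite [2 * eps]mulrC mulr_natr sin_mulr2n /c -mulr_natr; field.
  by rewrite gt_eqF.
pose w (y : R) : R := y - pi / 4.
pose Qr (x y : R) := Lam * (expR (a * x) * cos (a * w y)) +
   c * (expR (2 * x) * sin (2 * y)) + eps * (expR (p * x) * cos (p * w y)).
pose ipi4 : C := 0 +i* (pi / 4).
pose Q (z : C) := Lam%:C * cexp (a%:C * (z - ipi4)) +
  (0 +i* (- c)) * cexp ((2 : R)%:C * z) + eps%:C * cexp (p%:C * (z - ipi4)).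
have QE x y : Re (Q (x +i* y)) = Qr x y.
  rewrite /Q /Qr !reimE /cexp /= !mul0r !subr0 !addr0 /w.
  ring.
pose F z := G (cexp z) * cexp (- Q z).
have FT z : tay2 F z.
  apply: tay2M; first by apply: tay2_comp; [exact: tay2_cexp|exact: GT].
  apply: tay2_comp; last exact: tay2_cexp.
  have lin q : tay2 (fun z : C => cexp (q%:C * (z - ipi4))) z.
    apply: tay2_comp; last exact: tay2_cexp.
    by apply: tay2Z; apply: tay2D; [exact: tay2_id|exact: tay2_cst].
  have e z' : - Q z' = (-1) * Q z' by rewrite mulN1r.
  rewrite (_ : (fun z => - Q z) = (fun z => (-1) * Q z)); last exact/funext.
  apply: tay2Z; apply: tay2D; first apply: tay2D.
  - by apply: tay2Z; exact: lin.
  - apply: tay2Z; apply: tay2_comp; last exact: tay2_cexp.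
    by apply: tay2Z; exact: tay2_id.
  - by apply: tay2Z; exact: lin.
have FE x y : normc (F (x +i* y)) = normc (G (cexp (x +i* y))) * expR (- Qr x y).
  by rewrite normcM normc_cexp creN QE.
(* at x = X the comparison term of order p > 2 exceeds the quadratic growth *)
pose B := (1 + mu) / (eps * kap).
pose X := x0 + 1 + B / eps.
have B0 : 0 <= B by rewrite divr_ge0// ?addr_ge0// mulr_ge0// ltW.
have Bne : 0 <= B / eps by rewrite divr_ge0// ltW.
have X0 : 0 < X by rewrite /X; lra.
have Xx0 : x0 <= X by rewrite /X; lra.
have BX : (1 + mu) * expR (2 * X) <= eps * (expR (p * X) * kap).
  have -> : expR (p * X) = expR (eps * X) * expR (2 * X).
    by rewrite -expRD /p; congr expR; ring.
  rewrite [leRHS](_ : _ = (expR (eps * X) * (eps * kap)) * expR (2 * X)); last by ring.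
  rewrite ler_wpM2r ?expR_ge0//.
  have : B <= expR (eps * X).
    have : 1 + eps * X <= expR (eps * X) by exact: expR_ge1Dx.
    apply: le_trans; rewrite /X !mulrDr mulrCA divff ?gt_eqF// mulr1.
    have := mulr_ge0 (ltW e0) x00; move: e0; lra.
  by rewrite /B ler_pdivrMr ?mulr_gt0.
(* on the rectangle the comparison functions dominate their boundary values *)
have cosa y : eps <= y <= pi / 2 - eps -> cos (a * pi / 4) <= cos (a * w y).
  move=> /andP[h1 h2]; apply: ler_cos_abs; last by nra.
  by rewrite normrM (gtr0_norm a0) -mulrA ler_wpM2l ?(ltW a0)// ler_norml /w; lra.
have cosp y : eps <= y <= pi / 2 - eps -> kap <= cos (p * w y).
  move=> /andP[h1 h2]; apply: ler_cos_abs; last by rewrite /p; nra.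
  have p0 : 0 <= p by rewrite /p; lra.
  by rewrite normrM (ger0_norm p0) ler_wpM2l// ler_norml /w; lra.
have sin2 y : eps <= y <= pi / 2 - eps -> 0 <= sin (2 * y).
  by move=> /andP[h1 h2]; apply: sin_ge0_pi; lra.
have T1 x y : eps <= y <= pi / 2 - eps -> 0 <= c * (expR (2 * x) * sin (2 * y)).
  by move=> h; apply: (mulr_ge0 c0); apply: mulr_ge0; [exact: expR_ge0|exact: sin2].
have T2 x y : eps <= y <= pi / 2 - eps -> eps * (expR (p * x) * kap) <= eps * (expR (p * x) * cos (p * w y)).
  by move=> h; apply: ler_wpM2l (ltW e0) _ _ _; apply: ler_wpM2l (expR_ge0 _) _ _ _; exact: cosp.
have T2' x : 0 <= eps * (expR (p * x) * kap).
  by apply: mulr_ge0 (ltW e0) _; apply: mulr_ge0 (expR_ge0 _) (ltW kap0).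
have T3 x y : eps <= y <= pi / 2 - eps -> mu * expR (a * x) <= Lam * (expR (a * x) * cos (a * w y)).
  move=> h; rewrite /Lam -mulrA; apply: ler_wpM2l mu0 _ _ _.
  rewrite ler_pdivlMl// mulrC; apply: ler_wpM2l (expR_ge0 _) _ _ _; exact: cosa.
have T3' x : 0 <= mu * expR (a * x) by rewrite mulr_ge0 ?expR_ge0.
(* the two hypotheses on G in the coordinates z = e^(x + iy) *)
have pw x s : `|s| <= 1 -> `|expR x * s| `^ a <= expR (a * x).
  move=> s1; rewrite [a * x]mulrC expRM.
  apply: (ge0_ler_powR (ltW a0)); rewrite ?nnegrE ?expR_ge0 ?normr_ge0//.
  by rewrite normrM ger0_norm ?expR_ge0// ler_piMr ?expR_ge0.
have cos1' (y : R) : `|cos y| <= 1 by rewrite ler_norml cos_geN1 cos_le1.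
have sin1' (y : R) : `|sin y| <= 1 by rewrite ler_norml sin_geN1 sin_le1.
have G1 x y : normc (G (cexp (x +i* y))) <= M * expR (expR (2 * x) * sin y ^+ 2 + mu * expR (a * x)).
  rewrite (le_trans (H1 _ _))// ler_wpM2l// ler_expR lerD//.
    by rewrite exprMn -expRM_natl.
  by rewrite ler_wpM2l// pw.
have G2 x y : normc (G (cexp (x +i* y))) <= M * expR (expR (2 * x) * cos y ^+ 2 + mu * expR (a * x)).
  rewrite (le_trans (H2 _ _))// ler_wpM2l// ler_expR lerD//.
    by rewrite exprMn -expRM_natl.
  by rewrite ler_wpM2l// pw.
have FM x y : 0 <= x <= X -> eps <= y <= pi / 2 - eps ->
    normc (F (x +i* y)) <= M * expR (1 + mu).
  apply: max_principle_rect => //; first by lra.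
  move=> {}x {}y hx hy hb; rewrite FE.
  suff [T [HT1 HT2]] : exists T, normc (G (cexp (x +i* y))) <= M * expR T /\ T <= Qr x y + (1 + mu).
    rewrite expRN ler_pdivrMr ?expR_gt0// (le_trans HT1)// -mulrA ler_wpM2l// -expRD ler_expR.
    by rewrite addrC.
  have sy2 : sin y ^+ 2 <= 1 by rewrite -real_normK ?num_real// expr_le1.
  have := T1 x y hy; have := T2 x y hy; have := T2' x; have := T3 x y hy; have := T3' x.
  case/or4P: hb => /eqP e.
  - exists (1 + mu); split; last by rewrite /Qr; lra.
    rewrite (le_trans (G1 _ _))// ler_wpM2l// ler_expR e !mulr0 expR0 mul1r mulr1.
    by rewrite lerD2r.
  - exists (expR (2 * x) * sin y ^+ 2 + mu * expR (a * x)); split; first exact: G1.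
    have : mu * expR (a * x) <= mu * expR (2 * x).
      rewrite ler_wpM2l// ler_expR ler_wpM2r ?(ltW a2)//; by case/andP: hx.
    have : expR (2 * x) * sin y ^+ 2 <= expR (2 * x).
      by rewrite ler_piMr ?expR_ge0.
    by move: BX; rewrite -e /Qr; lra.
  - exists (expR (2 * x) * sin y ^+ 2 + mu * expR (a * x)); split; first exact: G1.
    have -> : expR (2 * x) * sin y ^+ 2 = c * (expR (2 * x) * sin (2 * y)).
      by rewrite e -csin; ring.
    by rewrite /Qr; lra.
  - exists (expR (2 * x) * cos y ^+ 2 + mu * expR (a * x)); split; first exact: G2.
    have -> : expR (2 * x) * cos y ^+ 2 = c * (expR (2 * x) * sin (2 * y)).
      have -> : 2 * y = pi - 2 * eps by rewrite e; field.
      have -> : cos y = sin eps by rewrite e -[pi / 2 - eps]opprB cosN cosBpihalf.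
      by rewrite sinB sinpi cospi mul0r sub0r mulN1r opprK -csin; ring.
    by rewrite /Qr; lra.
have hy0 : eps <= y0 <= pi / 2 - eps by lra.
have := FM x0 y0; rewrite x00 Xx0 => /(_ isT hy0).
rewrite FE expRN ler_pdivrMr ?expR_gt0// => /le_trans; apply.
rewrite ler_wpM2l ?mulr_ge0 ?expR_ge0// ler_expR /Qr.
have b1 : Lam * (expR (a * x0) * cos (a * w y0)) <= Lam * expR (a * x0).
  by rewrite ler_wpM2l// ler_piMr ?expR_ge0// cos_le1.
have b2 : c * (expR (2 * x0) * sin (2 * y0)) <= eps * (expR (2 * x0) / (2 * cos 1)).
  apply: (@le_trans _ _ (c * expR (2 * x0))).
    by rewrite ler_wpM2l// ler_piMr ?expR_ge0// sin_le1.
  rewrite [leRHS]mulrA [leRHS]mulrAC; apply: ler_wpM2r (expR_ge0 _) _ _ _.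
  apply: ler_pM => //; first by rewrite invr_ge0 mulr_ge0// ltW.
    by apply: sin_le_id; exact: ltW.
  by rewrite lef_pV2 ?posrE ?mulr_gt0// ler_pM2l.
have b3 : eps * (expR (p * x0) * cos (p * w y0)) <= eps * expR (4 * x0).
  rewrite ler_wpM2l ?(ltW e0)//.
  apply: (@le_trans _ _ (expR (p * x0))); first by rewrite ler_piMr ?expR_ge0// cos_le1.
  by rewrite ler_expR ler_wpM2r// /p; lra.
by move: b1 b2 b3; rewrite /Lam; lra.
Qed.

(** The limit eps -> 0 of the previous estimate. *)
Lemma sector_estimate (G : C -> C) (a mu M : R) :
  0 < a < 2 -> 0 <= mu -> 0 <= M ->
  (forall z, tay2 G z) ->
  (forall u v, normc (G (u +i* v)) <= M * expR (v ^+ 2 + mu * `|u| `^ a)) ->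
  (forall u v, normc (G (u +i* v)) <= M * expR (u ^+ 2 + mu * `|v| `^ a)) ->
  forall x0 y0, 0 <= x0 -> 0 < y0 < pi / 2 ->
  normc (G (cexp (x0 +i* y0))) <= M * expR (1 + mu) *
   expR (mu / cos (a * pi / 4) * expR (a * x0)).
Proof.
move=> a02 mu0 M0 GT H1 H2 x0 y0 x00 /andP[y00 y01].
set W := M * _ * _; set g := normc _.
have W0 : 0 <= W by rewrite !mulr_ge0 ?expR_ge0.
pose B := expR (2 * x0) / (2 * cos 1) + expR (4 * x0).
have B0 : 0 <= B by rewrite addr_ge0 ?expR_ge0// divr_ge0 ?expR_ge0// mulr_ge0// ltW// cos1_gt0.
have He eps : 0 < eps <= 1 -> eps < y0 -> y0 < pi / 2 - eps -> g <= W * expR (eps * B).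
  move=> h1 h2 h3; rewrite /W -[leRHS]mulrA -expRD.
  exact: (sector_estimate_log a02 mu0 M0 GT H1 H2).
rewrite leNgt; apply/negP => Wg.
have [W00|Wn0] := eqVneq W 0.
  pose e := Num.min 1 (Num.min (y0 / 2) ((pi / 2 - y0) / 2)).
  have e0 : 0 < e by rewrite !lt_min ltr01 !divr_gt0// subr_gt0.
  have : e <= e by [].
  rewrite {2}/e !le_min => /and3P[h1 h2 h3].
  have := He e; rewrite e0 h1 W00 mul0r => /(_ isT).
  by rewrite leNgt -W00 Wg => h; have : false by apply: h; lra.
have Wp : 0 < W by rewrite lt_neqAle eq_sym Wn0.
have lr : 0 < ln (g / W) by apply: ln_gt0; rewrite ltr_pdivlMr// mul1r.
pose e := Num.min (Num.min 1 (ln (g / W) / (2 * (B + 1)))) (Num.min (y0 / 2) ((pi / 2 - y0) / 2)).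
have B1 : 0 < B + 1 by rewrite ltr_wpDl.
have e0 : 0 < e.
  by rewrite !lt_min ltr01 /= !divr_gt0// ?subr_gt0// mulr_gt0.
have : e <= e by [].
rewrite {2}/e !le_min => /andP[/andP[h1 h4] /andP[h2 h3]].
have := He e; rewrite e0 h1 => /(_ isT).
have he : W * expR (e * B) < g.
  rewrite mulrC -ltr_pdivlMr// -[ltRHS](@lnK _ (g / W)); last first.
    by rewrite posrE divr_gt0// (lt_trans Wp).
  rewrite ltr_expR; move: h4; rewrite ler_pdivlMr ?mulr_gt0//.
  by have := mulr_ge0 (ltW e0) B0; move: e0 lr; lra.
by rewrite leNgt he => h; have : false by apply: h; lra.
Qed.

End phragmen_lindelof.

Section phragmen_lindelof2.
Variable R : realType.
Local Notation C := R[i].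

Lemma polar_angle (x y r : R) : 0 < x -> 0 < y -> 0 < r ->
  r ^+ 2 = x ^+ 2 + y ^+ 2 ->
  exists2 t, 0 < t < pi / 2 & cos t = x / r /\ sin t = y / r.
Proof.
move=> x0 y0 r0 r2.
have xr : x < r.
  rewrite -(ltr_pXn2r (_ : 0 < 2)%N) ?nnegrE ?ltW// r2.
  by rewrite ltrDl exprn_gt0.
have xr1 : x / r < 1 by rewrite ltr_pdivrMr// mul1r.
have xr0 : 0 < x / r by rewrite divr_gt0.
have xrN1 : -1 < x / r by rewrite (lt_trans _ xr0)// ltrN10.
have h1 : -1 <= x / r <= 1 by rewrite !ltW.
exists (acos (x / r)).
  rewrite acos_gt0 ?(ltW xrN1)//= ltNge; apply/negP => ht.
  have pp : 0 <= pi / 2 :> R by rewrite divr_ge0// pi_ge0.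
  have := @ler_cos_abs R (pi / 2) _ _ (acos_lepi h1).
  by rewrite cos_pihalf ger0_norm// acosK ?in_itv//= => /(_ ht); rewrite leNgt xr0.
have ct : cos (acos (x / r)) = x / r by rewrite acosK ?in_itv.
split => //; rewrite sin_acos//.
have yr0 : 0 <= y / r by rewrite divr_ge0 ?ltW.
have -> : y / r = Num.sqrt ((y / r) ^+ 2) by rewrite sqrtr_sqr ger0_norm.
congr Num.sqrt.
rewrite !expr_div_n; apply: (mulIf (_ : r ^+ 2 != 0)).
  by rewrite expf_neq0// gt_eqF.
by rewrite mulrBl !divfK ?expf_neq0 ?gt_eqF// mul1r r2 addrAC subrr add0r.
Qed.

(** In the open first quadrant G is compared with the exponential of
    (mu / cos (a pi / 4)) (z e^(-i pi / 4))^a, whose modulus dominates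
    exp (mu |z|^a) on both half-axes. A rotation by a multiple of pi / 2 either
    preserves or exchanges the two hypotheses, which gives the other quadrants. *)
Theorem phragmen_lindelof (G : C -> C) (a mu M : R) :
  0 < a < 2 -> 0 <= mu -> 0 <= M ->
  (forall z, tay2 G z) ->
  (forall u v, normc (G (u +i* v)) <= M * expR (v ^+ 2 + mu * `|u| `^ a)) ->
  (forall u v, normc (G (u +i* v)) <= M * expR (u ^+ 2 + mu * `|v| `^ a)) ->
  forall z, normc (G z) <= M * expR (1 + mu) *
   expR (mu / cos (a * pi / 4) * normc z `^ a).
Proof.
move=> a02 mu0 M0 GT H1 H2 z.
have [a0 a2] := andP a02.
have pi0 := pi_gt0 R.
have ca0 : 0 < cos (a * pi / 4) by apply: cos_gt0_pihalf; nra.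
have Lam0 : 0 <= mu / cos (a * pi / 4) by rewrite divr_ge0// ltW.
have Lammu : mu <= mu / cos (a * pi / 4).
  by rewrite ler_pdivlMr// ler_piMr// cos_le1.
have triv T : T <= 1 + mu + mu / cos (a * pi / 4) * normc z `^ a ->
    normc (G z) <= M * expR T -> normc (G z) <= M * expR (1 + mu) *
   expR (mu / cos (a * pi / 4) * normc z `^ a).
  move=> hT /le_trans; apply; rewrite -mulrA ler_wpM2l// -expRD ler_expR//.
have pz (s : R) : `|s| <= normc z -> `|s| `^ a <= normc z `^ a.
  by apply: (ge0_ler_powR (ltW a0)); rewrite nnegrE ?normc_ge0.
have pz0 : 0 <= mu / cos (a * pi / 4) * normc z `^ a.
  by rewrite mulr_ge0// powR_ge0.
have mup (s : R) : `|s| <= normc z -> mu * `|s| `^ a <= mu / cos (a * pi / 4) * normc z `^ a.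
  by move=> /pz h; apply: ler_pM => //; exact: powR_ge0.
case: z => u v in triv pz pz0 mup *.
have [u0|un0] := eqVneq u 0.
  apply: (triv _ _ (H2 u v)); rewrite u0 expr0n /= add0r -u0.
  by have := mup v (ler_Im_normc (u +i* v)); lra.
have [v0|vn0] := eqVneq v 0.
  apply: (triv _ _ (H1 u v)); rewrite v0 expr0n /= add0r -v0.
  by have := mup u (ler_Re_normc (u +i* v)); lra.
have [z1|z1] := leP (normc (u +i* v)) 1.
  apply: (triv _ _ (H1 u v)).
  have hu := ler_Re_normc (u +i* v); have hv := ler_Im_normc (u +i* v).
  have : v ^+ 2 <= 1 by rewrite -real_normK ?num_real// expr_le1// (le_trans hv).
  have : mu * `|u| `^ a <= mu.
    have p1 : (1 : R) `^ a = 1 by rewrite powR1.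
    rewrite ler_piMr// -[leRHS]p1.
    by apply: (ge0_ler_powR (ltW a0)); rewrite ?nnegrE// (le_trans hu).
  by move: pz0 mu0; lra.
(* reduction to the open first quadrant by the rotations i^k *)
have Q1 (G' : C -> C) (x y : R) : (forall z, tay2 G' z) ->
  (forall u v, normc (G' (u +i* v)) <= M * expR (v ^+ 2 + mu * `|u| `^ a)) ->
  (forall u v, normc (G' (u +i* v)) <= M * expR (u ^+ 2 + mu * `|v| `^ a)) ->
  0 < x -> 0 < y -> normc (x +i* y) = normc (u +i* v) ->
  normc (G' (x +i* y)) <= M * expR (1 + mu) *
   expR (mu / cos (a * pi / 4) * normc (u +i* v) `^ a).
  move=> GT' H1' H2' x0 y0 nE.
  pose r := normc (u +i* v).
  have r0 : 0 < r by rewrite (lt_trans _ z1).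
  have r2 : r ^+ 2 = x ^+ 2 + y ^+ 2 by rewrite /r -nE normc_sqr.
  have [t tb [ct st]] := polar_angle x0 y0 r0 r2.
  have -> : x +i* y = cexp (ln r +i* t).
    rewrite /cexp /= lnK ?posrE// ct st; congr (_ +i* _); rewrite mulrC divfK// gt_eqF//.
  have lr0 : 0 <= ln r by rewrite ln_ge0// ltW.
  have := sector_estimate a02 mu0 M0 GT' H1' H2' lr0 tb.
  rewrite /r /powR gt_eqF//.
have GTi c : forall z, tay2 (fun z => G (c * z)) z.
  by move=> z; apply: tay2_comp; [apply: tay2Z; exact: tay2_id|exact: GT].
have [u_gt|u_le] := ltP 0 u; have [v_gt|v_le] := ltP 0 v.
- exact: Q1.
- have vlt : v < 0 by rewrite lt_neqAle vn0.
  have -> : u +i* v = (0 +i* -1) * ((- v) +i* u) by apply: complex_ext => /=; ring.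
  rewrite normcM (_ : normc (0 +i* -1) = 1) ?mul1r; last first.
    by rewrite /= expr0n /= add0r sqrrN expr1n sqrtr1.
  have e (x y : R) : (0 +i* -1) * (x +i* y) = y +i* (- x) by apply: complex_ext => /=; ring.
  have nE : normc ((- v) +i* u) = normc (u +i* v) by rewrite /= sqrrN addrC.
  have vlt' : 0 < - v by rewrite oppr_gt0.
  have h1 x y : normc (G ((0 +i* -1) * (x +i* y))) <= M * expR (y ^+ 2 + mu * `|x| `^ a).
    by rewrite e -(normrN x); apply: H2.
  have h2 x y : normc (G ((0 +i* -1) * (x +i* y))) <= M * expR (x ^+ 2 + mu * `|y| `^ a).
    by rewrite e -(sqrrN x); apply: H1.
  rewrite nE; exact: (Q1 (fun z => G ((0 +i* -1) * z)) (- v) u (GTi _) h1 h2 vlt' u_gt nE).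
- have ult : u < 0 by rewrite lt_neqAle un0.
  have -> : u +i* v = (0 +i* 1) * (v +i* (- u)) by apply: complex_ext => /=; ring.
  rewrite normcM (_ : normc (0 +i* 1) = 1) ?mul1r; last first.
    by rewrite /= expr0n /= add0r expr1n sqrtr1.
  have e (x y : R) : (0 +i* 1) * (x +i* y) = (- y) +i* x by apply: complex_ext => /=; ring.
  have nE : normc (v +i* (- u)) = normc (u +i* v) by rewrite /= sqrrN addrC.
  have ult' : 0 < - u by rewrite oppr_gt0.
  have h1 x y : normc (G ((0 +i* 1) * (x +i* y))) <= M * expR (y ^+ 2 + mu * `|x| `^ a).
    by rewrite e -(sqrrN y); apply: H2.
  have h2 x y : normc (G ((0 +i* 1) * (x +i* y))) <= M * expR (x ^+ 2 + mu * `|y| `^ a).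
    by rewrite e -(normrN y); apply: H1.
  rewrite nE; exact: (Q1 (fun z => G ((0 +i* 1) * z)) v (- u) (GTi _) h1 h2 v_gt ult' nE).
- have ult : u < 0 by rewrite lt_neqAle un0.
  have vlt : v < 0 by rewrite lt_neqAle vn0.
  have -> : u +i* v = (-1) * ((- u) +i* (- v)) by apply: complex_ext => /=; ring.
  rewrite normcM normcN normc1 mul1r.
  have e (x y : R) : (-1) * (x +i* y) = (- x) +i* (- y) by apply: complex_ext => /=; ring.
  have nE : normc ((- u) +i* (- v)) = normc (u +i* v) by rewrite /= !sqrrN.
  have ult' : 0 < - u by rewrite oppr_gt0.
  have vlt' : 0 < - v by rewrite oppr_gt0.
  have h1 x y : normc (G (-1 * (x +i* y))) <= M * expR (y ^+ 2 + mu * `|x| `^ a).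
    by rewrite e -(normrN x) -(sqrrN y); apply: H1.
  have h2 x y : normc (G (-1 * (x +i* y))) <= M * expR (x ^+ 2 + mu * `|y| `^ a).
    by rewrite e -(normrN y) -(sqrrN x); apply: H2.
  rewrite nE; exact: (Q1 (fun z => G (-1 * z)) (- u) (- v) (GTi _) h1 h2 ult' vlt' nE).
Qed.

End phragmen_lindelof2.

(** * Integrals of complex-valued functions *)

Section complex_integral.
Context d (T : measurableType d) (R : realType) (mu : {measure set T -> \bar R}).
Local Notation C := R[i].
Implicit Types f g : T -> C.

Definition rintg (f : T -> R) := mu.-integrable setT (EFin \o f).

Definition cmeas f := measurable_fun setT (fun x => Re (f x)) /\
  measurable_fun setT (fun x => Im (f x)).

Definition cintg f := rintg (fun x => Re (f x)) /\ rintg (fun x => Im (f x)).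

Definition cint f : C :=
  (\int[mu]_x Re (f x)) +i* (\int[mu]_x Im (f x)).

Lemma rintg_meas (f : T -> R) : rintg f -> measurable_fun setT f.
Proof. by move=> /measurable_int /measurable_EFinP. Qed.

Lemma cintg_meas f : cintg f -> cmeas f.
Proof. by move=> [h1 h2]; split; exact: rintg_meas. Qed.

Lemma rintg_dom (f g : T -> R) : measurable_fun setT f -> rintg g ->
  {ae mu, forall x, `|f x| <= g x} -> rintg f.
Proof.
move=> mf ig fg; apply/integrableP; split; first exact/measurable_EFinP.
have /integrableP[mg goo] := ig.
apply: le_lt_trans goo; apply: ae_ge0_le_integral => //.
- by apply/measurable_EFinP; exact: measurableT_comp.
- by apply: measurableT_comp.
by apply: filterS fg => x h _; rewrite /= lee_fin (le_trans h)// ler_norm.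
Qed.

Lemma Rintegral_le_ae (f g : T -> R) : measurable_fun setT f -> rintg g ->
  (forall x, 0 <= g x) ->
  {ae mu, forall x, `|f x| <= g x} -> `|\int[mu]_x f x| <= \int[mu]_x g x.
Proof.
move=> mf ig g0 fg; have jf := rintg_dom mf ig fg.
apply: (le_trans (le_normr_Rintegral measurableT jf)).
rewrite /Rintegral; apply: fine_le.
- exact: (integrable_fin_num measurableT (integrable_norm jf)).
- exact: (integrable_fin_num measurableT ig).
apply: ae_ge0_le_integral => //.
- by apply/measurable_EFinP; exact: measurableT_comp.
- by move=> x _; rewrite lee_fin.
- by apply/measurable_EFinP; exact: rintg_meas.
by apply: filterS fg => x h _; rewrite lee_fin.
Qed.

Lemma cmeas_normc f : cmeas f -> measurable_fun setT (fun x => normc (f x)).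
Proof.
move=> [m1 m2].
rewrite (_ : (fun x => _) = (fun x => Num.sqrt (Re (f x) ^+ 2 + Im (f x) ^+ 2))).
  apply: measurableT_comp; first by apply: continuous_measurable_fun; exact: sqrt_continuous.
  by apply: measurable_funD; exact: measurable_funX.
by apply/funext => x; case: (f x).
Qed.

Lemma cmeasD f g : cmeas f -> cmeas g -> cmeas (fun x => f x + g x).
Proof.
move=> [f1 f2] [g1 g2]; split.
  by under eq_fun do rewrite creD; exact: measurable_funD.
by under eq_fun do rewrite cimD; exact: measurable_funD.
Qed.

Lemma cmeasM f g : cmeas f -> cmeas g -> cmeas (fun x => f x * g x).
Proof.
move=> [f1 f2] [g1 g2]; split.
  by under eq_fun do rewrite creM; apply: measurable_funB; exact: measurable_funM.
by under eq_fun do rewrite cimM; apply: measurable_funD; exact: measurable_funM.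
Qed.

Lemma cmeas_cst c : cmeas (fun=> c).
Proof. by split; exact: measurable_cst. Qed.

Lemma cmeas_real (f : T -> R) : measurable_fun setT f -> cmeas (fun x => (f x)%:C).
Proof. by move=> mf; split => //=; exact: measurable_cst. Qed.

Lemma cmeas_cexp f : cmeas f -> cmeas (fun x => cexp (f x)).
Proof.
move=> [f1 f2]; split => /=; apply: measurable_funM.
- exact: (measurableT_comp (@measurable_expR R)).
- by apply: measurableT_comp f2; apply: continuous_measurable_fun; exact: continuous_cos.
- exact: (measurableT_comp (@measurable_expR R)).
- by apply: measurableT_comp f2; apply: continuous_measurable_fun; exact: continuous_sin.
Qed.

Lemma cmeas_sum (I : Type) (r : seq I) (P : pred I) (F : I -> T -> C) :
  (forall i, cmeas (F i)) -> cmeas (fun x => \sum_(i <- r | P i) F i x).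
Proof.
move=> h; elim: r => [|i r IH].
  by under eq_fun do rewrite big_nil; exact: cmeas_cst.
under eq_fun do rewrite big_cons; case: (P i) => //.
exact: cmeasD.
Qed.

Lemma cmeas_prod (I : Type) (r : seq I) (P : pred I) (F : I -> T -> C) :
  (forall i, cmeas (F i)) -> cmeas (fun x => \prod_(i <- r | P i) F i x).
Proof.
move=> h; elim: r => [|i r IH].
  by under eq_fun do rewrite big_nil; exact: cmeas_cst.
under eq_fun do rewrite big_cons; case: (P i) => //.
exact: cmeasM.
Qed.

Lemma cintg_dom f (g : T -> R) : cmeas f -> rintg g ->
  {ae mu, forall x, normc (f x) <= g x} -> cintg f.
Proof.
move=> [f1 f2] ig fg; split; apply: (rintg_dom _ ig) => //.
  by apply: filterS fg => x; apply: le_trans; exact: ler_Re_normc.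
by apply: filterS fg => x; apply: le_trans; exact: ler_Im_normc.
Qed.

Lemma cintg_normc f : cintg f -> rintg (fun x => normc (f x)).
Proof.
move=> [f1 f2].
apply: (@rintg_dom _ (fun x => `|Re (f x)| + `|Im (f x)|)).
- exact/cmeas_normc/cintg_meas.
- rewrite /rintg (_ : _ \o _ = (fun x => (`|Re (f x)|%:E) + (`|Im (f x)|%:E))%E)//.
  by apply: integrableD => //; exact: integrable_norm.
by apply: aeW => x; rewrite ger0_norm ?normc_ge0// ler_normc_add.
Qed.

(** The factor 2 comes from treating the two components separately; only the
    order of magnitude matters in what follows. *)
Lemma normc_cint_le f (g : T -> R) : cmeas f -> rintg g ->
  (forall x, 0 <= g x) ->
  {ae mu, forall x, normc (f x) <= g x} -> normc (cint f) <= 2 * \int[mu]_x g x.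
Proof.
move=> [f1 f2] ig g0 fg; rewrite (le_trans (ler_normc_add _))//= mulr_natl mulr2n.
apply: lerD; apply: Rintegral_le_ae => //.
  by apply: filterS fg => x; apply: le_trans; exact: ler_Re_normc.
by apply: filterS fg => x; apply: le_trans; exact: ler_Im_normc.
Qed.

Lemma rintgZ (c : R) (f : T -> R) : rintg f -> rintg (fun x => c * f x).
Proof.
move=> h; rewrite /rintg (_ : _ \o _ = (fun x => c%:E * (f x)%:E)%E)//.
exact: integrableZl.
Qed.

Lemma rintgD (f g : T -> R) : rintg f -> rintg g -> rintg (fun x => f x + g x).
Proof.
move=> h1 h2; rewrite /rintg (_ : _ \o _ = (fun x => (f x)%:E + (g x)%:E)%E)//.
exact: integrableD.
Qed.

Lemma rintgB (f g : T -> R) : rintg f -> rintg g -> rintg (fun x => f x - g x).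
Proof.
move=> h1 h2; rewrite /rintg (_ : _ \o _ = (fun x => (f x)%:E - (g x)%:E)%E)//.
exact: integrableB.
Qed.

Lemma eq_cint f g : f =1 g -> cint f = cint g.
Proof. by move=> /funext ->. Qed.

Lemma cintgD f g : cintg f -> cintg g -> cintg (fun x => f x + g x).
Proof.
move=> [f1 f2] [g1 g2]; split.
  by under eq_fun do rewrite creD; exact: rintgD.
by under eq_fun do rewrite cimD; exact: rintgD.
Qed.

Lemma cintD f g : cintg f -> cintg g ->
  cint (fun x => f x + g x) = cint f + cint g.
Proof.
move=> [f1 f2] [g1 g2]; rewrite /cint.
rewrite -[RHS]/(_ +i* _); congr (_ +i* _); rewrite -RintegralD//.
  by apply: eq_Rintegral => x _; rewrite creD.
by apply: eq_Rintegral => x _; rewrite cimD.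
Qed.

Lemma cintgZ c f : cintg f -> cintg (fun x => c * f x).
Proof.
move=> [f1 f2]; split.
  by under eq_fun do rewrite creM; apply: rintgB; exact: rintgZ.
by under eq_fun do rewrite cimM; apply: rintgD; exact: rintgZ.
Qed.

Lemma cintZ c f : cintg f -> cint (fun x => c * f x) = c * cint f.
Proof.
move=> [f1 f2]; rewrite /cint; apply: complex_ext => /=.
  rewrite creM /= -!RintegralZl// -RintegralB//; try exact: rintgZ.
  by apply: eq_Rintegral => x _; rewrite creM.
rewrite cimM /= -!RintegralZl// -RintegralD//; try exact: rintgZ.
by apply: eq_Rintegral => x _; rewrite cimM.
Qed.

Lemma cint0 : cint (fun=> 0) = 0.
Proof.
by apply: complex_ext => /=; rewrite Rintegral_cst// mul0r.
Qed.

Lemma cintg0 : cintg (fun=> 0).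
Proof. by split; exact: integrable0. Qed.

Lemma cintg_sum (I : Type) (r : seq I) (F : I -> T -> C) :
  (forall i, cintg (F i)) -> cintg (fun x => \sum_(i <- r) F i x).
Proof.
move=> h; elim: r => [|i r IH].
  by under eq_fun do rewrite big_nil; exact: cintg0.
by under eq_fun do rewrite big_cons; exact: cintgD.
Qed.

Lemma cint_sum (I : Type) (r : seq I) (F : I -> T -> C) :
  (forall i, cintg (F i)) ->
  cint (fun x => \sum_(i <- r) F i x) = \sum_(i <- r) cint (F i).
Proof.
move=> h; elim: r => [|i r IH].
  by rewrite big_nil -[RHS]cint0; apply: eq_cint => x; rewrite big_nil.
rewrite big_cons -IH -cintD//; last exact: cintg_sum.
by apply: eq_cint => x; rewrite big_cons.
Qed.

End complex_integral.

Section complex_limits.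
Variable R : realType.
Local Notation C := R[i].

Definition ccvg (u : nat -> C) (l : C) := (fun n => normc (u n - l)) @ \oo --> (0 : R).

Lemma ccvg_components u l : ccvg u l ->
  (fun n => Re (u n)) @ \oo --> Re l /\ (fun n => Im (u n)) @ \oo --> Im l.
Proof.
move=> h; split; apply/cvgrPdist_le => e e0.
  move/cvgrPdist_le : h => /(_ e e0); apply: filterS => n.
  rewrite sub0r normrN ger0_norm ?normc_ge0//; apply: le_trans.
  by rewrite distrC -creN -creD; exact: ler_Re_normc.
move/cvgrPdist_le : h => /(_ e e0); apply: filterS => n.
rewrite sub0r normrN ger0_norm ?normc_ge0//; apply: le_trans.
by rewrite distrC -cimN -cimD; exact: ler_Im_normc.
Qed.

Lemma ccvg_of_components (u : nat -> C) l :
  (fun n => Re (u n)) @ \oo --> Re l -> (fun n => Im (u n)) @ \oo --> Im l ->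
  ccvg u l.
Proof.
move=> h1 h2.
have h : (fun n => `|Re (u n) - Re l| + `|Im (u n) - Im l|) @ \oo --> (0 : R).
  rewrite -[X in _ --> X]addr0; apply: cvgD.
    rewrite -(@normr0 _ R) -(subrr (Re l)); apply: cvg_norm.
    by apply: cvgB => //; exact: cvg_cst.
  rewrite -(@normr0 _ R) -(subrr (Im l)); apply: cvg_norm.
  by apply: cvgB => //; exact: cvg_cst.
apply: (squeeze_cvgr _ (cvg_cst 0) h).
apply: nearW => n; rewrite normc_ge0 /= (le_trans (ler_normc_add _))//.
by rewrite creD creN cimD cimN.
Qed.

Lemma ccvg_norm_le (u : nat -> C) l (B : R) : ccvg u l ->
  (forall n, normc (u n) <= B) -> normc l <= B.
Proof.
move=> h uB; apply/ler_addgt0Pr => e e0.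
move/cvgrPdist_le : h => /(_ e e0) [N _ /(_ N (leqnn N))].
rewrite /= sub0r normrN ger0_norm ?normc_ge0// => h.
have -> : l = (l - u N) + u N by rewrite subrK.
by rewrite (le_trans (le_normcD _ _))// addrC lerD// normcB.
Qed.

Lemma ccvg_unique u l l' : ccvg u l -> ccvg u l' -> l = l'.
Proof.
move=> /ccvg_components[h1 h2] /ccvg_components[h3 h4].
by apply: complex_ext; [exact: (cvg_unique _ h1 h3)|exact: (cvg_unique _ h2 h4)].
Qed.

Lemma ccvgM u v l l' : ccvg u l -> ccvg v l' ->
  ccvg (fun n => u n * v n) (l * l').
Proof.
move=> /ccvg_components[h1 h2] /ccvg_components[h3 h4].
apply: ccvg_of_components.
  under eq_fun do rewrite creM; rewrite creM.
  by apply: cvgB; apply: cvgM.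
under eq_fun do rewrite cimM; rewrite cimM.
by apply: cvgD; apply: cvgM.
Qed.

Lemma ccvg_cst (c : C) : ccvg (fun=> c) c.
Proof. by rewrite /ccvg subrr normc0; exact: cvg_cst. Qed.

Lemma ccvg_prod (I : Type) (r : seq I) (u : I -> nat -> C) (l : I -> C) :
  (forall i, ccvg (u i) (l i)) ->
  ccvg (fun n => \prod_(i <- r) u i n) (\prod_(i <- r) l i).
Proof.
move=> h; elim: r => [|i r IH].
  by under eq_fun do rewrite big_nil; rewrite big_nil; exact: ccvg_cst.
under eq_fun do rewrite big_cons; rewrite big_cons; exact: ccvgM.
Qed.

Lemma dominated_ccvg d (T : measurableType d) (mu : {measure set T -> \bar R})
    (F : nat -> T -> C) (f : T -> C) (g : T -> R) :
  (forall n, cmeas (F n)) -> cmeas f -> rintg mu g ->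
  (forall x, ccvg (fun n => F n x) (f x)) ->
  {ae mu, forall x n, normc (F n x) <= g x} ->
  ccvg (fun n => cint mu (F n)) (cint mu f).
Proof.
move=> mF mf ig Ff Fg.
have key (p : C -> R) : (forall n, measurable_fun setT (fun x => p (F n x))) ->
    measurable_fun setT (fun x => p (f x)) ->
    (forall x, (fun n => p (F n x)) @ \oo --> p (f x)) ->
    (forall z, `|p z| <= normc z) ->
    (fun n => \int[mu]_x p (F n x)) @ \oo --> \int[mu]_x p (f x).
  move=> m1 m2 h1 h2.
  have c1 : {ae mu, forall x, setT x -> (fun n => (p (F n x))%:E) @ \oo --> (p (f x))%:E}.
    by apply: aeW => x _; apply: cvg_EFin; [exact: nearW|exact: h1].
  have c2 : {ae mu, forall x n, setT x -> (`|(p (F n x))%:E| <= (g x)%:E)%E}.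
    by apply: filterS Fg => x h n _; rewrite lee_fin (le_trans (h2 _) (h n)).
  have [h3 _ h4] := dominated_convergence measurableT
    (fun n => (measurable_EFinP _ _).2 (m1 n)) ((measurable_EFinP _ _).2 m2) c1 ig c2.
  rewrite /Rintegral; apply: fine_cvg; rewrite fineK//.
  exact: integrable_fin_num.
apply: ccvg_of_components => /=.
- by apply: (key (@complex.Re R)) => [n||x|z]; [exact: (mF n).1|exact: mf.1|
    exact: (ccvg_components (Ff x)).1|exact: ler_Re_normc].
- by apply: (key (@complex.Im R)) => [n||x|z]; [exact: (mF n).2|exact: mf.2|
    exact: (ccvg_components (Ff x)).2|exact: ler_Im_normc].
Qed.

End complex_limits.

(** * Product measures *)

Section complex_fubini.
Context d1 d2 (T1 : measurableType d1) (T2 : measurableType d2) (R : realType).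
Variables (m1 : {sigma_finite_measure set T1 -> \bar R}).
Variables (m2 : {sigma_finite_measure set T2 -> \bar R}).
Local Notation C := R[i].

Lemma Rintegral_fubini (f : T1 * T2 -> R) : rintg (m1 \x m2)%E f ->
  [/\ rintg m1 (fun x => \int[m2]_y f (x, y)),
      \int[(m1 \x m2)%E]_z f z = \int[m1]_x \int[m2]_y f (x, y) &
      \int[(m1 \x m2)%E]_z f z = \int[m2]_y \int[m1]_x f (x, y)].
Proof.
move=> jf; pose F := fubini_F m2 (EFin \o f); pose G := fubini_G m1 (EFin \o f).
have iF : m1.-integrable setT F by exact: integrable_fubini_F.
have mG' : measurable_fun setT G by apply: measurable_fubini_G; exact: jf.
have fF : {ae m1, forall x, setT x -> F x = (fine (F x))%:E}.
  by apply: filterS (integrable_ae measurableT iF) => x h /h; move=> /fineK.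
have fG : {ae m2, forall x, setT x -> G x = (fine (G x))%:E}.
  apply: filterS (ae_integrable2 jf) => y /= h _.
  by rewrite fineK//; exact: integrable_fin_num.
have mF : measurable_fun setT (fun x => (fine (F x))%:E).
  apply/measurable_EFinP; apply: measurableT_comp; first exact: fine_measurable.
  exact: measurable_int iF.
have mG : measurable_fun setT (fun x => (fine (G x))%:E).
  apply/measurable_EFinP; apply: measurableT_comp; first exact: fine_measurable.
  by [].
split.
- have /integrableP[mF' Foo] := iF; apply/integrableP; split => //.
  rewrite (ae_eq_integral (fun x => `|F x|)%E) //.
  - exact: measurableT_comp.
  - exact: measurableT_comp.
  - by apply: filterS fF => x h /h {1}->.
- rewrite /Rintegral -integral12_prod_meas1//; congr fine.
  by apply: ae_eq_integral => //; exact: measurable_int iF.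
- rewrite /Rintegral -integral21_prod_meas1//; congr fine.
  by apply: ae_eq_integral.
Qed.

Lemma cint_fubini1 (F : T1 * T2 -> C) : cintg (m1 \x m2)%E F ->
  cintg m1 (fun x => cint m2 (fun y => F (x, y))) /\
  cint (m1 \x m2)%E F = cint m1 (fun x => cint m2 (fun y => F (x, y))).
Proof.
move=> [/Rintegral_fubini[h1 h2 h3] /Rintegral_fubini[h1' h2' h3']].
by split => //; apply: complex_ext.
Qed.

Lemma cint_fubini2 (F : T1 * T2 -> C) : cintg (m1 \x m2)%E F ->
  cint (m1 \x m2)%E F = cint m2 (fun y => cint m1 (fun x => F (x, y))).
Proof.
move=> [/Rintegral_fubini[h1 h2 h3] /Rintegral_fubini[h1' h2' h3']].
by apply: complex_ext.
Qed.

Lemma measurable_comp_fst d (S : measurableType d) (f : T1 -> S) :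
  measurable_fun setT f -> measurable_fun setT (fun p : T1 * T2 => f p.1).
Proof. by move=> mf; exact: (measurableT_comp mf measurable_fst). Qed.

Lemma measurable_comp_snd d (S : measurableType d) (f : T2 -> S) :
  measurable_fun setT f -> measurable_fun setT (fun p : T1 * T2 => f p.2).
Proof. by move=> mf; exact: (measurableT_comp mf measurable_snd). Qed.

Lemma cmeas_fst (f : T1 -> C) : cmeas f -> cmeas (fun p : T1 * T2 => f p.1).
Proof. by move=> [h1 h2]; split; [exact: (measurable_comp_fst h1)|exact: (measurable_comp_fst h2)]. Qed.

Lemma cmeas_snd (f : T2 -> C) : cmeas f -> cmeas (fun p : T1 * T2 => f p.2).
Proof. by move=> [h1 h2]; split; [exact: (measurable_comp_snd h1)|exact: (measurable_comp_snd h2)]. Qed.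

Lemma rintg_prod2 (f : T1 -> R) (g : T2 -> R) : rintg m1 f -> rintg m2 g ->
  rintg (m1 \x m2)%E (fun p => f p.1 * g p.2).
Proof.
move=> jf jg.
have mfg : measurable_fun setT (EFin \o (fun p : T1 * T2 => f p.1 * g p.2)).
  apply/measurable_EFinP; apply: measurable_funM.
    exact: (measurable_comp_fst (rintg_meas jf)).
  exact: (measurable_comp_snd (rintg_meas jg)).
apply/(integrable12ltyP _ _ mfg).
have [mf foo] := integrableP _ _ _ jf; have [mg goo] := integrableP _ _ _ jg.
have mg' : measurable_fun setT (fun y => `|(g y)%:E|)%E by exact: measurableT_comp.
have mf' : measurable_fun setT (fun y => `|(f y)%:E|)%E by exact: measurableT_comp.
under eq_integral => x _ do under eq_integral => y _ do rewrite /= normrM EFinM.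
under eq_integral => x _.
  rewrite ge0_integralZl//.
  over.
rewrite /=.
rewrite ge0_integralZr//.
- by rewrite lte_mul_pinfty ?integral_ge0// ge0_fin_numE ?integral_ge0.
- by apply: integral_ge0 => x _; rewrite lee_fin.
Qed.

Lemma cint_prod2 (f : T1 -> C) (g : T2 -> C) : cintg m1 f -> cintg m2 g ->
  cintg (m1 \x m2)%E (fun p => f p.1 * g p.2) /\
  cint (m1 \x m2)%E (fun p => f p.1 * g p.2) = cint m1 f * cint m2 g.
Proof.
move=> jf jg.
have jfg : cintg (m1 \x m2)%E (fun p => f p.1 * g p.2).
  apply: (cintg_dom (g := fun p => normc (f p.1) * normc (g p.2))).
  - apply: cmeasM; first exact: (cmeas_fst (cintg_meas jf)).
    exact: (cmeas_snd (cintg_meas jg)).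
  - exact: (rintg_prod2 (cintg_normc jf) (cintg_normc jg)).
  - by apply: aeW => p; rewrite normcM.
split => //; have [_ ->] := cint_fubini1 jfg; rewrite /=.
rewrite mulrC -cintZ//; apply: eq_cint => x.
by rewrite cintZ// mulrC.
Qed.

End complex_fubini.

Section pushforward.
Context d1 d2 (X : measurableType d1) (Y : measurableType d2) (R : realType).
Variables (mu : {measure set X -> \bar R}) (nu : {measure set Y -> \bar R}).
Variables (phi : X -> Y) (mphi : measurable_fun setT phi).
Hypothesis nuE : nu = pushforward mu phi :> (set Y -> \bar R).

Lemma cmeas_comp (f : Y -> R[i]) : cmeas f -> cmeas (f \o phi).
Proof. by move=> [h1 h2]; split; [exact: (measurableT_comp h1 mphi)|exact: (measurableT_comp h2 mphi)]. Qed.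

Lemma rintg_pushforward (f : Y -> R) : measurable_fun setT f ->
  rintg mu (f \o phi) -> rintg nu f.
Proof.
move=> /measurable_EFinP mf jf; rewrite /rintg nuE.
exact: (integrable_pushforward mphi mf jf).
Qed.

Lemma cint_pushforward (f : Y -> R[i]) : cmeas f -> cintg mu (f \o phi) ->
  cintg nu f /\ cint nu f = cint mu (f \o phi).
Proof.
move=> [m1 m2] [i1 i2]; split.
  by split; [exact: rintg_pushforward m1 i1|exact: rintg_pushforward m2 i2].
apply: complex_ext; rewrite /= /Rintegral nuE; congr fine.
  by have /measurable_EFinP m1' := m1; exact: (integral_pushforward mphi m1' i1).
by have /measurable_EFinP m2' := m2; exact: (integral_pushforward mphi m2' i2).
Qed.

End pushforward.

Section lebesgue_products.
Variable R : realType.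
Local Notation C := R[i].
Local Notation leb := (@lebesgue_measure R).

Lemma cmeas_coord n (k : 'I_n) (f : R -> C) : cmeas f ->
  cmeas (fun x : 'cV[R]_n => f (x k 0)).
Proof. by move=> mf; exact: (cmeas_comp (measurable_coord k) mf). Qed.

Lemma lebesgue_cVS n : lebesgue_cV R n.+1 =
  pushforward (leb \x lebesgue_cV R n)%E (@cons_cV R n) :> (set 'cV[R]_n.+1 -> \bar R).
Proof. by []. Qed.

(** Induction on n: the measure on R^(n+1) is the image of a product measure. *)
Lemma cint_tensor n (psi : 'I_n -> R -> C) :
  (forall k, cintg leb (psi k)) ->
  cintg (lebesgue_cV R n) (fun x => \prod_(k < n) psi k (x k 0)) /\
  cint (lebesgue_cV R n) (fun x => \prod_(k < n) psi k (x k 0)) =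
    \prod_(k < n) cint leb (psi k).
Proof.
elim: n psi => [|n IH] psi jpsi.
  rewrite big_ord0.
  have -> : (fun x : 'cV[R]_0 => \prod_(k < 0) psi k (x k 0)) = (fun=> 1).
    by apply/funext => x; rewrite big_ord0.
  have fin : (lebesgue_cV R 0 setT < +oo)%E by rewrite /= diracT ltry.
  split; first split.
  - exact: (finite_measure_integrable_cst (@dirac _ 'cV[R]_0 0 R) 1).
  - exact: integrable0.
  apply: complex_ext; rewrite /= Rintegral_cst//= ?mul0r//.
  by rewrite indicT mul1r.
have [j1 e1] := IH (fun k => psi (lift ord0 k)) (fun k => jpsi _).
have [j2 e2] := cint_prod2 (jpsi ord0) j1.
have mpsi : cmeas (fun x : 'cV[R]_n.+1 => \prod_(k < n.+1) psi k (x k 0)).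
  by apply: cmeas_prod => k; apply: cmeas_coord; exact: cintg_meas (jpsi k).
have eE : (fun x : 'cV[R]_n.+1 => \prod_(k < n.+1) psi k (x k 0)) \o @cons_cV R n
   = (fun p => psi ord0 p.1 * \prod_(k < n) psi (lift ord0 k) (p.2 k 0)).
  apply/funext => p; rewrite /= big_ord_recl cons_cV0; congr (_ * _).
  by apply: eq_bigr => k _; rewrite cons_cVS.
pose M := [the {measure set _ -> \bar R} of (leb \x lebesgue_cV R n)%E].
have [j3 e3] := @cint_pushforward _ _ _ _ R M (lebesgue_cV R n.+1) (@cons_cV R n)
  (@measurable_cons_cV R n) (lebesgue_cVS n) _ mpsi
  (eq_ind_r (cintg (leb \x lebesgue_cV R n)%E) j2 eE).
split; first exact: j3.
by rewrite big_ord_recl -e1 -e2 -eE -e3.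
Qed.

Lemma rintg_tensor n (psi : 'I_n -> R -> R) :
  (forall k, rintg leb (psi k)) ->
  rintg (lebesgue_cV R n) (fun x => \prod_(k < n) psi k (x k 0)) /\
  \int[lebesgue_cV R n]_x (\prod_(k < n) psi k (x k 0)) =
    \prod_(k < n) \int[leb]_x psi k x.
Proof.
move=> jpsi.
have rC (I : Type) (r : seq I) (F : I -> R) :
    \prod_(k <- r) (F k)%:C = (\prod_(k <- r) F k)%:C.
  by rewrite (rmorph_prod (real_complex R)).
have [|[j _] e] := @cint_tensor n (fun k x => (psi k x)%:C).
  by move=> k; split => //=; exact: integrable0.
split.
  move: j; rewrite (_ : (fun x => _) = (fun x : 'cV[R]_n => \prod_(k < n) psi k (x k 0)))//.
  by apply/funext => x; rewrite rC.
have := congr1 (@complex.Re R) e.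
rewrite (eq_bigr (fun k => (\int[leb]_x psi k x)%:C)) => [|k _].
  by rewrite rC /= => <-; apply: eq_Rintegral => x _; rewrite rC.
by apply: complex_ext => //=; rewrite Rintegral_cst// mul0r.
Qed.

End lebesgue_products.

(** * Linear changes of variables *)

Section translation.
Variable R : realType.
Local Notation leb := (@lebesgue_measure R).

Lemma measurable_addr (c : R) : measurable_fun setT (fun x : R => x + c).
Proof. by apply: measurable_funD => //; exact: measurable_cst. Qed.

Lemma lebesgue_measure_translate (c : R) (A : set R) : measurable A ->
  leb ((fun x => x + c) @^-1` A) = leb A.
Proof.
move=> mA.
pose mu := measure_function_pushforward__canonical__measure_function_Measure
  leb (measurable_addr c : measurable_fun setT (fun x : measurableTypeR R => (x + c : measurableTypeR R))).
rewrite -[LHS]/(mu A); apply/esym; apply: lebesgue_measure_unique => // X [[a b] _ <-] /=.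
rewrite /pushforward (_ : _ @^-1` _ = `]a - c, b - c]%classic).
  rewrite !lebesgue_measure_itv /= !lte_fin ltrBlDr subrK; case: ifP => // _.
  by rewrite -!EFinB opprB addrA subrK.
by apply/seteqP; split=> x /=; rewrite !in_itv /= ltrBlDr lerBrDr.
Qed.

Lemma ge0_integral_translate (c : R) (f : R -> \bar R) : measurable_fun setT f ->
  (forall x, (0 <= f x)%E) -> (\int[leb]_x f (x + c)%R = \int[leb]_x f x)%E.
Proof.
move=> mf f0.
pose mu := measure_function_pushforward__canonical__measure_function_Measure
  leb (measurable_addr c : measurable_fun setT (fun x : measurableTypeR R => (x + c : measurableTypeR R))).
transitivity (\int[mu]_x f x)%E.
  rewrite (ge0_integral_pushforward (measurable_addr c : measurable_fun setT (fun x : measurableTypeR R => (x + c : measurableTypeR R))))//.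
by apply: eq_measure_integral => A mA _; exact: lebesgue_measure_translate.
Qed.

Lemma measurable_addcV n (c : 'cV[R]_n) : measurable_fun setT (fun x : 'cV[R]_n => x + c).
Proof.
apply/measurable_fun_cVP => i; under eq_fun do rewrite mxE.
by apply: measurable_funD; [exact: measurable_coord|exact: measurable_cst].
Qed.

Lemma measurable_mulmx m n (B : 'M[R]_(m, n)) :
  measurable_fun setT (fun x : 'cV[R]_n => B *m x).
Proof.
apply/measurable_fun_cVP => i; under eq_fun do rewrite mxE.
by apply: measurable_sum => k; apply: measurable_funM; [exact: measurable_cst|exact: measurable_coord].
Qed.

Lemma lebesgue_cV_translate n (c : 'cV[R]_n) (A : set 'cV[R]_n) : measurable A ->
  lebesgue_cV R n ((fun x => x + c) @^-1` A) = lebesgue_cV R n A.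
Proof.
elim: n c A => [|n IH] c A mA.
  congr (lebesgue_cV R 0 _); apply/seteqP; split=> x /=;
  by rewrite (_ : x + c = x)//; apply/colP; case.
rewrite /= /cons_measure /pushforward /product_measure1.
pose g x := lebesgue_cV R n (xsection (@cons_cV R n @^-1` A) x).
have mcA : measurable (@cons_cV R n @^-1` A).
  by rewrite -[X in measurable X]setTI; exact: measurable_cons_cV.
have mg : measurable_fun setT g by exact: measurable_fun_xsection.
rewrite -[RHS](@ge0_integral_translate (c ord0 0) g mg)//.
apply: eq_integral => x _; rewrite /g /=.
pose c' : 'cV[R]_n := \col_i c (lift ord0 i) 0.
rewrite -[RHS](IH c'); last exact: measurable_xsection.
congr (lebesgue_cV R n _); rewrite /xsection; apply/seteqP; split=> y /=; rewrite !inE /=.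
  rewrite (_ : cons_cV (x + c ord0 0, y + c') = cons_cV (x, y) + c)//.
  apply/colP => i; rewrite [RHS]mxE; have [j ->|->] := unliftP ord0 i.
    by rewrite !cons_cVS /= !mxE.
  by rewrite !cons_cV0.
rewrite (_ : cons_cV (x + c ord0 0, y + c') = cons_cV (x, y) + c)//.
apply/colP => i; rewrite [RHS]mxE; have [j ->|->] := unliftP ord0 i.
  by rewrite !cons_cVS /= !mxE.
by rewrite !cons_cV0.
Qed.

Lemma ge0_integral_translate_cV n (c : 'cV[R]_n) (f : 'cV[R]_n -> \bar R) :
  measurable_fun setT f -> (forall x, (0 <= f x)%E) ->
  (\int[lebesgue_cV R n]_x f (x + c)%R = \int[lebesgue_cV R n]_x f x)%E.
Proof.
move=> mf f0.
pose mu := measure_function_pushforward__canonical__measure_function_Measure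
  (lebesgue_cV R n) (measurable_addcV c).
transitivity (\int[mu]_x f x)%E.
  by rewrite (ge0_integral_pushforward (measurable_addcV c)).
by apply: eq_measure_integral => A mA _; exact: lebesgue_cV_translate.
Qed.

End translation.

Section linear_change.
Variables (R : realType) (n : nat) (B : 'M[R]_n).
Hypothesis uB : B \in unitmx.
Local Notation nu := (lebesgue_cV R n).
Local Notation mB := (measurable_mulmx B).

Definition cube (r : R) : set 'cV[R]_n := [set x | forall i, `[-r, r]%classic (x i 0)].

Lemma measurable_cube r : measurable (cube r).
Proof.
have -> : cube r = \bigcap_i ((fun x : 'cV[R]_n => x i 0) @^-1` `[-r, r]%classic).
  by apply/seteqP; split=> x /= h i; [move=> _|]; exact: h.
apply: fin_bigcap_measurable => [|i _]; first exact: finite_finset.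
by rewrite -[X in measurable X]setTI; exact: measurable_coord.
Qed.

Lemma lebesgue_cube r : 0 < r -> nu (cube r) = ((2 * r) ^+ n)%:E.
Proof.
move=> r0; rewrite /cube (@lebesgue_cV_box R n (fun=> `[-r, r]%classic))//.
under eq_bigr do rewrite lebesgue_measure_itv /= lte_fin gtrN// -EFinB opprK.
by rewrite prodEFin prodr_const card_ord mulr_natl mulr2n.
Qed.

Lemma measurable_preim (E : set 'cV[R]_n) : measurable E ->
  measurable ((fun x => B *m x) @^-1` E).
Proof. by move=> mE; rewrite -[X in measurable X]setTI; exact: mB. Qed.

Lemma measurable_indic_comp d (T : measurableType d) (E : set 'cV[R]_n)
    (phi : T -> 'cV[R]_n) : measurable E -> measurable_fun setT phi ->
  measurable_fun setT (fun p => \1_E (phi p) : R).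
Proof.
move=> mE mphi; apply: (measurableT_comp (f := \1_E : 'cV[R]_n -> R)) => //; exact: measurable_indic.
Qed.

(** Uniqueness of Haar measure, specialized: both sides compute the integral
    of 1_Q(Bx) 1_F(y + Bx), in the two orders, up to translations. *)
Lemma haar_exchange (F : set 'cV[R]_n) : measurable F ->
  (nu ((fun x => B *m x) @^-1` cube 1) * nu F =
   nu ((fun x => B *m x) @^-1` F) * nu (cube 1))%E.
Proof.
move=> mF.
pose f (p : 'cV[R]_n * 'cV[R]_n) : \bar R :=
  ((\1_(cube 1) (B *m p.1))%:E * (\1_F (p.2 + B *m p.1)%R)%:E)%E.
have mQ := measurable_cube 1.
have mf : measurable_fun setT f.
  apply: emeasurable_funM; apply/measurable_EFinP.
    apply: (measurable_indic_comp mQ).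
    exact: (measurable_comp_fst mB).
  apply: (measurable_indic_comp mF).
  apply/measurable_fun_cVP => i; under eq_fun do rewrite mxE.
  apply: measurable_funD; first exact: (measurable_comp_snd (measurable_coord i)).
  by have /measurable_fun_cVP := measurable_comp_fst (T2 := 'cV[R]_n) mB; exact.
have f0 p : (0 <= f p)%E by rewrite /f mule_ge0// lee_fin.
have ind (E : set 'cV[R]_n) : measurable E -> (\int[nu]_x (\1_E x)%:E)%E = nu E.
  by move=> mE; rewrite integral_indic// setIT.
have mind (E : set 'cV[R]_n) : measurable E -> measurable_fun setT (fun x : 'cV[R]_n => (\1_E x : R)%:E).
  by move=> mE; exact/measurable_EFinP.
have mindB (E : set 'cV[R]_n) : measurable E -> measurable_fun setT (fun x : 'cV[R]_n => (\1_E (B *m x) : R)%:E).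
  by move=> mE; apply: (measurableT_comp (mind E mE)); exact: mB.
have indB (E : set 'cV[R]_n) : measurable E -> (\int[nu]_x (\1_E (B *m x))%:E)%E = nu ((fun x => B *m x) @^-1` E).
  by move=> mE; rewrite -ind//; exact: measurable_preim.
have L : (\int[nu]_x \int[nu]_y f (x, y))%E = (nu ((fun x => B *m x) @^-1` cube 1) * nu F)%E.
  under eq_integral => x _.
    rewrite /f /= ge0_integralZl//; last first.
      by apply: (measurableT_comp (mind F mF)); exact: measurable_addcV.
    rewrite (@ge0_integral_translate_cV _ _ (B *m x) (fun y => (\1_F y)%:E))// ?ind//; last exact: mind.
    over.
  rewrite /= ge0_integralZr//; last exact: mindB.
  by rewrite indB.
have Rr : (\int[nu]_y \int[nu]_x f (x, y))%E = (nu ((fun x => B *m x) @^-1` F) * nu (cube 1))%E.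
  transitivity (\int[nu]_y \int[nu]_x ((\1_(cube 1) (B *m x - y)%R)%:E * (\1_F (B *m x))%:E))%E.
    apply: eq_integral => y _.
    rewrite -(@ge0_integral_translate_cV _ _ (- (invmx B *m y)) (fun x => f (x, y)))//; last first.
      exact: (measurableT_comp mf (pair2_measurable y)).
    apply: eq_integral => x _; rewrite /f /= mulmxDr mulmxN mulmxA mulmxV// mul1mx.
    by rewrite [(y + _)%R]addrC subrK.
  pose f' (p : 'cV[R]_n * 'cV[R]_n) : \bar R :=
    ((\1_(cube 1) (B *m p.1 - p.2)%R)%:E * (\1_F (B *m p.1))%:E)%E.
  have mf' : measurable_fun setT f'.
    apply: emeasurable_funM; apply/measurable_EFinP.
      apply: (measurable_indic_comp mQ).
      apply/measurable_fun_cVP => i; under eq_fun do rewrite !mxE.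
      apply: measurable_funB; last exact: (measurable_comp_snd (measurable_coord i)).
      have /measurable_fun_cVP /(_ i) := measurable_comp_fst (T2 := 'cV[R]_n) mB.
      by under eq_fun do rewrite mxE.
    apply: (measurable_indic_comp mF).
    exact: (measurable_comp_fst mB).
  have f'0 p : (0 <= f' p)%E by rewrite /f' mule_ge0// lee_fin.
  rewrite -(fubini_tonelli (m1 := nu) (m2 := nu) f' mf' f'0) /=.
  under eq_integral => x _.
    rewrite /f' /=.
    under eq_integral => y _.
      rewrite (_ : \1_(cube 1) (B *m x - y) = \1_(cube 1) (y + - (B *m x)) :> R); last first.
        rewrite !indicE; congr ((nat_of_bool _)%:R); apply/idP/idP; rewrite !inE /cube /= => h i.
          by have := h i; rewrite !in_itv /= !mxE; lra.
        by have := h i; rewrite !in_itv /= !mxE; lra.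
      over.
    rewrite /= ge0_integralZr//; last first.
      by apply: (measurableT_comp (mind _ mQ)); exact: measurable_addcV.
    rewrite (@ge0_integral_translate_cV _ _ (- (B *m x)) (fun y => (\1_(cube 1) y)%:E))// ?ind//; last exact: mind.
    over.
  rewrite /= ge0_integralZl//; last exact: mindB.
  by rewrite indB// muleC.
by rewrite -L (fubini_tonelli (m1 := nu) (m2 := nu) f mf f0).
Qed.

(** The exchange identity makes the two measures proportional; the preimage of
    the unit cube contains a cube and is contained in another one, so that the
    factor is positive and finite. *)
Lemma lebesgue_linear : exists2 c : R, 0 < c &
  forall F, measurable F -> nu ((fun x => B *m x) @^-1` F) = (c%:E * nu F)%E.
Proof.
pose Q := (fun x => B *m x) @^-1` cube 1.
have sub_le (M : 'M[R]_n) (r : R) x i : 0 <= r -> cube r x ->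
    `|(M *m x) i 0| <= r * \sum_i \sum_j `|M i j|.
  move=> r0 hx; rewrite mxE (le_trans (ler_norm_sum _ _ _))//.
  apply: (@le_trans _ _ (\sum_j r * `|M i j|)).
    apply: ler_sum => j _; rewrite normrM mulrC ler_wpM2r//.
    by have := hx j; rewrite /= in_itv /= ler_norml.
  rewrite -mulr_sumr ler_wpM2l// [leRHS](bigD1 i)//= lerDl.
  by apply: sumr_ge0 => k _; apply: sumr_ge0.
have S0 (M : 'M[R]_n) : 0 <= \sum_i \sum_j `|M i j|.
  by apply: sumr_ge0 => k _; apply: sumr_ge0.
have mQ : measurable Q by apply: measurable_preim; exact: measurable_cube.
have Qlt : (nu Q < +oo)%E.
  pose r := \sum_i \sum_j `|invmx B i j| + 1.
  have r0 : 0 < r by rewrite ltr_wpDl.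
  apply: (@le_lt_trans _ _ (nu (cube r))); last by rewrite lebesgue_cube// ltry.
  apply: le_measure; rewrite ?inE//; first exact: measurable_cube.
  move=> x Qx i; have := sub_le (invmx B) 1 (B *m x) i ler01 Qx.
  rewrite mulmxA mulVmx// mul1mx mul1r ler_norml /= in_itv /= /r; lra.
have Qgt : (0 < nu Q)%E.
  pose s := \sum_i \sum_j `|B i j| + 1.
  have s0 : 0 < s by rewrite ltr_wpDl.
  apply: (@lt_le_trans _ _ (nu (cube s^-1))).
    by rewrite lebesgue_cube ?invr_gt0// lte_fin exprn_gt0// mulr_gt0// invr_gt0.
  apply: le_measure; rewrite ?inE//; first exact: measurable_cube.
  move=> x hx i; have := sub_le B s^-1 x i (ltW _) hx; rewrite invr_gt0 => /(_ s0).
  have : s^-1 * \sum_i \sum_j `|B i j| <= 1 by rewrite mulrC ler_pdivrMr// mul1r /s lerDl.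
  by rewrite /= in_itv /= ler_norml; lra.
have e2 : 0 < 2 ^+ n :> R by rewrite exprn_gt0.
have Qfin : nu Q \is a fin_num by rewrite ge0_fin_numE.
exists (fine (nu Q) / 2 ^+ n).
  by rewrite divr_gt0// fine_gt0// Qgt.
move=> F mF; have := haar_exchange mF; rewrite -/Q lebesgue_cube// mulr1.
rewrite -(fineK Qfin) => h.
rewrite EFinM muleAC h -muleA -EFinM divff ?mule1// gt_eqF//.
Qed.

End linear_change.

Section linear_change_integral.
Variables (R : realType) (n : nat) (B : 'M[R]_n).
Hypothesis uB : B \in unitmx.
Local Notation nu := (lebesgue_cV R n).
Local Notation mB := (measurable_mulmx B).

(** The factor c is the Jacobian; its value only affects multiplicative constants. *)
Lemma linear_change_of_variables : exists2 c : R, 0 < c &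
 [/\ (forall f : 'cV[R]_n -> \bar R, measurable_fun setT f ->
       (forall x, (0 <= f x)%E) ->
       (\int[nu]_x f (B *m x)%R = c%:E * \int[nu]_x f x)%E),
     (forall f : 'cV[R]_n -> R[i], cintg nu f ->
       cintg nu (fun x => f (B *m x)) /\
       cint nu (fun x => f (B *m x)) = c%:C * cint nu f) &
     (forall P : 'cV[R]_n -> Prop, {ae nu, forall x, P x} ->
       {ae nu, forall x, P (B *m x)})].
Proof.
have [c c0 cE] := lebesgue_linear uB; exists c => //.
pose cn := NngNum (ltW c0).
have ge0 (f : 'cV[R]_n -> \bar R) : measurable_fun setT f ->
       (forall x, (0 <= f x)%E) ->
       (\int[nu]_x f (B *m x)%R = c%:E * \int[nu]_x f x)%E.
  move=> mf f0.
  pose mu := measure_function_pushforward__canonical__measure_function_Measure nu mB.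
  transitivity (\int[mu]_x f x)%E.
    by rewrite (ge0_integral_pushforward mB).
  transitivity (\int[mscale cn nu]_x f x)%E.
    by apply: eq_measure_integral => A mA _; rewrite -[LHS]/(nu _) cE.
  by rewrite ge0_integral_mscale.
have rint (f : 'cV[R]_n -> R) : rintg nu f -> rintg nu (fun x => f (B *m x)) /\
    \int[nu]_x f (B *m x) = c * \int[nu]_x f x.
  move=> jf; have mf := rintg_meas jf.
  have mfB : measurable_fun setT (fun x => f (B *m x)) by exact: (measurableT_comp mf mB).
  have [_ foo] := integrableP _ _ _ jf.
  have jfB : rintg nu (fun x => f (B *m x)).
    apply/integrableP; split; first exact/measurable_EFinP.
    rewrite (ge0 (fun x => `|(f x)%:E|%E))//; last first.
      by apply: measurableT_comp => //; exact/measurable_EFinP.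
    by rewrite lte_mul_pinfty// lee_fin ltW.
  split => //.
  have fp := integrable_pos_fin_num measurableT jf.
  have fn := integrable_neg_fin_num measurableT jf.
  rewrite /Rintegral integralE [in RHS]integralE.
  have mp : measurable_fun setT (EFin \o f)^\+%E by apply: measurable_funepos; exact/measurable_EFinP.
  have mn : measurable_fun setT (EFin \o f)^\-%E by apply: measurable_funeneg; exact/measurable_EFinP.
  have -> : (\int[nu]_x (fun x => (f (B *m x))%:E)^\+ x = c%:E * \int[nu]_x (EFin \o f)^\+ x)%E.
    by rewrite -ge0//; apply: eq_integral => x _; rewrite !funeposE.
  have -> : (\int[nu]_x (fun x => (f (B *m x))%:E)^\- x = c%:E * \int[nu]_x (EFin \o f)^\- x)%E.
    by rewrite -ge0//; apply: eq_integral => x _; rewrite !funenegE.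
  rewrite -(fineK fp) -(fineK fn) -!EFinM -!EFinB /=.
  by rewrite mulrBr.
split => //.
- move=> f [j1 j2]; have [k1 e1] := rint _ j1; have [k2 e2] := rint _ j2.
  split => //; apply: complex_ext; rewrite /= ?e1 ?e2; ring.
- move=> P [N [mN N0 PN]].
  exists ((fun x => B *m x) @^-1` N); split; first exact: measurable_preim.
    by rewrite [LHS]cE// N0 mule0.
  by move=> x /= h; apply: PN.
Qed.

End linear_change_integral.

(** * Exponential integrals and the Bargmann kernel *)

Section exponential_integral.
Context d (T : measurableType d) (R : realType) (mu : {measure set T -> \bar R}).
Variables (phi : T -> R[i]) (s : T -> R).
Hypotheses (mphi : cmeas phi) (ms : measurable_fun setT s).
Hypothesis jphi : forall c : R, 0 <= c ->
  rintg mu (fun x => normc (phi x) * expR (c * `|s x|)).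

Lemma exprn_le_expR (x : R) n : 0 <= x -> x ^+ n <= expR (n%:R * x).
Proof.
move=> x0; rewrite expRM_natl lerXn2r ?nnegrE ?expR_ge0//.
by rewrite (le_trans _ (expR_ge1Dx x))// lerDr.
Qed.

Lemma cintg_exponential n z :
  cintg mu (fun x => phi x * ((s x)%:C ^+ n * cexp (z * (s x)%:C))).
Proof.
apply: (cintg_dom (g := fun x => normc (phi x) * expR ((n%:R + normc z) * `|s x|))).
- apply: cmeasM => //; apply: cmeasM.
    under eq_fun do rewrite -rmorphXn; apply: cmeas_real.
    exact: measurable_funX.
  by apply: cmeas_cexp; apply: cmeasM; [exact: cmeas_cst|exact: cmeas_real].
- by apply: jphi; rewrite addr_ge0// normc_ge0.
- apply: aeW => x; rewrite !normcM ler_wpM2l ?normc_ge0// normcX normc_real.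
  rewrite mulrDl expRD ler_pM ?exprn_ge0 ?normc_ge0 ?exprn_le_expR//.
  rewrite normc_cexp ler_expR (le_trans (ler_norm _))// (le_trans (ler_Re_normc _))//.
  by rewrite normcM normc_real.
Qed.

Lemma cintg_exponential0 z : cintg mu (fun x => phi x * cexp (z * (s x)%:C)).
Proof.
have := cintg_exponential 0 z; congr cintg.
by apply/funext => x; rewrite expr0 mul1r.
Qed.

(** The second-order Taylor remainder of [cexp (w * s)] in w is dominated by the
    integrable exponentials of the hypothesis. *)
Lemma tay2_exponential z : tay2 (fun w => cint mu (fun x => phi x * cexp (w * (s x)%:C))) z.
Proof.
pose F n := cint mu (fun x => phi x * ((s x)%:C ^+ n * cexp (z * (s x)%:C))).
have j0 := cintg_exponential 0 z; have j1 := cintg_exponential 1 z.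
have j2 := cintg_exponential 2 z.
exists (F 1%N), (F 2%N / 2).
pose g x := normc (phi x) * expR ((normc z + 4) * `|s x|).
exists (2 * \int[mu]_x g x), 1; split => //.
  rewrite mulr_ge0//; apply: Rintegral_ge0 => x _.
  by rewrite mulr_ge0 ?normc_ge0 ?expR_ge0.
move=> h h1.
pose rem x := phi x * (cexp (z * (s x)%:C) *
  (cexp (h * (s x)%:C) - (1 + h * (s x)%:C + (h * (s x)%:C) ^+ 2 / 2))).
have -> : cint mu (fun x => phi x * cexp ((z + h) * (s x)%:C)) -
   (cint mu (fun x => phi x * cexp (z * (s x)%:C)) + F 1%N * h + F 2%N / 2 * h ^+ 2)
   = cint mu rem.
  have -> : cint mu (fun x => phi x * cexp ((z + h) * (s x)%:C)) =
    cint mu (fun x => rem x + (phi x * ((s x)%:C ^+ 0 * cexp (z * (s x)%:C)) +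
      (h * (phi x * ((s x)%:C ^+ 1 * cexp (z * (s x)%:C))) +
      (h ^+ 2 / 2) * (phi x * ((s x)%:C ^+ 2 * cexp (z * (s x)%:C)))))).
    apply: eq_cint => x; rewrite /rem mulrDl cexpD expr0 expr1; ring.
  have jrem : cintg mu rem.
    have := cintg_exponential0 (z + h); have := cintgD j0 (cintgD (cintgZ h j1) (cintgZ (h ^+ 2 / 2) j2)).
    move=> k1 k2; have := cintgD k2 (cintgZ (-1) k1); congr cintg.
    apply/funext => x; rewrite /rem mulrDl cexpD expr0 expr1; ring.
  have k1 := cintgZ h j1; have k2 := cintgZ (h ^+ 2 / 2) j2.
  have k12 := cintgD k1 k2; have k012 := cintgD j0 k12.
  rewrite (cintD jrem k012) (cintD j0 k12) (cintD k1 k2) !cintZ// -/(F 1%N) -/(F 2%N).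
  have -> : cint mu (fun x => phi x * ((s x)%:C ^+ 0 * cexp (z * (s x)%:C))) =
    cint mu (fun x => phi x * cexp (z * (s x)%:C)).
    by apply: eq_cint => x; rewrite expr0 mul1r.
  ring.
have mrem : cmeas rem.
  have mcs c : cmeas (fun x => c * (s x)%:C).
    by apply: cmeasM; [exact: cmeas_cst|exact: cmeas_real].
  apply: cmeasM => //; apply: cmeasM; first exact: cmeas_cexp.
  apply: cmeasD; first exact: cmeas_cexp.
  rewrite (_ : (fun x => _) = (fun x => (-1) + (- h) * (s x)%:C + (- h * (s x)%:C) * ((h / 2) * (s x)%:C))); last first.
    by apply/funext => x; ring.
  apply: cmeasD; last by apply: cmeasM.
  by apply: cmeasD; first exact: cmeas_cst.
apply: (@le_trans _ _ (2 * \int[mu]_x (normc h ^+ 3 * g x))); last first.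
  have jg : rintg mu g by apply: jphi; rewrite addr_ge0// normc_ge0.
  by rewrite RintegralZl//; rewrite le_eqVlt; apply/orP; left; apply/eqP; ring.
apply: normc_cint_le => //.
- by apply: rintgZ; apply: jphi; rewrite addr_ge0// normc_ge0.
- by move=> x; rewrite !mulr_ge0 ?exprn_ge0 ?normc_ge0 ?expR_ge0.
apply: aeW => x; rewrite /rem /g normcM mulrCA ler_wpM2l ?normc_ge0// normcM.
rewrite mulrDl expRD mulrCA ler_pM ?normc_ge0//.
  rewrite normc_cexp ler_expR (le_trans (ler_norm _))// (le_trans (ler_Re_normc _))//.
  by rewrite normcM normc_real.
rewrite (le_trans (cexp_taylor2 _))// normcM normc_real exprMn -mulrA.
rewrite ler_wpM2l ?exprn_ge0 ?normc_ge0//.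
apply: (@le_trans _ _ (expR (3 * `|s x|) * expR (1 * `|s x|))).
  rewrite ler_pM ?exprn_ge0 ?expR_ge0//; first by rewrite exprn_le_expR.
  by rewrite ler_expR ler_wpM2r.
by rewrite -expRD ler_expR -mulrDl ler_wpM2r// natr1.
Qed.

End exponential_integral.

Section one_dim.
Variable R : realType.
Local Notation C := R[i].
Local Notation leb := (@lebesgue_measure R).

Lemma meas_continuous (f : R -> R) : continuous f -> measurable_fun setT f.
Proof. by move=> cf; exact: continuous_measurable_fun. Qed.

Lemma measurable_absr : measurable_fun setT (fun x : R => `|x|).
Proof. by apply: meas_continuous; exact: norm_continuous. Qed.

Lemma measurable_powR_norm (a : R) : measurable_fun setT (fun x : R => `|x| `^ a).
Proof.
apply: (measurableT_comp (f := fun x : R => x `^ a)); first exact: measurable_powR.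
exact: measurable_absr.
Qed.

Lemma rintg_translate (c : R) (f : R -> R) : rintg leb f ->
  rintg leb (fun x => f (x + c)) /\ \int[leb]_x f (x + c) = \int[leb]_x f x.
Proof.
move=> jf; have mf := rintg_meas jf; have [_ foo] := integrableP _ _ _ jf.
have mfc : measurable_fun setT (fun x : R => f (x + c)).
  exact: (measurableT_comp mf (measurable_addr c)).
split.
  apply/integrableP; split; first exact/measurable_EFinP.
  rewrite (@ge0_integral_translate _ c (fun x => `|(f x)%:E|%E))//.
  by apply: measurableT_comp => //; exact/measurable_EFinP.
have mp : measurable_fun setT (EFin \o f)^\+%E by apply: measurable_funepos; exact/measurable_EFinP.
have mn : measurable_fun setT (EFin \o f)^\-%E by apply: measurable_funeneg; exact/measurable_EFinP.
rewrite /Rintegral integralE [in RHS]integralE; congr (fine (_ - _)%E).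
  rewrite -[RHS](@ge0_integral_translate _ c)//.
  by apply: eq_integral => x _; rewrite !funeposE.
rewrite -[RHS](@ge0_integral_translate _ c)//.
by apply: eq_integral => x _; rewrite !funenegE.
Qed.

Lemma cint_translate (c : R) (f : R -> C) : cintg leb f ->
  cintg leb (fun x => f (x + c)) /\ cint leb (fun x => f (x + c)) = cint leb f.
Proof.
move=> [/(rintg_translate c)[j1 e1] /(rintg_translate c)[j2 e2]].
by split => //; apply: complex_ext.
Qed.

Lemma rintg_gauss (b : R) : 0 < b -> rintg leb (fun x => expR (- (b * x ^+ 2))).
Proof.
move=> b0; pose s := Num.sqrt ((2 * b)^-1).
have s0 : 0 < s by rewrite sqrtr_gt0 invr_gt0 mulr_gt0.
have p0 : normal_peak s != 0 :> R by rewrite gt_eqF// normal_peak_gt0// gt_eqF.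
have := rintgZ (normal_peak s)^-1 (integrable_normal_pdf 0 s : rintg leb _).
congr rintg; apply/funext => x; rewrite /normal_pdf gt_eqF// mulKf// /normal_fun subr0.
congr expR; rewrite sqr_sqrtr ?invr_ge0 ?mulr_ge0 ?ltW//.
by field; rewrite gt_eqF.
Qed.

(** A power below 2 is absorbed by the Gaussian. *)
Lemma powR_le_sqr (a b lam : R) : 0 < a < 2 -> 0 < b -> 0 <= lam ->
  exists2 c : R, 0 <= c & forall x : R, lam * `|x| `^ a <= b * x ^+ 2 + c.
Proof.
move=> /andP[a0 a2] b0 l0; pose s := (lam / b) `^ (2 - a)^-1.
have s0 : 0 <= s by exact: powR_ge0.
exists (lam * s `^ a); first by rewrite mulr_ge0// powR_ge0.
move=> x; have [xs|sx] := leP `|x| s.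
  apply: (@le_trans _ _ (lam * s `^ a)); last by rewrite lerDr mulr_ge0 ?sqr_ge0// ltW.
  rewrite ler_wpM2l//; apply: (ge0_ler_powR (ltW a0)); rewrite ?nnegrE//.
apply: (@le_trans _ _ (b * x ^+ 2)); last by rewrite lerDl mulr_ge0// powR_ge0.
have x0 : 0 < `|x| by exact: le_lt_trans sx.
have -> : x ^+ 2 = `|x| `^ a * `|x| `^ (2 - a).
  rewrite -powRD; last by rewrite (gt_eqF x0) implybT.
  by rewrite addrC subrK powR_mulrn// real_normK// num_real.
rewrite mulrCA mulrC ler_wpM2l ?powR_ge0// -ler_pdivrMl// mulrC.
have a20 : 0 < 2 - a by rewrite subr_gt0.
apply: (@le_trans _ _ (s `^ (2 - a))).
  by rewrite -powRrM mulVf ?gt_eqF// powRr1// divr_ge0// ltW.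
by apply: (ge0_ler_powR (ltW a20)); rewrite ?nnegrE// ltW.
Qed.

Lemma rintg_subgauss (a b lam c : R) : 0 < a < 2 -> 0 < b -> 0 <= lam -> 0 <= c ->
  rintg leb (fun x => expR (- (b * x ^+ 2) + lam * `|x| `^ a + c * `|x|)).
Proof.
move=> a02 b0 l0 c0.
have b4 : 0 < b / 4 by rewrite divr_gt0.
have [C1 C10 H1] := powR_le_sqr a02 b4 l0.
have i1 : 0 < (1 : R) < 2 by lra.
have [C2 C20 H2] := powR_le_sqr i1 b4 c0.
have b2 : 0 < b / 2 by rewrite divr_gt0.
apply: (rintg_dom _ (rintgZ (expR (C1 + C2)) (rintg_gauss b2))).
  apply: (measurableT_comp (@measurable_expR R)).
  apply: measurable_funD; first apply: measurable_funD.
  - by apply: measurableT_comp => //; apply: measurable_funM => //; exact: measurable_funX.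
  - by apply: measurable_funM => //; exact: measurable_powR_norm.
  - by apply: measurable_funM => //; exact: measurable_absr.
apply: aeW => x; rewrite ger0_norm ?expR_ge0// -expRD ler_expR.
have := H1 x; have := H2 x; rewrite powRr1//; lra.
Qed.

(** The kernel of the Bargmann transform, with the variable rescaled by
    sqrt 2 so that it generates the Hermite polynomials. *)
Definition bargK (t : C) (x : R) : C :=
  cexp (2 * t * x%:C - t ^+ 2 - (x ^+ 2 / 2)%:C).

Lemma normc_bargK (u v x : R) :
  normc (bargK (u +i* v) x) = expR (2 * u * x - u ^+ 2 + v ^+ 2 - x ^+ 2 / 2).
Proof.
rewrite normc_cexp; congr expR.
have -> : (2 : C) = (2 : R)%:C by rewrite rmorph_nat.
by rewrite expr2 !reimE /= ?reimE /=; ring.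
Qed.

Lemma cmeas_bargK t : cmeas (bargK t).
Proof.
apply: cmeas_cexp; apply: cmeasD; first apply: cmeasD.
- by apply: cmeasM; [exact: cmeas_cst|apply: cmeas_real].
- exact: cmeas_cst.
- rewrite (_ : (fun x : R => _) = (fun x : R => (- (x ^+ 2 / 2))%:C)); last first.
    by apply/funext => x; rewrite rmorphN.
  apply: cmeas_real; apply: measurableT_comp => //.
  by apply: measurable_funM => //; exact: measurable_funX.
Qed.

Lemma normc_bargK_le (t : C) (x : R) :
  normc (bargK t x) <= expR (normc t ^+ 2) * expR (- (2^-1 * x ^+ 2) + 2 * normc t * `|x|).
Proof.
case: t => u v; rewrite normc_bargK -expRD ler_expR normc_sqr /=.
have : u * x <= Num.sqrt (u ^+ 2 + v ^+ 2) * `|x|.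
  rewrite (le_trans (ler_norm _))// normrM ler_wpM2r//.
  exact: (ler_Re_normc (u +i* v)).
have := sqr_ge0 u; rewrite expr2 => /= h.
by set N := Num.sqrt _; move: h; nra.
Qed.

Lemma rintg_bargK_exp (t : C) (c : R) : 0 <= c ->
  rintg leb (fun x => normc (bargK t x) * expR (c * `|x|)).
Proof.
move=> c0.
have i1 : 0 < (1 : R) < 2 by lra.
have h2 : 0 < 2^-1 :> R by rewrite invr_gt0.
have t0 : 0 <= 2 * normc t + c by rewrite addr_ge0// mulr_ge0// normc_ge0.
apply: (rintg_dom _ (rintgZ (expR (normc t ^+ 2)) (rintg_subgauss i1 h2 (lexx 0) t0))).
  apply: measurable_funM; first exact/cmeas_normc/cmeas_bargK.
  apply: (measurableT_comp (@measurable_expR R)).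
  by apply: measurable_funM => //; exact: measurable_absr.
apply: aeW => x; rewrite ger0_norm ?mulr_ge0 ?expR_ge0 ?normc_ge0//.
apply: (le_trans (ler_wpM2r (expR_ge0 _) (normc_bargK_le _ _))).
by rewrite -[leLHS]mulrA ler_wpM2l ?expR_ge0// -expRD ler_expR mul0r; lra.
Qed.

Lemma cintg_bargK t : cintg leb (bargK t).
Proof.
apply: (cintg_dom _ (rintg_bargK_exp t (lexx 0))); first exact: cmeas_bargK.
by apply: aeW => x; rewrite mul0r expR0 mulr1.
Qed.

(** Completing the square in x centres the Gaussian at Re t = u, and |x|^a is
    bounded by 2^a times the sum of |x - u|^a and |u|^a. *)
Lemma bargK_subgauss (a lam : R) : 0 < a < 2 -> 0 <= lam ->
  exists2 D : R, 0 <= D & forall u v : R,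
   rintg leb (fun x => expR (- (2^-1 * `|x| ^+ 2) + lam * `|x| `^ a) * normc (bargK (u +i* v) x)) /\
   \int[leb]_x (expR (- (2^-1 * `|x| ^+ 2) + lam * `|x| `^ a) * normc (bargK (u +i* v) x))
     <= D * expR (v ^+ 2 + 2 `^ a * lam * `|u| `^ a).
Proof.
move=> a02 l0; have [a0 a2] := andP a02.
have la0 : 0 <= 2 `^ a * lam by rewrite mulr_ge0// powR_ge0.
pose g (x : R) := expR (- (1 * x ^+ 2) + 2 `^ a * lam * `|x| `^ a + 0 * `|x|).
have jg : rintg leb g by exact: rintg_subgauss.
exists (\int[leb]_x g x); first by apply: Rintegral_ge0 => x _; exact: expR_ge0.
move=> u v.
have [jgu eg] := rintg_translate (- u) jg.
set W := expR (_ + 2 `^ a * lam * `|u| `^ a).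
have pw (x : R) : `|x| `^ a <= 2 `^ a * (`|x - u| `^ a + `|u| `^ a).
  pose m := Num.max `|x - u| `|u|.
  have m0 : 0 <= m by rewrite le_max normr_ge0.
  apply: (@le_trans _ _ ((2 * m) `^ a)).
    apply: (ge0_ler_powR (ltW a0)); rewrite ?nnegrE ?mulr_ge0//.
    rewrite -{1}(subrK u x) (le_trans (ler_normD _ _))// mulr_natl mulr2n.
    by rewrite lerD// /m le_max lexx ?orbT.
  rewrite powRM// ler_wpM2l ?powR_ge0// /m.
  by rewrite maxEle; case: ifP => _; rewrite ?lerDl ?lerDr; exact: powR_ge0.
have bnd (x : R) : expR (- (2^-1 * `|x| ^+ 2) + lam * `|x| `^ a) * normc (bargK (u +i* v) x)
    <= W * g (x - u).
  rewrite normc_bargK /W /g -!expRD ler_expR real_normK ?num_real//.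
  have := ler_wpM2l l0 (pw x); set X := `|x| `^ a; set Y := `|x - u| `^ a; set Z := `|u| `^ a.
  by rewrite sqrrB; lra.
have jb : rintg leb (fun x => expR (- (2^-1 * `|x| ^+ 2) + lam * `|x| `^ a) * normc (bargK (u +i* v) x)).
  apply: (rintg_dom _ (rintgZ W jgu)).
    apply: measurable_funM; last exact/cmeas_normc/cmeas_bargK.
    apply: (measurableT_comp (@measurable_expR R)).
    apply: measurable_funD; last by apply: measurable_funM => //; exact: measurable_powR_norm.
    apply: measurableT_comp => //; apply: measurable_funM => //.
    by apply: measurable_funX; exact: measurable_absr.
  by apply: aeW => x; rewrite ger0_norm ?mulr_ge0 ?expR_ge0 ?normc_ge0.
split => //.
apply: (@le_trans _ _ (\int[leb]_x (W * g (x - u)))).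
  by apply: le_Rintegral => //; exact: rintgZ.
by rewrite RintegralZl// eg mulrC.
Qed.

End one_dim.

(** * Gaussian integrals with complex parameters *)

Section gaussian_fourier.
Variable R : realType.
Local Notation C := R[i].
Local Notation leb := (@lebesgue_measure R).

(** The first-order coefficient can be computed along the real axis, where it vanishes. *)
Lemma tay2_real_invariant (F : C -> C) z : tay2 F z ->
  (forall h : R, F (z + h%:C) = F z) ->
  exists K d : R, [/\ 0 <= K, 0 < d & forall h, normc h <= d ->
    normc (F (z + h) - F z) <= K * normc h ^+ 2].
Proof.
move=> [F1 [F2 HF]] Finv.
have H2 : bigO_at0 2 (fun h => F (z + h) - (F z + F1 * h)).
  apply: (@bigO_ext _ _ (fun h => (F (z + h) - (F z + F1 * h + F2 * h ^+ 2)) + F2 * h ^+ 2)).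
    by move=> h; ring.
  by apply: bigOD; [exact: bigO_le HF|exact/bigOZ/bigOX].
have [K [d [K0 d0 d1 H]]] := H2.
suff F10 : F1 = 0.
  by exists K, d; split => // h hd; have := H h hd; rewrite F10 mul0r addr0.
apply: normc_eq0P; apply/eqP; rewrite eq_le normc_ge0 andbT.
apply/ler_addgt0Pr => e e0; rewrite add0r.
have K1 : 0 < K + 1 by rewrite ltr_wpDl.
pose t := Num.min d (e / (K + 1)).
have t0 : 0 < t by rewrite lt_min d0 divr_gt0.
have : t <= t by [].
rewrite {2}/t le_min => /andP[td te].
have := H t%:C; rewrite normc_real gtr0_norm// Finv => /(_ td).
rewrite opprD addNKr normcN normcM normc_real gtr0_norm// expr2 mulrA ler_pM2r//.
move=> /le_trans; apply; move: te; rewrite ler_pdivlMr// mulrC; apply: le_trans.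
by rewrite ler_wpM2r ?(ltW t0)// lerDl.
Qed.

(** An entire function invariant under real translations has derivative 0. *)
Lemma entire_const (F : C -> C) : (forall z, tay2 F z) ->
  (forall z (h : R), F (z + h%:C) = F z) -> forall z, F z = F 0.
Proof.
move=> FT Finv z.
have key (p : C -> R) : (forall w, `|p w| <= normc w) -> (forall u v, p (u - v) = p u - p v) ->
    p (F z) = p (F 0).
  move=> pn pB; pose g (t : R) := p (F (t%:C * z)).
  have <- : g 1 = p (F z) by rewrite /g rmorph1 mul1r.
  have <- : g 0 = p (F 0) by rewrite /g rmorph0 mul0r.
  apply: is_derive_0_is_cst => t.
  have [K [d [K0 d0 H]]] := tay2_real_invariant (FT (t%:C * z)) (Finv _).
  pose n := normc z + 1.
  have n0 : 0 < n by rewrite ltr_wpDl ?normc_ge0.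
  have cv : (fun h : R => h^-1 *: (g (h *: (1 : R) + t) - g t)) @ 0^' --> (0 : R).
    apply/cvgrPdist_le => e e0.
    have Kn : 0 < K * n ^+ 2 + 1 by rewrite ltr_wpDl// mulr_ge0// exprn_ge0// ltW.
    near=> h.
    have hn0 : h != 0 by near: h; exact: nbhs_dnbhs_neq.
    have hs : `|h| <= Num.min (d / n) (e / (K * n ^+ 2 + 1)).
      near: h; apply: dnbhs0_le; rewrite lt_min !divr_gt0//.
    move: hs; rewrite le_min => /andP[hd he].
    have hd' : normc (h%:C * z) <= d.
      rewrite normcM normc_real; move: hd; rewrite ler_pdivlMr//; apply: le_trans.
      by rewrite ler_wpM2l// /n lerDl.
    rewrite sub0r normrN /GRing.scale /= mulr1 normrM normfV ler_pdivrMl ?normr_gt0//.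
    rewrite /g -pB (le_trans (pn _))//.
    rewrite rmorphD mulrDl addrC [_ * z + _]addrC.
    rewrite [X in normc X]addrC (le_trans (H _ hd'))// normcM normc_real exprMn.
    rewrite mulrCA expr2 -!mulrA ler_wpM2l//.
    move: he; rewrite ler_pdivlMr//; apply: le_trans; rewrite ler_wpM2l//.
    apply: (@le_trans _ _ (K * n ^+ 2)); last by rewrite lerDl.
    by rewrite ler_wpM2l// lerXn2r ?nnegrE ?normc_ge0 ?(ltW n0)// /n lerDl.
  split; first by apply/cvg_ex; exists 0.
  by apply: cvg_lim => //; exact: cv.
apply: complex_ext; [apply: (key (@complex.Re R))|apply: (key (@complex.Im R))].
- exact: ler_Re_normc.
- by move=> u v; rewrite creD creN.
- exact: ler_Im_normc.
- by move=> u v; rewrite cimD cimN.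
Unshelve. all: by end_near.
Qed.

Section width.
Variables (b : R) (b0 : 0 < b).

Definition gaussC (x : R) : C := (expR (- (b * x ^+ 2)))%:C.
Definition gaussJ (w : C) : C := cint leb (fun x => gaussC x * cexp (w * x%:C)).
Definition gauss_mass : R := \int[leb]_x expR (- (b * x ^+ 2)).

Lemma gauss_mass_gt0 : 0 < gauss_mass.
Proof.
rewrite lt_neqAle; apply/andP; split; last first.
  by apply: Rintegral_ge0 => x _; exact: expR_ge0.
apply/negP => /eqP h0.
pose s := Num.sqrt ((2 * b)^-1).
have s0 : 0 < s by rewrite sqrtr_gt0 invr_gt0 mulr_gt0.
have := integral_normal_pdf (0 : R) s.
have E (x : R) : normal_pdf 0 s x = normal_peak s * expR (- (b * x ^+ 2)).
  rewrite /normal_pdf gt_eqF// /normal_fun subr0; congr (_ * expR _).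
  rewrite sqr_sqrtr ?invr_ge0 ?mulr_ge0 ?(ltW b0)//.
  by field; rewrite gt_eqF.
move=> /(congr1 fine) /=.
have -> : fine (\int[leb]_x (normal_pdf 0 s x)%:E)%E = \int[leb]_x (normal_peak s * expR (- (b * x ^+ 2))).
  by apply: eq_Rintegral => x _; exact: E.
rewrite RintegralZl//; last exact: (rintg_gauss b0).
by rewrite -/gauss_mass -h0 mulr0 => /esym/eqP; rewrite oner_eq0.
Qed.

Lemma cmeas_gaussC : cmeas gaussC.
Proof.
apply: cmeas_real; apply: (measurableT_comp (@measurable_expR R)).
by apply: measurableT_comp => //; apply: measurable_funM => //; exact: measurable_funX.
Qed.

Lemma jgauss (c : R) : 0 <= c ->
  rintg leb (fun x => normc (gaussC x) * expR (c * `|x|)).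
Proof.
move=> c0; have i1 : 0 < (1 : R) < 2 by lra.
have := rintg_subgauss i1 b0 (lexx 0) c0; congr rintg; apply/funext => x.
have -> : normc (gaussC x) = expR (- (b * x ^+ 2)).
  by rewrite /gaussC normc_real ger0_norm ?expR_ge0.
by rewrite -expRD mul0r addr0.
Qed.

Lemma cintg_gaussJ w : cintg leb (fun x => gaussC x * cexp (w * x%:C)).
Proof. by apply: (cintg_exponential0 _ _ jgauss); [exact: cmeas_gaussC|]. Qed.

Lemma gaussJ_translate w (h : R) :
  gaussJ (w + (2 * b * h)%:C) = cexp (w * h%:C + (b * h ^+ 2)%:C) * gaussJ w.
Proof.
rewrite /gaussJ -cintZ; last exact: cintg_gaussJ.
have [_ <-] := cint_translate h (cintg_gaussJ (w + (2 * b * h)%:C)).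
apply: eq_cint => x; rewrite /gaussC -!cexp_real -!cexpD; congr cexp.
by rewrite !(rmorphD, rmorphN, rmorphM, rmorphXn) /= ?rmorph_nat; ring.
Qed.

(** Both sides change by the same factor under real translations, so that their
    quotient is entire and invariant under these, hence constant. *)
Lemma gaussJE w : gaussJ w = gauss_mass%:C * cexp (w ^+ 2 / (4 * b)%:C).
Proof.
have bC : b%:C != 0 :> C by rewrite (fmorph_eq0 (real_complex R)) gt_eqF.
pose H w := gaussJ w * cexp (- (w ^+ 2 / (4 * b)%:C)).
have TJ z : tay2 gaussJ z.
  by apply: (tay2_exponential _ _ jgauss); [exact: cmeas_gaussC|].
have TH z : tay2 H z.
  apply: tay2M; first exact: TJ.
  apply: tay2_comp; last exact: tay2_cexp.
  rewrite (_ : (fun w => _) = (fun w => (- ((4 * b)%:C)^-1) * (w * w))); last first.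
    by apply/funext => u; rewrite expr2 mulNr mulrC.
  by apply: tay2Z; apply: tay2M; exact: tay2_id.
have Hinv z (h : R) : H (z + h%:C) = H z.
  have -> : h = 2 * b * (h / (2 * b)) by rewrite [RHS]mulrC divfK// mulf_neq0 ?gt_eqF.
  set k := h / _.
  rewrite /H gaussJ_translate mulrAC mulrC -cexpD; congr (_ * cexp _).
  by rewrite !(rmorphM, rmorphXn) /= !rmorph_nat; field.
have H0 : H 0 = gauss_mass%:C.
  rewrite /H expr0n /= mul0r oppr0 cexp0 mulr1 /gaussJ.
  have -> : (fun x : R => gaussC x * cexp (0 * x%:C)) =
      (fun x : R => (expR (- (b * x ^+ 2)))%:C).
    by apply/funext => x; rewrite mul0r cexp0 mulr1.
  by apply: complex_ext => //=; rewrite Rintegral_cst// mul0r.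
have := entire_const TH Hinv w; rewrite H0 /H => <-.
by rewrite -mulrA -cexpD addNr cexp0 mulr1.
Qed.

End width.

Lemma half_gt0 : 0 < 2^-1 :> R. Proof. by rewrite invr_gt0. Qed.

(** By [gaussJE] at b = 1/2: completing the square turns the parameter of the
    kernel by a right angle. *)
Lemma bargK_fourier (t : C) (y : R) :
  cint leb (fun x => bargK ((0 +i* 1) * t) x * cexp (- ((0 +i* 1) * (y * x)%:C))) =
  (gauss_mass 2^-1)%:C * bargK t y.
Proof.
have i2 : ((0 +i* 1) : C) * (0 +i* 1) = -1 by apply: complex_ext => /=; ring.
have -> : (fun x : R => bargK ((0 +i* 1) * t) x * cexp (- ((0 +i* 1) * (y * x)%:C))) =
   (fun x : R => cexp (t ^+ 2) * (gaussC 2^-1 x * cexp (((0 +i* 1) * (2 * t - y%:C)) * x%:C))).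
  apply/funext => x; rewrite /bargK /gaussC -cexp_real -!cexpD; congr cexp.
  rewrite !(rmorphN, rmorphM, rmorphXn) /= !fmorphV !rmorph_nat exprMn expr2 i2.
  by field.
rewrite cintZ; last exact: (cintg_gaussJ half_gt0).
rewrite -/(gaussJ _ _) (gaussJE half_gt0) mulrCA -cexpD; congr (_ * cexp _).
rewrite exprMn [(0 +i* 1) ^+ 2]expr2 i2 !(rmorphM, rmorphXn) /= fmorphV !rmorph_nat.
by field.
Qed.

(** The product of two kernels is a Gaussian times the exponential of a linear function. *)
Lemma bargK_pairing (s t : C) :
  cintg leb (fun x => bargK s x * bargK t x) /\
  cint leb (fun x => bargK s x * bargK t x) = (gauss_mass 1)%:C * cexp (2 * s * t).
Proof.
have -> : (fun x : R => bargK s x * bargK t x) =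
   (fun x : R => cexp (- (s ^+ 2 + t ^+ 2)) * (gaussC 1 x * cexp ((2 * (s + t)) * x%:C))).
  apply/funext => x; rewrite /bargK /gaussC -cexp_real -!cexpD; congr cexp.
  rewrite !(rmorphN, rmorphM, rmorphXn) /= !fmorphV !rmorph_nat.
  by field.
split; first exact: (cintgZ _ (cintg_gaussJ ltr01 _)).
rewrite cintZ; last exact: (cintg_gaussJ ltr01).
rewrite -/(gaussJ _ _) (gaussJE ltr01) mulrCA -cexpD; congr (_ * cexp _).
by rewrite mulr1 rmorph_nat; field.
Qed.

End gaussian_fourier.

(** * Hermite polynomials *)

Section hermite_polynomials.

(** [hq n x] is the value at x of H_n / n!, the n-th Hermite polynomial
    divided by n!; the pair carries two consecutive values. *)
Fixpoint hq2 (F : fieldType) (n : nat) (x : F) : F * F :=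
  if n is m.+1 then
    let p := hq2 m x in (p.2, (2 * x * p.2 - 2 * p.1) / (m.+2)%:R)
  else (1, 2 * x).

Definition hq (F : fieldType) (n : nat) (x : F) : F := (hq2 n x).1.

Lemma hq0 (F : fieldType) (x : F) : hq 0 x = 1. Proof. by []. Qed.
Lemma hq1 (F : fieldType) (x : F) : hq 1 x = 2 * x. Proof. by []. Qed.
Lemma hqSS (F : fieldType) n (x : F) :
  hq n.+2 x = (2 * x * hq n.+1 x - 2 * hq n x) / (n.+2)%:R.
Proof. by []. Qed.

Definition hqpred (F : fieldType) (n : nat) (x : F) : F :=
  if n is m.+1 then hq m x else 0.

Lemma nat_ind2 (P : nat -> Prop) : P 0%N -> P 1%N ->
  (forall n, P n -> P n.+1 -> P n.+2) -> forall n, P n.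
Proof.
move=> P0 P1 PS n; suff : P n /\ P n.+1 by case.
by elim: n => [//|n [h1 h2]]; split => //; exact: PS.
Qed.

Lemma hqS (F : numFieldType) n (x : F) :
  n.+1%:R * hq n.+1 x = 2 * x * hq n x - 2 * hqpred n x.
Proof.
case: n => [|n]; first by rewrite hq1 hq0 /= mulr1 mulr0 subr0 mul1r.
by rewrite hqSS mulrC divfK// pnatr_eq0.
Qed.

Variable R : realType.
Local Notation C := R[i].

Lemma hq_real n (x : R) : (hq n x)%:C = hq n x%:C.
Proof.
elim/nat_ind2: n => [||n h1 h2].
- by rewrite !hq0 rmorph1.
- by rewrite !hq1 rmorphM rmorph_nat.
by rewrite !hqSS -h1 -h2 rmorphM fmorphV !rmorph_nat rmorphB !rmorphM rmorph_nat.
Qed.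

Lemma is_cderive_hq n (x : R) (y : R -> C) dy : is_cderive x y dy ->
  is_cderive x (fun s => hq n (y s)) (2 * hqpred n (y x) * dy).
Proof.
move=> hy; elim/nat_ind2: n => [||n h1 h2].
- by apply: is_cderive_eq; [exact: is_cderive_cst|rewrite mulr0 mul0r].
- by apply: is_cderive_eq; [exact: (is_cderiveZ 2 hy)|rewrite /= hq0 mulr1].
under eq_fun do rewrite hqSS mulrC.
apply: is_cderive_eq.
  apply: is_cderiveZ; apply: is_cderiveD.
    by apply: is_cderiveM; [apply: is_cderiveZ; exact: hy|exact: h2].
  by apply: is_cderiveN; apply: is_cderiveZ; exact: h1.
rewrite [hqpred n.+2 _]/= [hqpred n.+1 _]/=.
have n2 : (n.+2%:R : C) != 0 by rewrite pnatr_eq0.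
apply: (mulfI n2); rewrite mulrA divff// mul1r.
have e := hqS n (y x).
transitivity (2 * hq n.+1 (y x) * dy + 2 * dy * (2 * y x * hq n (y x) - 2 * hqpred n (y x))).
  by ring.
by rewrite -e -[n.+2%:R]natr1; ring.
Qed.

(** Chain of derivatives along the segment from 0 to t of the generating
    function exp (2xt - t^2). *)
Definition genE (x : R) (t : C) k (s : R) : C :=
  t ^+ k * k`!%:R * hq k (x%:C - t * s%:C) * cexp (2 * x%:C * t * s%:C - t ^+ 2 * (s%:C * s%:C)).

Lemma genE_derive x t k (s : R) : is_cderive s (genE x t k) (genE x t k.+1 s).
Proof.
rewrite /genE; apply: is_cderive_eq.
  apply: is_cderiveM.
    apply: is_cderiveZ; apply: is_cderive_hq; apply: is_cderiveD.
      exact: is_cderive_cst.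
    by apply: is_cderiveN; apply: is_cderiveZ; exact: is_cderive_id.
  apply: is_cderive_cexp; apply: is_cderiveD.
    by apply: is_cderiveZ; exact: is_cderive_id.
  apply: is_cderiveN; apply: is_cderiveZ.
  by apply: is_cderiveM; exact: is_cderive_id.
set y := x%:C - _; set E := cexp _.
rewrite factS natrM.
transitivity (t ^+ k.+1 * k`!%:R * E * (k.+1%:R * hq k.+1 y)).
  by rewrite hqS [t ^+ k.+1]exprS /E /y; ring.
by ring.
Qed.

(** Induction along the three-term recursion. The parameter p distributes the
    factorial between the growth in n and the growth in w. *)
Lemma hq_growth (p kap : R) (w : C) n : 2^-1 <= p -> 0 < kap <= 1 ->
  n`!%:R `^ (1 - p) * normc (hq n w) <=
  (4 / kap) ^+ n * \sum_(m < n.+1) (kap * normc w) ^+ m / m`!%:R `^ p.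
Proof.
move=> p2 /andP[k0 k1].
have p0 : 0 <= p by rewrite (le_trans _ p2).
have f0 m : 0 < m`!%:R :> R by rewrite ltr0n fact_gt0.
pose F m : R := m`!%:R `^ p.
have F0 m : 0 < F m by exact: powR_gt0.
have FS m : F m.+1 = m.+1%:R `^ p * F m by rewrite /F factS natrM powRM.
pose D m := m`!%:R / F m * normc (hq m w).
have DE m : m`!%:R `^ (1 - p) * normc (hq m w) = D m.
  rewrite /D powRB; last by rewrite (gt_eqF (f0 m)) implybT.
  by rewrite powRr1// ltW.
pose W m := (kap * normc w) ^+ m / F m.
pose S m := \sum_(i < m.+1) W i.
have W0 m : 0 <= W m by rewrite divr_ge0 ?exprn_ge0 ?mulr_ge0 ?normc_ge0// ltW.
have S0 m : 0 <= S m by apply: sumr_ge0 => i _; exact: W0.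
have SS m : S m <= S m.+1 by rewrite /S [leRHS]big_ord_recr /= lerDl.
have e4 : 0 < 4 / kap by rewrite divr_gt0.
have step m : (4 / kap) ^+ m.+1 = 4 / kap * (4 / kap) ^+ m by rewrite exprS.
rewrite DE -/(S n).
elim/nat_ind2: n => [||n h1 h2].
- rewrite /D /S /W big_ord1 hq0 normc1 expr0 !mul1r mulr1 /F fact0.
  by rewrite powR1 invr1.
- rewrite /D /S /W !big_ord_recr big_ord0 /= hq1 expr0 !expr1 /F fact0 powR1 add0r.
  rewrite !invr1 !mul1r !mulr1 normcM.
  have -> : normc 2 = 2 :> R by rewrite -(rmorph_nat (real_complex R) 2) normc_real ger0_norm.
  rewrite mulrDr mulrA divfK ?gt_eqF//.
  by have := normc_ge0 w; move: e4; lra.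
have n2 : 0 < n.+2%:R :> R by rewrite ltr0n.
have rec : normc (hq n.+2 w) <= (2 * normc w * normc (hq n.+1 w) + 2 * normc (hq n w)) / n.+2%:R.
  rewrite hqSS normcM.
  have -> : normc (n.+2%:R^-1) = (n.+2%:R : R)^-1.
    by rewrite normcV -(rmorph_nat (real_complex R)) normc_real ger0_norm// ltW.
  rewrite ler_wpM2r ?invr_ge0 ?(ltW n2)// (le_trans (le_normcD _ _))// normcN !normcM.
  by have -> : normc 2 = 2 :> R by rewrite -(rmorph_nat (real_complex R) 2) normc_real ger0_norm.
have q1 : D n.+2 <= 2 * normc w * D n.+1 / n.+2%:R `^ p + 2 * D n.
  apply: (@le_trans _ _ (n.+2`!%:R / F n.+2 * ((2 * normc w * normc (hq n.+1 w) + 2 * normc (hq n w)) / n.+2%:R))).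
    by rewrite /D ler_wpM2l// divr_ge0// ltW.
  have -> : n.+2`!%:R / F n.+2 * ((2 * normc w * normc (hq n.+1 w) + 2 * normc (hq n w)) / n.+2%:R) =
    2 * normc w * D n.+1 / n.+2%:R `^ p + n.+1%:R / (n.+2%:R `^ p * n.+1%:R `^ p) * (2 * D n).
    rewrite /D !FS (factS n.+1) (factS n) !natrM.
    have h1' : n.+2%:R `^ p != 0 :> R by rewrite gt_eqF// powR_gt0.
    have h2' : n.+1%:R `^ p != 0 :> R by rewrite gt_eqF// powR_gt0.
    by field; rewrite !gt_eqF// ltr0n.
  rewrite lerD2l ler_piMl//.
    by rewrite mulr_ge0// /D mulr_ge0 ?normc_ge0// divr_ge0// ltW.
  rewrite ler_pdivrMr ?mulr_gt0 ?powR_gt0// mul1r -powRM//.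
  apply: (@le_trans _ _ ((n.+1%:R * n.+1%:R) `^ 2^-1)).
    by rewrite -expr2 powR12_sqrt// sqrtr_sqr ger0_norm.
  apply: (@le_trans _ _ ((n.+1%:R * n.+1%:R) `^ p)).
    by apply: ler_powR => //; rewrite -natrM ler1n.
  apply: ge0_ler_powR => //; rewrite ?nnegrE ?mulr_ge0//.
  by rewrite ler_wpM2r// ler_nat.
have q2 : normc w * S n.+1 / n.+2%:R `^ p <= S n.+2 / kap.
  rewrite ler_pdivlMr// -(ler_pM2r (_ : 0 < n.+2%:R `^ p)) ?powR_gt0//.
  rewrite mulrAC divfK ?gt_eqF ?powR_gt0// /S [in leRHS]big_ord_recl /= mulrDl.
  apply: ler_wpDl; first by rewrite mulr_ge0// powR_ge0.
  rewrite mulr_sumr !mulr_suml; apply: ler_sum => i _.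
  rewrite /W /bump /= add1n exprS FS.
  have -> : normc w * ((kap * normc w) ^+ i / F i) * kap =
    kap * normc w * (kap * normc w) ^+ i / (i.+1%:R `^ p * F i) * i.+1%:R `^ p.
    have h1' : i.+1%:R `^ p != 0 :> R by rewrite gt_eqF// powR_gt0.
    by field; rewrite h1' gt_eqF.
  rewrite ler_wpM2l//.
    rewrite divr_ge0 ?mulr_ge0 ?exprn_ge0 ?normc_ge0 ?powR_ge0 ?(ltW (F0 _)) ?(ltW k0)//.
    by rewrite mulr_ge0 ?normc_ge0// ltW.
  apply: ge0_ler_powR => //; rewrite ?nnegrE// ler_nat.
  exact: ltn_ord.
apply: (le_trans q1).
have w0 := normc_ge0 w.
have r1 : 2 * normc w * D n.+1 / n.+2%:R `^ p <= 2 * (4 / kap) ^+ n.+1 * (S n.+2 / kap).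
  have -> : 2 * normc w * D n.+1 / n.+2%:R `^ p = 2 * (normc w / n.+2%:R `^ p) * D n.+1.
    by rewrite mulrAC mulrA.
  apply: (@le_trans _ _ (2 * (normc w / n.+2%:R `^ p) * ((4 / kap) ^+ n.+1 * S n.+1))).
    by rewrite ler_wpM2l// mulr_ge0// divr_ge0// powR_ge0.
  have -> : 2 * (normc w / n.+2%:R `^ p) * ((4 / kap) ^+ n.+1 * S n.+1) =
    2 * (4 / kap) ^+ n.+1 * (normc w * S n.+1 / n.+2%:R `^ p) by ring.
  by rewrite ler_wpM2l// mulr_ge0// exprn_ge0// ltW.
have r2 : 2 * D n <= 2 * ((4 / kap) ^+ n * S n.+2).
  rewrite ler_wpM2l// (le_trans h1)// ler_wpM2l ?exprn_ge0 ?(ltW e4)//.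
  by rewrite (le_trans (SS _))// SS.
apply: (le_trans (lerD r1 r2)).
rewrite !step; set P := (4 / kap) ^+ n; set k' := kap^-1.
have P0 : 0 <= P * S n.+2 by rewrite mulr_ge0// exprn_ge0// ltW.
have k'1 : 1 <= k' by rewrite invf_ge1.
have : 1 <= k' * k' by rewrite -expr2 expr_ge1// (le_trans _ k'1).
rewrite /k' => kk.
have -> : 2 * (4 / kap * P) * (S n.+2 / kap) + 2 * (P * S n.+2) =
  (P * S n.+2) * (8 * (kap^-1 * kap^-1) + 2) by ring.
have -> : 4 / kap * (4 / kap * P) * S n.+2 = (P * S n.+2) * (16 * (kap^-1 * kap^-1)) by ring.
by rewrite ler_wpM2l//; move: kk; lra.
Qed.

Lemma exp_fact_le (x : R) m : 0 <= x -> x ^+ m / m`!%:R <= expR x.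
Proof.
move=> x0; have := @exp_coeff_ge0 R x m x0; rewrite /exp_coeff /= => _.
have := nondecreasing_cvgn_le (nondecreasing_series (P := xpredT) (fun n _ _ => exp_coeff_ge0 n x0)) (is_cvg_series_exp_coeff x) m.+1.
rewrite /series /= big_nat_recr //=; apply: le_trans.
by rewrite lerDr; apply: sumr_ge0 => i _; exact: exp_coeff_ge0.
Qed.

(** For p = 1/a every term of the sum in [hq_growth] is the power 1/a of a term of
    the exponential series of (kap |w|)^a; doubling the base absorbs the number
    of terms. *)
Lemma hq_growth_exp (a kap : R) (w : C) n : 0 < a <= 2 -> 0 < kap <= 1 ->
  n`!%:R `^ (1 - a^-1) * normc (hq n w) <=
  (8 / kap) ^+ n * expR (kap `^ a / a * normc w `^ a).
Proof.
move=> /andP[a0 a2] k01; have /andP[k0 k1] := k01.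
have p2 : 2^-1 <= a^-1 by rewrite lef_pV2 ?posrE.
rewrite (le_trans (hq_growth w n p2 k01))//.
have W (m : nat) : (kap * normc w) ^+ m / m`!%:R `^ a^-1 <= expR (kap `^ a / a * normc w `^ a).
  pose s := (kap * normc w) `^ a.
  have kw0 : 0 <= kap * normc w by rewrite mulr_ge0 ?normc_ge0// ltW.
  have f0 : 0 < m`!%:R :> R by rewrite ltr0n fact_gt0.
  have -> : (kap * normc w) ^+ m / m`!%:R `^ a^-1 = (s ^+ m / m`!%:R) `^ a^-1.
    rewrite powRM ?exprn_ge0 ?powR_ge0 ?invr_ge0 ?(ltW f0)//.
    have -> : m`!%:R^-1 `^ a^-1 = (m`!%:R `^ a^-1)^-1 :> R.
      have nz : m`!%:R `^ a^-1 != 0 :> R by rewrite gt_eqF// powR_gt0.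
      apply: (mulfI nz); rewrite divff// -powRM ?invr_ge0 ?(ltW f0)//.
      by rewrite divff ?gt_eqF// powR1.
    congr (_ / _); rewrite /s -!powR_mulrn ?powR_ge0// -!powRrM.
    by rewrite mulrCA divff ?mulr1// gt_eqF.
  have -> : kap `^ a / a * normc w `^ a = s * a^-1.
    by rewrite /s powRM ?normc_ge0 ?(ltW k0)//; ring.
  rewrite expRM; apply: ge0_ler_powR; rewrite ?nnegrE ?invr_ge0 ?(ltW a0) ?expR_ge0//.
    by rewrite divr_ge0 ?exprn_ge0 ?powR_ge0// ltW.
  by apply: exp_fact_le; exact: powR_ge0.
apply: (@le_trans _ _ ((4 / kap) ^+ n * (2 ^+ n * expR (kap `^ a / a * normc w `^ a)))).
  rewrite ler_wpM2l ?exprn_ge0 ?divr_ge0 ?(ltW k0)//.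
  apply: (@le_trans _ _ (\sum_(m < n.+1) expR (kap `^ a / a * normc w `^ a))).
    by apply: ler_sum => m _; exact: W.
  rewrite sumr_const card_ord -[leLHS]mulr_natl ler_wpM2r ?expR_ge0//.
  by rewrite -natrX ler_nat ltn_expl.
rewrite mulrA -exprMn le_eqVlt; apply/orP; left; apply/eqP; congr (_ ^+ _ * _).
by rewrite mulrAC -natrM.
Qed.

End hermite_polynomials.

(** * Taylor coefficients by averages over roots of unity *)

Section roots_of_unity.
Variable R : realType.
Local Notation C := R[i].

Definition zeta (N k : nat) : C := cexp (0 +i* (2 * pi * k%:R / N%:R)).

Lemma zeta_norm N k : normc (zeta N k) = 1.
Proof. by rewrite normc_cexp expR0. Qed.

Lemma zeta_neq0 N k : zeta N k != 0.
Proof. exact: cexp_neq0. Qed.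

Lemma zetaE N k : zeta N k = zeta N 1 ^+ k.
Proof.
rewrite /zeta cexpX; congr cexp.
have -> : (k%:R : C) = (k%:R : R)%:C by rewrite rmorph_nat.
by apply: complex_ext => /=; ring.
Qed.

Lemma zeta_root N : (0 < N)%N -> zeta N 1 ^+ N = 1.
Proof.
move=> N0; rewrite -zetaE /zeta mulfK ?pnatr_eq0 -?lt0n//.
apply: complex_ext; rewrite /= expR0 mul1r.
  by rewrite mulr_natl cos2pi.
by rewrite mulr_natl sin2pi.
Qed.

Lemma zeta_primitive N m : (0 < m < N)%N -> zeta N 1 ^+ m != 1.
Proof.
move=> /andP[m0 mN]; rewrite -zetaE; apply/eqP => /(congr1 (@complex.Re R)) /=.
rewrite expR0 mul1r.
pose th : R := pi * m%:R / N%:R.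
have -> : 2 * pi * m%:R / N%:R = th *+ 2 by rewrite -[RHS]mulr_natl /th; ring.
rewrite cos_mulr2n cos2sin2 => h.
have N0 : 0 < N%:R :> R by rewrite ltr0n (leq_trans _ mN).
have sp : 0 < sin th.
  apply: sin_gt0_pi; apply/andP; split.
    by rewrite divr_gt0// mulr_gt0 ?pi_gt0// ltr0n.
  by rewrite ltr_pdivrMr// ltr_pM2l ?pi_gt0// ltr_nat.
have : sin th ^+ 2 = 0 by move: h; rewrite mulr2n; lra.
by move=> /eqP; rewrite sqrf_eq0 => /eqP s0; move: sp; rewrite s0 ltxx.
Qed.

Lemma zeta_orthogonal N m n : (m < N)%N -> (n < N)%N ->
  \sum_(k < N) zeta N k ^+ m / zeta N k ^+ n = (m == n)%:R * N%:R.
Proof.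
move=> mN nN.
have N0 : (0 < N)%N by apply: leq_ltn_trans mN.
have zn0 k : zeta N 1 ^+ k != 0 by rewrite expf_neq0// zeta_neq0.
pose z := zeta N 1 ^+ m / zeta N 1 ^+ n.
have zk (k : 'I_N) : zeta N k ^+ m / zeta N k ^+ n = z ^+ k.
  by rewrite zetaE -!exprM mulnC [(k * n)%N]mulnC !exprM -expr_div_n.
rewrite (eq_bigr _ (fun k _ => zk k)).
have [mn|mn] := eqVneq m n.
  rewrite mul1r (eq_bigr (fun=> 1)) => [|k _]; first by rewrite sumr_const card_ord.
  by rewrite /z mn divff// expr1n.
rewrite mul0r; have zN : z ^+ N = 1.
  by rewrite /z expr_div_n -!exprM ![(_ * N)%N]mulnC !exprM zeta_root// !expr1n divr1.
have z1 : z != 1.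
  have [lt|le] := ltnP m n.
    apply/eqP => h.
    have := @zeta_primitive N (n - m); rewrite subn_gt0 lt (leq_ltn_trans (leq_subr _ _) nN).
    move=> /(_ isT)/eqP; apply.
    have e : zeta N 1 ^+ n = zeta N 1 ^+ m by rewrite -[RHS](divfK (zn0 n)) -/z h mul1r.
    by apply: (mulfI (zn0 m)); rewrite -exprD subnKC ?(ltnW lt)// mulr1.
  have lt : (n < m)%N by rewrite ltn_neqAle eq_sym mn.
  apply/eqP => h.
  have := @zeta_primitive N (m - n); rewrite subn_gt0 lt (leq_ltn_trans (leq_subr _ _) mN).
  move=> /(_ isT)/eqP; apply.
  have e : zeta N 1 ^+ n = zeta N 1 ^+ m by rewrite -[RHS](divfK (zn0 n)) -/z h mul1r.
  by apply: (mulfI (zn0 n)); rewrite -exprD subnKC// mulr1.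
apply/eqP; have := subrX1 z N; rewrite zN subrr => /esym/eqP.
by rewrite mulf_eq0 subr_eq0 (negPf z1).
Qed.

(** Discrete Cauchy integral: the average over the N-th roots of unity that
    extracts the n-th Taylor coefficient, up to aliasing. *)
Definition cavg (F : C -> C) (N : nat) (rho : C) (n : nat) : C :=
  N%:R^-1 * \sum_(k < N) F (rho * zeta N k) / zeta N k ^+ n.

Lemma normc_cavg F N rho n (M : R) : (0 < N)%N ->
  (forall z, normc z = normc rho -> normc (F z) <= M) ->
  normc (cavg F N rho n) <= M.
Proof.
move=> N0 FM; have Np : 0 < N%:R :> R by rewrite ltr0n.
rewrite /cavg normcM normcV -(rmorph_nat (real_complex R)) normc_real (ger0_norm (ltW Np)).
rewrite ler_pdivrMl// (le_trans (normc_sum _ _ _))//.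
apply: (@le_trans _ _ (\sum_(k < N) M)).
  apply: ler_sum => k _; rewrite normcM normcV normcX zeta_norm expr1n invr1 mulr1.
  by apply: FM; rewrite normcM zeta_norm mulr1.
by rewrite sumr_const card_ord mulr_natl.
Qed.

Lemma cavg_poly N rho n (e : nat -> C) : (n < N)%N ->
  cavg (fun t => \sum_(k < N) t ^+ k * e k) N rho n = rho ^+ n * e n.
Proof.
move=> nN; have N0 : (N%:R : C) != 0 by rewrite pnatr_eq0 -lt0n (leq_ltn_trans _ nN).
rewrite /cavg; apply: (mulfI N0); rewrite mulrA divff// mul1r.
under eq_bigr => k _ do rewrite mulr_suml.
rewrite exchange_big /=.
transitivity (\sum_(j < N) rho ^+ j * e j * ((nat_of_ord j == n)%:R * N%:R)).
  apply: eq_bigr => j _; rewrite -(zeta_orthogonal (ltn_ord j) nN) mulr_sumr.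
  by apply: eq_bigr => k _; rewrite exprMn; ring.
rewrite (bigD1 (Ordinal nN))//= eqxx mul1r big1 ?addr0; first by ring.
move=> j jn; have -> : (nat_of_ord j == n) = false; last by rewrite mul0r mulr0.
by apply/negbTE; apply: contra jn => /eqP jn; apply/eqP/val_inj.
Qed.

Lemma cavgB F G N rho n :
  cavg F N rho n - cavg G N rho n = cavg (fun t => F t - G t) N rho n.
Proof.
rewrite /cavg -mulrBr; congr (_ * _); rewrite -sumrB; apply: eq_bigr => k _.
by rewrite mulrBl.
Qed.

(** The average is exact on polynomials of degree below N and does not increase
    the supremum over the circle. *)
Lemma cavg_cvg (F : C -> C) (e : nat -> C) (rho : C) n (r : nat -> R) :
  r @ \oo --> (0 : R) ->
  (forall N t, normc t = normc rho ->
     normc (F t - \sum_(k < N) t ^+ k * e k) <= r N) ->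
  ccvg (fun N => cavg F N.+1 rho n) (rho ^+ n * e n).
Proof.
move=> r0 Fr.
have rS : (fun N => r N.+1) @ \oo --> (0 : R) by rewrite cvg_shiftS.
apply: (squeeze_cvgr _ (cvg_cst 0) rS).
exists n => // N /= nN; rewrite normc_ge0 /=.
rewrite -(@cavg_poly N.+1 rho n e)// cavgB.
by apply: normc_cavg => // z hz; exact: Fr.
Qed.

Lemma cvg_expn_fact (x : R) : (fun N => x ^+ N / N`!%:R) @ \oo --> (0 : R).
Proof.
have := cvg_series_cvg_0 (is_cvg_series_exp_coeff x).
by rewrite /exp_coeff.
Qed.

Lemma cexp_extract (c rho : C) n :
  ccvg (fun N => cavg (fun t => cexp (c * t)) N.+1 rho n) (rho ^+ n * (c ^+ n / n`!%:R)).
Proof.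
pose x := normc c * normc rho.
apply: (@cavg_cvg _ (fun n => c ^+ n / n`!%:R) _ _ (fun N => 2 * expR x * (x ^+ N / N`!%:R))).
  rewrite -[X in _ --> X](mulr0 (2 * expR x)).
  by apply: cvgM; [exact: cvg_cst|exact: cvg_expn_fact].
move=> N t ht; pose z := c * t.
have nz : normc z = x by rewrite normcM ht.
pose e k (s : R) := z ^+ k * cexp (s%:C * z).
have De k (s : R) : is_cderive s (e k) (e k.+1 s).
  apply: is_cderive_eq.
    apply: is_cderiveZ; apply: is_cderive_cexp.
    by apply: is_cderiveM; [exact: is_cderive_id|exact: is_cderive_cst].
  by rewrite /e exprS; ring.
have eM (s : R) : 0 <= s <= 1 -> normc (e N s) <= x ^+ N * expR x.
  move=> /andP[s0 s1].
  rewrite /e normcM normcX nz ler_wpM2l ?exprn_ge0 -?nz ?normc_ge0// normc_cexp ler_expR.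
  rewrite creM /= mul0r subr0 (le_trans (ler_norm _))// normrM (ger0_norm s0).
  by rewrite (le_trans (ler_wpM2l s0 (ler_Re_normc _)))// ler_piMl ?normc_ge0.
have := ctaylor_bound De eM; rewrite /e expr0 mul1r rmorph1 mul1r -/z.
have -> : 2 * (x ^+ N * expR x) / N`!%:R = 2 * expR x * (x ^+ N / N`!%:R) by ring.
apply: le_trans; rewrite le_eqVlt; apply/orP; left; apply/eqP; congr (normc (_ - _)).
by apply: eq_bigr => k _; rewrite mul0r cexp0 mulr1 /z exprMn; ring.
Qed.

End roots_of_unity.

(** * Hermite functions *)

Section hermite_functions.
Variable R : realType.
Local Notation C := R[i].
Local Notation leb := (@lebesgue_measure R).

(** The n-th Hermite function e^(-x^2/2) H_n divided by n!, which is the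
    coefficient of t^n in [bargK t x]. *)
Definition hfun n (x : R) : R := hq n x * expR (- (2^-1 * x ^+ 2)).

Lemma cmeas_hq n : cmeas (fun x : R => hq n (x%:C)).
Proof.
elim/nat_ind2: n => [||n h1 h2].
- exact: cmeas_cst.
- by apply: cmeasM; [exact: cmeas_cst|exact: cmeas_real].
under eq_fun do rewrite hqSS.
apply: cmeasM; last exact: cmeas_cst.
apply: cmeasD; first by apply: cmeasM => //; apply: cmeasM; [exact: cmeas_cst|exact: cmeas_real].
under eq_fun do rewrite -mulNr.
by apply: cmeasM => //; exact: cmeas_cst.
Qed.

Lemma measurable_hfun n : measurable_fun setT (hfun n).
Proof.
apply: measurable_funM.
  have [h _] := cmeas_hq n; move: h; congr measurable_fun; apply/funext => x.
  by rewrite -hq_real.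
apply: (measurableT_comp (@measurable_expR R)).
by apply: measurableT_comp => //; apply: measurable_funM => //; exact: measurable_funX.
Qed.

Lemma hq_norm_real n (x : R) : normc (hq n x%:C) = `|hq n x|.
Proof. by rewrite -hq_real normc_real. Qed.

(** The case a = 2, kap = 1 of [hq_growth_exp], in which the Gaussian cancels the
    exponential. *)
Lemma hfun_bound n (x : R) : n`!%:R `^ 2^-1 * `|hfun n x| <= 8 ^+ n.
Proof.
have h2 : 0 < (2 : R) <= 2 by lra.
have h1 : 0 < (1 : R) <= 1 by lra.
have := @hq_growth_exp R 2 1 x%:C n h2 h1.
have -> : 1 - 2^-1 = 2^-1 :> R by field.
rewrite divr1 hq_norm_real normc_real powR1 powR_mulrn// real_normK ?num_real// mul1r.
rewrite /hfun normrM (ger0_norm (expR_ge0 _)) expRN => h.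
by rewrite mulrA ler_pdivrMr ?expR_gt0.
Qed.

(** Decreasing kap lowers the constant in front of |x|^a and raises the geometric
    rate in n. *)
Lemma hfun_bound_subgauss (a kap x : R) n : 0 < a < 2 -> 0 < kap <= 1 ->
  n`!%:R `^ (1 - a^-1) * `|hfun n x| <=
  (8 / kap) ^+ n * expR (- (2^-1 * `|x| ^+ 2) + kap `^ a / a * `|x| `^ a).
Proof.
move=> /andP[a0 a2] k01.
have a02 : 0 < a <= 2 by rewrite a0 ltW.
have := @hq_growth_exp R a kap x%:C n a02 k01.
rewrite hq_norm_real normc_real /hfun normrM (ger0_norm (expR_ge0 _)) => h.
rewrite expRD real_normK ?num_real// [leRHS]mulrCA [leRHS]mulrC [leLHS]mulrA.
by rewrite ler_wpM2r ?expR_ge0.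
Qed.

(** The generating function of the Hermite functions is the Bargmann kernel. *)
Lemma bargK_extract (x : R) (rho : C) n :
  ccvg (fun N => cavg (fun t => bargK t x) N.+1 rho n) (rho ^+ n * (hfun n x)%:C).
Proof.
pose r := normc rho; pose X := `|x| + r.
have r0 : 0 <= r by exact: normc_ge0.
pose B := 2 * expR (X ^+ 2 / 2) * expR (2 * `|x| * r + r ^+ 2).
apply: (@cavg_cvg _ _ (fun n => (hfun n x)%:C) _ _
   (fun N => B * ((64 * r ^+ 2) ^+ N / N`!%:R) `^ 2^-1)).
  rewrite -[X in _ --> X](mulr0 B); apply: cvgM; first exact: cvg_cst.
  have -> : (0 : R) = Num.sqrt 0 by rewrite sqrtr0.
  under eq_fun do rewrite powR12_sqrt ?divr_ge0 ?exprn_ge0 ?mulr_ge0//.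
  apply: continuous_cvg; first exact: sqrt_continuous.
  exact: cvg_expn_fact.
move=> N t ht.
have f0 : 0 < N`!%:R :> R by rewrite ltr0n fact_gt0.
have hb (s : R) : 0 <= s <= 1 -> normc (genE x t N s) <=
    r ^+ N * N`!%:R * (8 ^+ N * expR (X ^+ 2 / 2) / N`!%:R `^ 2^-1) * expR (2 * `|x| * r + r ^+ 2).
  move=> /andP[s0 s1].
  have ns : `|s| <= 1 by rewrite ger0_norm.
  have fN : normc (N`!%:R : C) = N`!%:R by rewrite -(rmorph_nat (real_complex R)) normc_real ger0_norm.
  rewrite /genE !normcM normcX ht fN; apply: ler_pM.
  - by rewrite !mulr_ge0 ?exprn_ge0 ?normc_ge0.
  - exact: normc_ge0.
  - rewrite ler_wpM2l ?mulr_ge0 ?exprn_ge0//.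
    have h2 : 0 < (2 : R) <= 2 by lra.
    have h1 : 0 < (1 : R) <= 1 by lra.
    have := @hq_growth_exp R 2 1 (x%:C - t * s%:C) N h2 h1.
    have -> : 1 - 2^-1 = 2^-1 :> R by field.
    rewrite divr1 powR1 powR_mulrn ?normc_ge0// => h.
    rewrite ler_pdivlMr ?powR_gt0// mulrC (le_trans h)// ler_wpM2l ?exprn_ge0//.
    rewrite ler_expR mulrC mul1r ler_wpM2r// lerXn2r ?nnegrE ?normc_ge0//.
      by rewrite addr_ge0.
    rewrite (le_trans (le_normcD _ _))// normc_real normcN normcM normc_real lerD2l ht.
    by rewrite ler_piMr.
  - rewrite normc_cexp ler_expR (le_trans (ler_norm _))// (le_trans (ler_Re_normc _))//.
    rewrite (le_trans (le_normcD _ _))// normcN !normcM ht !normc_real -/r.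
    have -> : normc 2 = 2 :> R by rewrite -(rmorph_nat (real_complex R) 2) normc_real ger0_norm.
    apply: lerD; first by rewrite ler_piMr// !mulr_ge0.
    by rewrite expr2 ler_piMr ?mulr_ge0// mulr_ile1.
have := ctaylor_bound (genE_derive x t) hb.
have g0 : genE x t 0 1 = cexp (2 * t * x%:C - t ^+ 2).
  by rewrite /genE expr0 hq0 !mul1r rmorph1 !mulr1; congr cexp; ring.
rewrite g0 => h.
have eK : bargK t x = cexp (2 * t * x%:C - t ^+ 2) * (expR (- (2^-1 * x ^+ 2)))%:C.
  rewrite -cexp_real -cexpD; congr cexp.
  by rewrite !(rmorphN, rmorphM, rmorphXn) /= fmorphV rmorph_nat; field.
have -> : bargK t x - \sum_(k < N) t ^+ k * (hfun k x)%:C =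
  (cexp (2 * t * x%:C - t ^+ 2) - \sum_(k < N) genE x t k 0 / k`!%:R) * (expR (- (2^-1 * x ^+ 2)))%:C.
  rewrite eK mulrBl; congr (_ - _); rewrite mulr_suml; apply: eq_bigr => k _.
  have fk : (k`!%:R : C) != 0 by rewrite pnatr_eq0 -lt0n fact_gt0.
  have -> : (hfun k x)%:C = hq k x%:C * (expR (- (2^-1 * x ^+ 2)))%:C.
    by rewrite -hq_real -(rmorphM (real_complex R)).
  rewrite /genE (rmorph0 (real_complex R)) !mulr0 !subr0 cexp0 mulr1.
  by field.
rewrite normcM normc_real ger0_norm ?expR_ge0//.
apply: (@le_trans _ _ (2 * (r ^+ N * N`!%:R * (8 ^+ N * expR (X ^+ 2 / 2) / N`!%:R `^ 2^-1) * expR (2 * `|x| * r + r ^+ 2)) / N`!%:R)).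
  apply: (le_trans (ler_wpM2r (expR_ge0 _) h)).
  rewrite ler_piMr//.
    rewrite !mulr_ge0 ?exprn_ge0 ?expR_ge0 ?invr_ge0 ?powR_ge0//.
  by rewrite -expR0 ler_expR oppr_le0 mulr_ge0 ?sqr_ge0.
have -> : ((64 * r ^+ 2) ^+ N / N`!%:R) `^ 2^-1 = (8 * r) ^+ N / N`!%:R `^ 2^-1.
  have nz : 0 < N`!%:R `^ 2^-1 :> R by exact: powR_gt0.
  apply: (mulIf (lt0r_neq0 nz)); rewrite divfK ?gt_eqF// -powRM ?divr_ge0 ?exprn_ge0 ?mulr_ge0// ?exprn_ge0//.
  rewrite divfK ?gt_eqF// powR12_sqrt ?exprn_ge0 ?mulr_ge0 ?exprn_ge0//.
  have -> : (64 * r ^+ 2) ^+ N = ((8 * r) ^+ N) ^+ 2.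
    by rewrite -exprM mulnC exprM; congr (_ ^+ _); ring.
  by rewrite sqrtr_sqr ger0_norm ?exprn_ge0 ?mulr_ge0.
rewrite le_eqVlt; apply/orP; left; apply/eqP; rewrite /B exprMn.
have nz : N`!%:R `^ 2^-1 != 0 :> R by rewrite gt_eqF// powR_gt0.
by field; rewrite nz gt_eqF.
Qed.

Lemma cavg_bargK_bound (rho : C) n N (x : R) :
  normc (cavg (fun t => bargK t x) N.+1 rho n) <=
  expR (normc rho ^+ 2) * expR (- (2^-1 * x ^+ 2) + 2 * normc rho * `|x|).
Proof. by apply: normc_cavg => // z hz; rewrite -hz; exact: normc_bargK_le. Qed.

Lemma cmeas_cavg_bargK (rho : C) n N :
  cmeas (fun x : R => cavg (fun t => bargK t x) N rho n).
Proof.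
apply: cmeasM; first exact: cmeas_cst.
apply: cmeas_sum => k; apply: cmeasM; last exact: cmeas_cst.
exact: cmeas_bargK.
Qed.

End hermite_functions.

Section hermite_transforms.
Variable R : realType.
Local Notation C := R[i].
Local Notation leb := (@lebesgue_measure R).

Lemma hfun_le n (x : R) : `|hfun n x| <= 8 ^+ n * expR (- (2^-1 * x ^+ 2) + `|x|).
Proof.
have i1 : 0 < (1 : R) < 2 by lra.
have i2 : 0 < (1 : R) <= 1 by lra.
have := hfun_bound_subgauss x n i1 i2.
by rewrite invr1 subrr powRr0 mul1r !mulr1 powR1 powRr1// mul1r real_normK ?num_real.
Qed.

Lemma rintg_hfun_exp n (c : R) : 0 <= c ->
  rintg leb (fun x => normc (hfun n x)%:C * expR (c * `|x|)).
Proof.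
move=> c0; have i1 : 0 < (1 : R) < 2 by lra.
have := rintgZ (8 ^+ n) (rintg_subgauss i1 (half_gt0 R) ler01 c0) => j.
apply: (rintg_dom _ j).
  apply: measurable_funM.
    by apply: cmeas_normc; apply: cmeas_real; exact: measurable_hfun.
  apply: (measurableT_comp (@measurable_expR R)).
  by apply: measurable_funM => //; exact: measurable_absr.
apply: aeW => x; rewrite ger0_norm ?mulr_ge0 ?normc_ge0 ?expR_ge0//.
rewrite normc_real expRD mulrA ler_wpM2r ?expR_ge0// powRr1// mul1r.
exact: hfun_le.
Qed.

Lemma cintg_hfun n : cintg leb (fun x => (hfun n x)%:C).
Proof.
apply: (cintg_dom _ (rintg_hfun_exp n (lexx 0))).
  by apply: cmeas_real; exact: measurable_hfun.
by apply: aeW => x; rewrite mul0r expR0 mulr1.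
Qed.

Lemma cint_cavg (phi : R -> C) N rho n :
  (forall t, cintg leb (fun x => phi x * bargK t x)) ->
  cint leb (fun x => phi x * cavg (fun t => bargK t x) N rho n) =
  cavg (fun t => cint leb (fun x => phi x * bargK t x)) N rho n.
Proof.
move=> j; rewrite /cavg.
have jk (k : 'I_N) : cintg leb (fun x => (zeta R N k ^+ n)^-1 * (phi x * bargK (rho * zeta R N k) x)).
  exact: cintgZ.
have js := cintg_sum (index_enum 'I_N) jk.
transitivity (cint leb (fun x => N%:R^-1 * \sum_(k < N) (zeta R N k ^+ n)^-1 * (phi x * bargK (rho * zeta R N k) x))).
  apply: eq_cint => x; rewrite mulrCA; congr (_ * _); rewrite mulr_sumr.
  by apply: eq_bigr => k _; ring.
rewrite cintZ// cint_sum//; congr (_ * _); apply: eq_bigr => k _.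
by rewrite cintZ// mulrC.
Qed.

(** Averages in the parameter commute with the integral, by dominated convergence. *)
Lemma cint_extract (phi : R -> C) rho n : cmeas phi ->
  rintg leb (fun x => normc (phi x) * expR (- (2^-1 * x ^+ 2) + 2 * normc rho * `|x|)) ->
  (forall t, cintg leb (fun x => phi x * bargK t x)) ->
  ccvg (fun N => cavg (fun t => cint leb (fun x => phi x * bargK t x)) N.+1 rho n)
    (cint leb (fun x => phi x * (rho ^+ n * (hfun n x)%:C))).
Proof.
move=> mphi jphi j.
have e N : cavg (fun t => cint leb (fun x => phi x * bargK t x)) N.+1 rho n =
  cint leb (fun x => phi x * cavg (fun t => bargK t x) N.+1 rho n).
  by rewrite cint_cavg.
rewrite (eq_fun e).
apply: (@dominated_ccvg R _ _ leb
  (fun N x => phi x * cavg (fun t => bargK t x) N.+1 rho n)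
  (fun x => phi x * (rho ^+ n * (hfun n x)%:C))
  (fun x => expR (normc rho ^+ 2) *
  (normc (phi x) * expR (- (2^-1 * x ^+ 2) + 2 * normc rho * `|x|)))).
- by move=> N; apply: cmeasM => //; exact: cmeas_cavg_bargK.
- apply: cmeasM => //; apply: cmeasM; first exact: cmeas_cst.
  by apply: cmeas_real; exact: measurable_hfun.
- exact: rintgZ.
- by move=> x; apply: ccvgM; [exact: ccvg_cst|exact: bargK_extract].
apply: aeW => x N; rewrite normcM mulrCA ler_wpM2l ?normc_ge0//.
exact: cavg_bargK_bound.
Qed.

Lemma rintg_dom_bound (phi : R -> C) (c B : R) : cmeas phi -> 0 <= c ->
  (forall x, normc (phi x) <= B) ->
  rintg leb (fun x => normc (phi x) * expR (- (2^-1 * x ^+ 2) + c * `|x|)).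
Proof.
move=> mphi c0 hB; have i1 : 0 < (1 : R) < 2 by lra.
have j := rintgZ B (rintg_subgauss i1 (half_gt0 R) (lexx 0) c0).
apply: (rintg_dom _ j).
  apply: measurable_funM; first exact: cmeas_normc.
  apply: (measurableT_comp (@measurable_expR R)); apply: measurable_funD.
    by apply: measurableT_comp => //; apply: measurable_funM => //; exact: measurable_funX.
  by apply: measurable_funM => //; exact: measurable_absr.
apply: aeW => x; rewrite ger0_norm ?mulr_ge0 ?normc_ge0 ?expR_ge0//.
by rewrite mul0r addr0 ler_wpM2r ?expR_ge0.
Qed.

Lemma cintg_bounded_bargK (phi : R -> C) (B : R) t : cmeas phi ->
  (forall x, normc (phi x) <= B) -> cintg leb (fun x => phi x * bargK t x).
Proof.
move=> mphi hB; apply: (@cintg_dom _ _ _ leb _ (fun x => B * normc (bargK t x))).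
- by apply: cmeasM => //; exact: cmeas_bargK.
- exact/rintgZ/cintg_normc/cintg_bargK.
- by apply: aeW => x; rewrite normcM ler_wpM2r ?normc_ge0.
Qed.

(** The Fourier transform acts diagonally on Hermite functions, because it
    rotates the parameter of their generating function. *)
Lemma hfun_fourier n (y : R) :
  (0 +i* 1) ^+ n * cint leb (fun x => cexp (- ((0 +i* 1) * (y * x)%:C)) * (hfun n x)%:C) =
  (gauss_mass (2^-1 : R))%:C * (hfun n y)%:C.
Proof.
pose phi (x : R) : C := cexp (- ((0 +i* 1) * (y * x)%:C)).
have mphi : cmeas phi.
  apply: cmeas_cexp; rewrite (_ : (fun x : R => _) = (fun x : R => (- (0 +i* 1) * y%:C) * x%:C)); last first.
    by apply/funext => x; rewrite rmorphM; ring.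
  by apply: cmeasM; [exact: cmeas_cst|exact: cmeas_real].
have nphi (x : R) : normc (phi x) <= 1.
  by rewrite normc_cexp creN creM /= mul0r mulr0 subrr oppr0 expR0.
have jphi t := cintg_bounded_bargK t mphi nphi.
pose ii : C := 0 +i* 1.
have ni : normc ii = 1 by rewrite /= expr0n /= add0r expr1n sqrtr1.
have c0 : 0 <= 2 * normc ii by rewrite ni mulr1.
have h := @cint_extract phi ii n mphi (rintg_dom_bound mphi c0 nphi) jphi.
have h' : ccvg (fun N => cavg (fun t => cint leb (fun x => phi x * bargK t x)) N.+1 ii n)
   ((gauss_mass (2^-1 : R))%:C * (1 ^+ n * (hfun n y)%:C)).
  have e N : cavg (fun t => cint leb (fun x => phi x * bargK t x)) N.+1 ii n =
    (gauss_mass (2^-1 : R))%:C * cavg (fun t => bargK t y) N.+1 1 n.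
    rewrite /cavg mulrCA; congr (_ * _); rewrite mulr_sumr; apply: eq_bigr => k _.
    rewrite mul1r mulrA -bargK_fourier; congr (_ / _); apply: eq_cint => x.
    by rewrite mulrC.
  rewrite (eq_fun e); apply: ccvgM; first exact: ccvg_cst.
  exact: bargK_extract.
have := ccvg_unique h h'; rewrite expr1n mul1r => <-.
rewrite -cintZ; first by apply: eq_cint => x; rewrite mulrCA.
apply: (@cintg_dom _ _ _ leb _ (fun x => normc (hfun n x)%:C)).
- by apply: cmeasM => //; apply: cmeas_real; exact: measurable_hfun.
- exact/cintg_normc/cintg_hfun.
- by apply: aeW => x; rewrite normcM ler_piMl ?normc_ge0 ?nphi.
Qed.

Lemma hfun_bounded n (x : R) : normc (hfun n x)%:C <= 8 ^+ n.
Proof.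
rewrite normc_real; apply: le_trans (hfun_bound n x).
rewrite ler_peMl//.
have e1 : (1 : R) `^ 2^-1 = 1 by rewrite powR1.
rewrite -[leLHS]e1.
apply: ge0_ler_powR; rewrite ?nnegrE ?invr_ge0//.
by rewrite ler1n fact_gt0.
Qed.

(** From the pairing of the generating functions, by extracting a coefficient in
    each of the two parameters. *)
Lemma hfun_orthogonal m n :
  cint leb (fun x => (hfun m x)%:C * (hfun n x)%:C) =
  (m == n)%:R * ((gauss_mass (1 : R))%:C * (2 ^+ m / m`!%:R)).
Proof.
have n1 : normc (1 : C) = 1 by rewrite normc1.
have c0 : 0 <= 2 * normc (1 : C) by rewrite n1 mulr1.
have step1 (s : C) k : cint leb (fun x => bargK s x * (hfun k x)%:C) =
    (gauss_mass (1 : R))%:C * ((2 * s) ^+ k / k`!%:R).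
  have js : rintg leb (fun x => normc (bargK s x) * expR (- (2^-1 * x ^+ 2) + 2 * normc (1 : C) * `|x|)).
    apply: (rintg_dom _ (rintg_bargK_exp s c0)).
      apply: measurable_funM; first exact/cmeas_normc/cmeas_bargK.
      apply: (measurableT_comp (@measurable_expR R)); apply: measurable_funD.
        by apply: measurableT_comp => //; apply: measurable_funM => //; exact: measurable_funX.
      by apply: measurable_funM => //; exact: measurable_absr.
    apply: aeW => x; rewrite ger0_norm ?mulr_ge0 ?normc_ge0 ?expR_ge0//.
    rewrite ler_wpM2l ?normc_ge0// ler_expR gerDr oppr_le0.
    by rewrite mulr_ge0 ?sqr_ge0.
  have h := @cint_extract (bargK s) 1 k (@cmeas_bargK R s) js (fun t => (bargK_pairing s t).1).
  have h' : ccvg (fun N => cavg (fun t => cint leb (fun x => bargK s x * bargK t x)) N.+1 1 k)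
     ((gauss_mass (1 : R))%:C * (1 ^+ k * ((2 * s) ^+ k / k`!%:R))).
    have e N : cavg (fun t => cint leb (fun x => bargK s x * bargK t x)) N.+1 1 k =
      (gauss_mass (1 : R))%:C * cavg (fun t => cexp (2 * s * t)) N.+1 1 k.
      rewrite /cavg mulrCA; congr (_ * _); rewrite mulr_sumr; apply: eq_bigr => j _.
      by rewrite (bargK_pairing s (1 * zeta R N.+1 j)).2 -[in LHS]mulrA.
    rewrite (eq_fun e); apply: ccvgM; first exact: ccvg_cst.
    exact: cexp_extract.
  have := ccvg_unique h h'; rewrite !expr1n !mul1r => <-.
  by apply: eq_cint => x; rewrite mul1r.
pose phi (x : R) : C := (hfun m x)%:C.
have mphi : cmeas phi by apply: cmeas_real; exact: measurable_hfun.
have nphi x : normc (phi x) <= 8 ^+ m by exact: hfun_bounded.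
have h := @cint_extract phi 1 n mphi (rintg_dom_bound mphi c0 nphi)
  (fun t => cintg_bounded_bargK t mphi nphi).
pose e k : C := (m == k)%:R * ((gauss_mass (1 : R))%:C * (2 ^+ m / m`!%:R)).
have h' : ccvg (fun N => cavg (fun t => cint leb (fun x => phi x * bargK t x)) N.+1 1 n) (1 ^+ n * e n).
  pose B := normc (\sum_(k < m.+1) e k) + normc (e m).
  pose r N : R := if (N <= m)%N then normc (e m) else 0.
  apply: (@cavg_cvg _ _ e _ _ r).
    apply: cvg_near_cst; exists m.+1 => // N /= mN.
    by rewrite /r leqNgt mN.
  move=> N t ht.
  have -> : cint leb (fun x => phi x * bargK t x) = t ^+ m * e m.
    have -> : (fun x : R => phi x * bargK t x) = (fun x : R => bargK t x * (hfun m x)%:C).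
      by apply/funext => x; rewrite mulrC.
    have alg (u g p q : C) : g * (p * u / q) = u * (1 * (g * (p / q))) by ring.
    by rewrite step1 /e eqxx exprMn alg.
  rewrite /r; case: ifP => Nm.
    rewrite big1 ?subr0; first by rewrite normcM normcX ht n1 expr1n mul1r.
    move=> k _; rewrite /e; have -> : (m == k) = false; last by rewrite mul0r mulr0.
    by apply/eqP => mk; move: Nm; rewrite leqNgt mk ltn_ord.
  have mN : (m < N)%N by rewrite ltnNge Nm.
  rewrite (bigD1 (Ordinal mN))//= big1 ?addr0 ?subrr ?normc0//.
  move=> k km; rewrite /e; have -> : (m == k) = false; last by rewrite mul0r mulr0.
  by apply/eqP => mk; move/eqP: km; apply; exact/val_inj.
have := ccvg_unique h h'; rewrite !expr1n !mul1r -/(e n) => <-.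
by apply: eq_cint => x; rewrite mul1r.
Qed.

End hermite_transforms.

Section hermite_identification.
Variable R : realType.

Lemma is_derive_hq n (x : R) : is_derive x (1 : R) (hq n) (2 * hqpred n x).
Proof.
have [h _] := is_cderive_hq n (is_cderive_id x).
have e1 : (fun y : R => complex.Re (hq n y%:C)) = hq n.
  by apply/funext => y; rewrite -hq_real.
have e2 : complex.Re (2 * hqpred n x%:C * 1) = 2 * hqpred n x.
  rewrite mulr1 -(rmorph_nat (real_complex R) 2) creM /= mul0r subr0.
  by case: n {h e1} => [|n] //=; rewrite -hq_real.
by move: h; rewrite e1 e2.
Qed.

(** Successive derivatives of the Gaussian exp (-x^2). *)
Definition gauss_deriv n (x : R) : R := (-1) ^+ n * n`!%:R * hq n x * expR (- x ^+ 2).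

Lemma is_derive_gauss_deriv n (x : R) :
  is_derive x (1 : R) (gauss_deriv n) (gauss_deriv n.+1 x).
Proof.
have hE : is_derive x (1 : R) (fun y : R => expR (- y ^+ 2)) (- (2 * x) * expR (- x ^+ 2)).
  have h2 : is_derive x (1 : R) (fun y : R => - y ^+ 2) (- (2 * x)).
    have e : (fun y : R => - y ^+ 2) = - (@id R * @id R).
      by apply/funext => y; rewrite !fctE expr2.
    rewrite e; apply: is_derive1_eq; rewrite /GRing.scale /=; ring.
  apply: is_derive1_eq; by rewrite /GRing.scale /= mulrC.
have e : gauss_deriv n = ((-1) ^+ n * n`!%:R) *: (hq n * (fun y : R => expR (- y ^+ 2))).
  by apply/funext => y; rewrite /gauss_deriv !fctE /GRing.scale /= !mulrA.
rewrite e; apply: is_derive1_eq.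
  apply: is_deriveZ; exact: (is_deriveM (is_derive_hq n x) hE).
rewrite /gauss_deriv factS natrM [(-1) ^+ n.+1]exprS /GRing.scale /=.
transitivity ((-1) ^+ n * n`!%:R * expR (- x ^+ 2) * (- (n.+1%:R * hq n.+1 x))).
  by rewrite hqS; ring.
by ring.
Qed.

Lemma pderiv_tensor d (j : 'I_d) (phi : 'I_d -> R -> R) (dphi : R -> R) :
  (forall x, is_derive x (1 : R) (phi j) (dphi x)) ->
  pderiv j (fun y : 'cV[R]_d => \prod_(k < d) phi k (y k 0)) =
  (fun y => \prod_(k < d) (if k == j then dphi (y k 0) else phi k (y k 0))).
Proof.
move=> D; apply/funext => x; rewrite /pderiv.
pose c := \prod_(k < d | k != j) phi k (x k 0).
have line (h : R) : \prod_(k < d) phi k ((h *: basis_vec R j + x) k 0) = phi j (h + x j 0) * c.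
  rewrite (bigD1 j)//=; congr (_ * _).
    by rewrite !mxE !eqxx /= mulr1.
  by apply: eq_bigr => k kj; rewrite !mxE (negPf kj) /= mulr0 add0r.
have -> : \prod_(k < d) (if k == j then dphi (x k 0) else phi k (x k 0)) = dphi (x j 0) * c.
  rewrite (bigD1 j)//= eqxx; congr (_ * _); apply: eq_bigr => k kj.
  by rewrite (negPf kj).
have [der val] := D (x j 0).
have cv : (fun h : R => h^-1 *: (phi j (h *: (1 : R) + x j 0) - phi j (x j 0))) @ 0^' --> dphi (x j 0).
  by rewrite -val; exact: der.
apply: cvg_lim => //.
have x0 : \prod_(k < d) phi k (x k 0) = phi j (x j 0) * c by rewrite (bigD1 j).
have -> : (fun h : R => h^-1 *: (((fun y : 'cV[R]_d => \prod_(k < d) phi k (y k 0)) \o shift x) (h *: basis_vec R j) - \prod_(k < d) phi k (x k 0))) =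
  (fun h : R => (h^-1 *: (phi j (h *: (1 : R) + x j 0) - phi j (x j 0))) * c).
  apply/funext => h; rewrite /= line x0 /GRing.scale /= mulr1 -mulrBl mulrA.
  by [].
by apply: cvgM; [exact: cv|exact: cvg_cst].
Qed.

Lemma iter_pderiv_tensor d (j : 'I_d) (phi : nat -> R -> R) (a : 'I_d -> nat) m :
  (forall n x, is_derive x (1 : R) (phi n) (phi n.+1 x)) ->
  iter m (pderiv j) (fun y : 'cV[R]_d => \prod_(k < d) phi (a k) (y k 0)) =
  (fun y => \prod_(k < d) phi (if k == j then (a k + m)%N else a k) (y k 0)).
Proof.
move=> D; elim: m => [|m IH].
  by apply/funext => y; apply: eq_bigr => k _; rewrite addn0; case: ifP.
rewrite iterS IH.
have Dj (x : R) : is_derive x (1 : R) (phi (if j == j then (a j + m)%N else a j)) (phi (a j + m).+1 x).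
  by rewrite eqxx; exact: D.
rewrite (@pderiv_tensor _ j (fun k => phi (if k == j then (a k + m)%N else a k)) _ Dj).
apply/funext => y; apply: eq_bigr => k _; case: eqVneq => [->|//].
by rewrite addnS.
Qed.

Lemma mi_deriv_tensor d (phi : nat -> R -> R) (alpha : 'I_d -> nat) :
  (forall n x, is_derive x (1 : R) (phi n) (phi n.+1 x)) ->
  mi_deriv alpha (fun y : 'cV[R]_d => \prod_(k < d) phi 0%N (y k 0)) =
  (fun y => \prod_(k < d) phi (alpha k) (y k 0)).
Proof.
move=> D; rewrite /mi_deriv.
have gen (s : seq 'I_d) : uniq s ->
  foldr (fun j => iter (alpha j) (pderiv j)) (fun y : 'cV[R]_d => \prod_(k < d) phi 0%N (y k 0)) s =
  (fun y => \prod_(k < d) phi (if k \in s then alpha k else 0%N) (y k 0)).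
  elim: s => [|j s IH] /=; first by move=> _; apply/funext => y; apply: eq_bigr.
  move=> /andP[js us]; rewrite IH// iter_pderiv_tensor//.
  apply/funext => y; apply: eq_bigr => k _; rewrite inE.
  by case: eqVneq => [->|kj] /=; rewrite ?(negPf js).
rewrite gen ?enum_uniq//; apply/funext => y; apply: eq_bigr => k _.
by rewrite mem_enum.
Qed.

(** The Gaussian is a tensor product, and its n-th derivative in one variable is
    (-1)^n H_n times itself. *)
Lemma hermiteE d (alpha : 'I_d -> nat) (x : 'cV[R]_d) :
  hermite alpha x = pi `^ (- (d%:R / 4)) *
   ((2 ^ mi_size alpha * mi_fact alpha)%N%:R) `^ (- 2^-1) *
   \prod_(k < d) ((alpha k)`!%:R * hfun (alpha k) (x k 0)).
Proof.
rewrite /hermite.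
have -> : (fun y : 'cV[R]_d => expR (- dot y y)) = (fun y => \prod_(k < d) gauss_deriv 0 (y k 0)).
  apply/funext => y; rewrite /dot -sumrN expR_sum; apply: eq_bigr => k _.
  by rewrite /gauss_deriv hq0 fact0 expr0 !mul1r expr2.
rewrite (mi_deriv_tensor alpha is_derive_gauss_deriv).
have -> : expR (2^-1 * dot x x) = \prod_(k < d) expR (2^-1 * x k 0 ^+ 2).
  by rewrite /dot mulr_sumr expR_sum; apply: eq_bigr => k _; rewrite expr2.
rewrite -!mulrA mulrCA; congr (_ * _); rewrite mulrCA; congr (_ * _).
rewrite /mi_size expr_sum -!big_split /=; apply: eq_bigr => k _.
rewrite /gauss_deriv /hfun.
have -> : expR (- (2^-1 * x k 0 ^+ 2)) = expR (2^-1 * x k 0 ^+ 2) * expR (- x k 0 ^+ 2).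
  by rewrite -expRD; congr expR; field.
have -> : (-1) ^+ alpha k * (expR (2^-1 * x k 0 ^+ 2) * ((-1) ^+ alpha k * (alpha k)`!%:R * hq (alpha k) (x k 0) * expR (- x k 0 ^+ 2))) =
  ((-1) ^+ alpha k * (-1) ^+ alpha k) * ((alpha k)`!%:R * (hq (alpha k) (x k 0) * (expR (2^-1 * x k 0 ^+ 2) * expR (- x k 0 ^+ 2)))) :> R by ring.
by rewrite -exprMn mulrNN mulr1 expr1n mul1r.
Qed.

End hermite_identification.

(** * The square root of a positive definite matrix *)

Section square_root.
Variable R : realType.
Local Notation C := R[i].

Lemma dotE d (x y : 'cV[R]_d) : dot x y = (x^T *m y) 0 0.
Proof. by rewrite mxE; apply: eq_bigr => k _; rewrite mxE. Qed.

Lemma dot_mulmx d (M : 'M[R]_d) (x y : 'cV[R]_d) : dot (M *m x) y = dot x (M^T *m y).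
Proof. by rewrite !dotE trmx_mul mulmxA. Qed.

Lemma dotZ d (c : R) (x y : 'cV[R]_d) : dot x (c *: y) = c * dot x y.
Proof. by rewrite !dotE -scalemxAr mxE. Qed.

Lemma dot_ge0 d (x : 'cV[R]_d) : 0 <= dot x x.
Proof. by apply: sumr_ge0 => k _; rewrite -expr2 sqr_ge0. Qed.

Lemma dot_gt0 d (x : 'cV[R]_d) : x != 0 -> 0 < dot x x.
Proof.
move=> x0; rewrite lt_neqAle dot_ge0 andbT eq_sym; apply: contra x0.
rewrite /dot psumr_eq0 => [|k _]; last by rewrite -expr2 sqr_ge0.
move=> /allP h; apply/eqP/colP => k; rewrite mxE.
by have := h k (mem_index_enum k); rewrite /= -expr2 sqrf_eq0 => /eqP.
Qed.

Lemma dot_basis_vec d (x : 'cV[R]_d) j : dot x (basis_vec R j) = x j 0.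
Proof.
rewrite /dot (bigD1 j)//= big1 ?addr0; first by rewrite !mxE !eqxx mulr1.
by move=> k kj; rewrite !mxE (negPf kj) mulr0.
Qed.

Lemma spd_unitmx d (A : 'M[R]_d) : spd A -> A \in unitmx.
Proof.
move=> [symA posA]; rewrite unitmxE unitfE; apply/negP => /det0P[v v0 vA].
have := posA v^T; rewrite trmx_eq0 => /(_ v0).
rewrite dotE trmxK mulmxA vA mul0mx mxE ltxx.
by [].
Qed.

Lemma interpolation (f : R -> R) (s : seq R) :
  exists p : {poly R}, forall x, x \in s -> p.[x] = f x.
Proof.
elim: s => [|y s [p hp]]; first by exists 0.
have [ys|ys] := boolP (y \in s).
  by exists p => x; rewrite inE => /orP[/eqP->|]; exact: hp.
pose q := \prod_(z <- s) ('X - z%:P).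
have qy : q.[y] != 0 by rewrite -[_ == 0]/(root q y) root_prod_XsubC.
exists (p + ((f y - p.[y]) / q.[y]) *: q) => x; rewrite inE hornerD hornerZ => /orP[/eqP->|xs].
  by rewrite divfK// addrC subrK.
have : root q x by rewrite root_prod_XsubC.
by rewrite /root => /eqP ->; rewrite mulr0 addr0 hp.
Qed.

Lemma trmx_horner_mx n (A : 'M[R]_n.+1) (p : {poly R}) :
  A^T = A -> (horner_mx A p)^T = horner_mx A p.
Proof.
move=> symA; elim/poly_ind: p => [|p c IH]; first by rewrite rmorph0 trmx0.
rewrite rmorphD rmorphM /= horner_mx_X horner_mx_C linearD /= tr_scalar_mx.
congr (_ + _); rewrite -[_ * _]/(_ *m _) trmx_mul symA IH.
exact: (comm_mx_horner p (comm_mx_refl A)).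
Qed.

(** Over the complex numbers the matrix is diagonalizable with positive
    eigenvalues, so a real polynomial that takes at each eigenvalue its fourth
    root gives a real symmetric S with S^4 = A. The fourth root rather than the
    square root makes S^2 visibly positive. *)
Lemma spd_sqrt d (A : 'M[R]_d) : spd A -> exists B, spd B /\ B *m B = A.
Proof.
case: d A => [|n] A [symA posA].
  exists 0; split; last by apply/matrixP => -[].
  by split=> [|x]; [apply/matrixP => -[]|case/eqP; apply/matrixP => -[]].
pose AC := map_mx (real_complex R) A.
have herm : AC \is hermsymmx.
  apply: realsym_hermsym.
    by apply/is_hermitianmxP; rewrite expr0 scale1r; apply/matrixP => i j; rewrite !mxE /= -[A in LHS]symA mxE.
  by apply/mxOverP => i j; rewrite mxE complex_real.
have Dr := hermitian_spectral_diag_real herm.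
have AE := orthomx_spectralP (hermitian_normalmx herm).
set P := spectralmx AC in AE; set D := spectral_diag AC in Dr AE.
have uP : P \in unitmx by exact: spectral_unit.
pose lam i := complex.Re (D 0 i).
have DE i : D 0 i = (lam i)%:C.
  by have /mxOverP/(_ 0 i)/RRe_real <- := Dr.
have PA : P *m AC = diag_mx D *m P by rewrite [in LHS]AE -mulmxA (mulKVmx uP).
have lam_gt0 i : 0 < lam i.
  pose u : 'cV[R]_n.+1 := \col_k complex.Re (P i k).
  pose v : 'cV[R]_n.+1 := \col_k complex.Im (P i k).
  have rowE k : \sum_j P i j * (A j k)%:C = (lam i)%:C * P i k.
    have := congr1 (fun M : 'M[C]_n.+1 => M i k) PA; rewrite mul_diag_mx !mxE DE => <-.
    by apply: eq_bigr => j _; rewrite mxE.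
  have Au : A *m u = lam i *: u.
    apply/colP => k; have := congr1 (fun z => complex.Re z) (rowE k).
    rewrite !mxE raddf_sum /=.
    have -> : complex.Re ((lam i)%:C * P i k) = lam i * complex.Re (P i k).
      by case: (P i k) => p q /=; rewrite mul0r subr0.
    move=> <-; apply: eq_bigr => j _; rewrite mxE -[A in LHS]symA mxE.
    by case: (P i j) => p q /=; rewrite mulr0 subr0 mulrC.
  have Av : A *m v = lam i *: v.
    apply/colP => k; have := congr1 (fun z => complex.Im z) (rowE k).
    rewrite !mxE raddf_sum /=.
    have -> : complex.Im ((lam i)%:C * P i k) = lam i * complex.Im (P i k).
      by case: (P i k) => p q /=; rewrite mul0r addr0.
    move=> <-; apply: eq_bigr => j _; rewrite mxE -[A in LHS]symA mxE.
    by case: (P i j) => p q /=; rewrite mulr0 add0r mulrC.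
  have pos (w : 'cV[R]_n.+1) : w != 0 -> A *m w = lam i *: w -> 0 < lam i.
    move=> w0 Aw; have := posA w w0; rewrite Aw dotZ pmulr_lgt0//.
    exact: dot_gt0.
  have [u0|u0] := eqVneq u 0; last exact: (pos u).
  have [v0|v0] := eqVneq v 0; last exact: (pos v).
  have : row i P *m invmx P = 0.
    rewrite (_ : row i P = 0) ?mul0mx//; apply/rowP => k; rewrite !mxE.
    have := congr1 (fun w : 'cV[R]_n.+1 => w k 0) u0.
    have := congr1 (fun w : 'cV[R]_n.+1 => w k 0) v0.
    by rewrite !mxE; case: (P i k) => p q /= -> ->.
  rewrite -row_mul mulmxV// => /rowP/(_ i); rewrite !mxE eqxx => /eqP.
  by rewrite oner_eq0.
have [p hp] := interpolation (fun x => Num.sqrt (Num.sqrt x)) [seq lam i | i <- enum 'I_n.+1].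
pose S := horner_mx A p.
have S4 : horner_mx A (p ^+ 4) = A.
  suff : horner_mx A (p ^+ 4 - 'X) = 0.
    by rewrite rmorphB /= horner_mx_X => /eqP; rewrite subr_eq0 => /eqP.
  apply: (map_mx_inj (f := real_complex R)); rewrite map_mx0 map_horner_mx -/AC AE.
  rewrite (horner_mx_uconjC _ _ (uP : P \is a GRing.unit)) horner_mx_diag.
  rewrite (_ : map_mx _ D = 0).
    by rewrite (_ : diag_mx 0 = 0) ?mulmx0 ?mul0mx//; apply/matrixP => i j; rewrite !mxE mul0rn.
  apply/rowP => i; rewrite !mxE DE horner_map hornerD hornerN hornerX horner_exp.
  rewrite hp; last by apply/mapP; exists i; rewrite ?mem_enum.
  rewrite (exprM _ 2 2) sqr_sqrtr ?sqrtr_ge0// sqr_sqrtr ?(ltW (lam_gt0 i))//.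
  by rewrite subrr.
have symS : S^T = S by exact: trmx_horner_mx.
have SS : S *m S *m (S *m S) = A.
  by rewrite -[RHS]S4 rmorphXn /= -[LHS]/(S * S * (S * S)) -!expr2 -exprM.
exists (S *m S); split=> //; split; first by rewrite trmx_mul symS.
move=> x x0; rewrite -mulmxA -[S in X in X *m _]symS -dot_mulmx; apply: dot_gt0.
apply/eqP => Sx; have := posA x x0; rewrite -SS -!mulmxA Sx !mulmx0 dotE mulmx0 mxE ltxx.
by [].
Qed.

Lemma sqrtmxP d (A : 'M[R]_d) : spd A -> spd (sqrtmx A) /\ sqrtmx A *m sqrtmx A = A.
Proof.
by move=> /spd_sqrt h; exact: (@xgetPex _ 0 [set B | spd B /\ B *m B = A] h).
Qed.

Lemma det_gt0 d (A : 'M[R]_d) : spd A -> 0 < \det A.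
Proof.
move=> hA; have [hB <-] := sqrtmxP hA; rewrite det_mulmx -expr2 lt_neqAle sqr_ge0 andbT.
by rewrite eq_sym sqrf_eq0 -unitfE -unitmxE spd_unitmx.
Qed.

Lemma dot_v_vec d (A : 'M[R]_d) j (x : 'cV[R]_d) : spd A ->
  dot (A *m x) (v_vec A j) = (sqrtmx A *m x) j 0.
Proof.
move=> hA; have [hB BB] := sqrtmxP hA; have uB := spd_unitmx hB.
rewrite -[A in A *m x]BB /v_vec -mulmxA dot_mulmx hB.1 mulmxA mulmxV// mul1mx.
exact: dot_basis_vec.
Qed.

Lemma dot_w_vec d (A : 'M[R]_d) j (x : 'cV[R]_d) : spd A ->
  dot (invmx A *m x) (w_vec A j) = (invmx (sqrtmx A) *m x) j 0.
Proof.
move=> hA; have [hB BB] := sqrtmxP hA; have uB := spd_unitmx hB.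
have -> : invmx A = invmx (sqrtmx A) *m invmx (sqrtmx A).
  move: uB BB; set B := sqrtmx A => uB BB; have uA := spd_unitmx hA.
  apply: (can_inj (mulKmx uA)); rewrite mulmxV//.
  by rewrite -[in RHS]BB -mulmxA mulKVmx// mulmxV.
rewrite /w_vec -mulmxA dot_mulmx trmx_inv hB.1 mulmxA mulVmx// mul1mx.
exact: dot_basis_vec.
Qed.

End square_root.

(** * Bargmann transforms of functions with one-directional Gaussian bounds *)

Section bargmann.
Variables (R : realType) (d : nat).
Local Notation C := R[i].
Local Notation leb := (@lebesgue_measure R).
Local Notation nu := (lebesgue_cV R d).
Implicit Types (g : 'cV[R]_d -> C) (t : 'I_d -> C).

Definition barg_integrand g t (y : 'cV[R]_d) : C :=
  g y * \prod_(k < d) bargK (t k) (y k 0).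

Definition barg g t : C := cint nu (barg_integrand g t).

Definition upd t (j : 'I_d) (z : C) (k : 'I_d) : C := if k == j then z else t k.

(** The Fourier transform without the factor (2 pi)^(-d/2). *)
Definition eft g (eta : 'cV[R]_d) : C :=
  cint nu (fun y => g y * cexp (- ((0 +i* 1) * (dot y eta)%:C))).

Definition subgauss_along (j : 'I_d) (a lam c : R) g : Prop :=
  {ae nu, forall y : 'cV[R]_d, normc (g y) <=
     c * expR (- (2^-1 * `|y j 0| ^+ 2) + lam * `|y j 0| `^ a)}.

Lemma cmeas_barg_integrand g t : cmeas g -> cmeas (barg_integrand g t).
Proof.
move=> mg; apply: cmeasM => //; apply: cmeas_prod => k.
exact: (cmeas_coord k (cmeas_bargK (t k))).
Qed.

Lemma bargK_mass (t : C) :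
  rintg leb (fun x : R => normc (bargK t x)) /\
  \int[leb]_x normc (bargK t x) = expR (normc t ^+ 2) * gauss_mass 2^-1.
Proof.
case: t => u v.
have [j1 e1] := rintg_translate (- (2 * u)) (@rintg_gauss R 2^-1 (half_gt0 R)).
have e : (fun x : R => normc (bargK (u +i* v) x)) =
    (fun x : R => expR (normc (u +i* v) ^+ 2) * expR (- (2^-1 * (x + - (2 * u)) ^+ 2))).
  by apply/funext => x; rewrite normc_bargK normc_sqr /= -expRD; congr expR; field.
rewrite e; split; first exact: rintgZ.
by rewrite RintegralZl ?e1.
Qed.

(** In the direction [j] the bound on g limits the growth in Re t_j; in the other
    directions the mass of the kernel is of size exp |t_k|^2. *)
Lemma barg_bound g (j : 'I_d) (a lam c : R) :
  cmeas g -> 0 < a < 2 -> 0 <= lam -> 0 <= c -> subgauss_along j a lam c g ->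
  exists2 M : R, 0 <= M & forall t u v,
    cintg nu (barg_integrand g (upd t j (u +i* v))) /\
    normc (barg g (upd t j (u +i* v))) <=
      M * \prod_(k < d | k != j) expR (normc (t k) ^+ 2) *
        expR (v ^+ 2 + 2 `^ a * lam * `|u| `^ a).
Proof.
move=> mg a02 lam0 c0 hg; have [D D0 hD] := bargK_subgauss a02 lam0.
have gm0 : 0 <= gauss_mass (2^-1 : R) by exact/ltW/gauss_mass_gt0/half_gt0.
exists (2 * (c * (D * \prod_(k < d | k != j) gauss_mass (2^-1 : R)))).
  by rewrite !mulr_ge0 ?prodr_ge0.
move=> t u v.
pose w (x : R) := expR (- (2^-1 * `|x| ^+ 2) + lam * `|x| `^ a).
pose psi (k : 'I_d) (x : R) := if k == j then w x * normc (bargK (u +i* v) x) else normc (bargK (t k) x).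
have jpsi k : rintg leb (psi k).
  case: (eqVneq k j) => kj; rewrite /psi.
    by rewrite kj eqxx; exact: (hD u v).1.
  by rewrite (negPf kj); exact: (bargK_mass (t k)).1.
have psi0 k x : 0 <= psi k x.
  by rewrite /psi; case: (k == j); rewrite ?mulr_ge0 ?expR_ge0 ?normc_ge0.
have [jP eP] := rintg_tensor jpsi.
have mF := cmeas_barg_integrand (upd t j (u +i* v)) mg.
have dom : {ae nu, forall y : 'cV[R]_d, normc (barg_integrand g (upd t j (u +i* v)) y) <=
    c * \prod_(k < d) psi k (y k 0)}.
  apply: filterS hg => y hy; rewrite normcM normc_prod.
  pose q := \prod_(k < d | k != j) normc (bargK (t k) (y k 0)).
  have -> : \prod_(k < d) normc (bargK (upd t j (u +i* v) k) (y k 0)) =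
      normc (bargK (u +i* v) (y j 0)) * q.
    rewrite (bigD1 j) //; congr (_ * _); first by rewrite /upd eqxx.
    by apply: eq_bigr => k kj; rewrite /upd (negPf kj).
  have -> : \prod_(k < d) psi k (y k 0) = w (y j 0) * normc (bargK (u +i* v) (y j 0)) * q.
    rewrite (bigD1 j) //; congr (_ * _); first by rewrite /psi eqxx.
    by apply: eq_bigr => k kj; rewrite /psi (negPf kj).
  have q0 : 0 <= q by apply: prodr_ge0 => k _; exact: normc_ge0.
  rewrite !mulrA; apply: (ler_wpM2r q0); apply: ler_wpM2r => //.
  exact: normc_ge0.
split; first exact: (cintg_dom mF (rintgZ c jP) dom).
apply: (le_trans (normc_cint_le mF (rintgZ c jP) _ dom)).
  by move=> y; rewrite mulr_ge0 ?prodr_ge0.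
rewrite RintegralZl// eP (bigD1 j)//= {1}/psi eqxx -!mulrA ler_pM2l// ler_wpM2l//.
have -> : \prod_(i < d | i != j) \int[leb]_x psi i x =
    \prod_(k < d | k != j) expR (normc (t k) ^+ 2) * \prod_(k < d | k != j) gauss_mass (2^-1 : R).
  rewrite -big_split /=; apply: eq_bigr => k kj; rewrite /psi (negPf kj).
  exact: (bargK_mass (t k)).2.
have /= hj := (hD u v).2; rewrite -/(w _) in hj.
set p := \prod_(k < d | k != j) expR _; set q := \prod_(k < d | k != j) gauss_mass _.
have alg (x y : R) : x * (q * (p * y)) = (x * y) * (p * q) by ring.
rewrite alg; apply: ler_wpM2r; first by rewrite mulr_ge0 ?prodr_ge0.
by rewrite [2 `^ a * _]mulrA.
Qed.

Lemma bargK_exponential (z : C) (x : R) :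
  bargK z x = cexp (- z ^+ 2) * (cexp (- (x ^+ 2 / 2)%:C) * cexp (z * (2 * x)%:C)).
Proof.
rewrite -!cexpD /bargK; congr cexp.
have -> : (2 * x)%:C = 2 * x%:C :> C.
  by rewrite [LHS](rmorphM (real_complex R)) (rmorph_nat (real_complex R) 2).
by ring.
Qed.

Lemma tay2_barg g t j z : cmeas g ->
  (forall t', cintg nu (barg_integrand g t')) ->
  tay2 (fun w => barg g (upd t j w)) z.
Proof.
move=> mg jg.
pose phi (y : 'cV[R]_d) : C := g y * \prod_(k < d | k != j) bargK (t k) (y k 0) * cexp (- (y j 0 ^+ 2 / 2)%:C).
pose s (y : 'cV[R]_d) : R := 2 * y j 0.
have mphi : cmeas phi.
  apply: cmeasM; first by apply: cmeasM => //; apply: cmeas_prod => k; exact: (cmeas_coord k (cmeas_bargK (t k))).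
  apply: cmeas_cexp; rewrite (_ : (fun x : 'cV[R]_d => _) = (fun y => (- (y j 0 ^+ 2 / 2))%:C)); last first.
    by apply/funext => y; rewrite rmorphN.
  apply: cmeas_real; apply: measurableT_comp => //; apply: measurable_funM => //.
  by apply: measurable_funX; exact: measurable_coord.
have ms : measurable_fun setT s by apply: measurable_funM => //; exact: measurable_coord.
have integrandE w y : barg_integrand g (upd t j w) y = cexp (- w ^+ 2) * (phi y * cexp (w * (s y)%:C)).
  rewrite /barg_integrand (bigD1 j) //; rewrite {1}/upd eqxx bargK_exponential /phi /s.
  rewrite (eq_bigr (fun k => bargK (t k) (y k 0))); last first.
    by move=> k kj; rewrite /upd (negPf kj).
  set q := \prod_(k < d | k != j) _; set u1 := cexp (- w ^+ 2); set u2 := cexp (- _); set u3 := cexp (w * _).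
  move: (g y) q u1 u2 u3 => G q u1 u2 u3 /=; ring.
have jexp w : cintg nu (fun y => phi y * cexp (w * (s y)%:C)).
  have -> : (fun y => phi y * cexp (w * (s y)%:C)) = (fun y => cexp (w ^+ 2) * barg_integrand g (upd t j w) y).
    by apply/funext => y; rewrite integrandE mulrA -cexpD subrr cexp0 mul1r.
  exact: cintgZ.
have jphi c : 0 <= c -> rintg nu (fun y => normc (phi y) * expR (c * `|s y|)).
  move=> c0.
  have e (b : R) y : normc (phi y * cexp (b%:C * (s y)%:C)) = normc (phi y) * expR (b * s y).
    by rewrite normcM normc_cexp -rmorphM.
  apply: (rintg_dom _ (rintgD (cintg_normc (jexp c%:C)) (cintg_normc (jexp (- c)%:C)))).
    apply: measurable_funM; first exact: cmeas_normc.
    apply: (measurableT_comp (@measurable_expR R)); apply: measurable_funM => //.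
    exact: (measurableT_comp (@measurable_absr R)).
  apply: aeW => y; rewrite ger0_norm ?mulr_ge0 ?normc_ge0 ?expR_ge0//.
  rewrite !e -mulrDr ler_wpM2l ?normc_ge0//.
  have [s0|s0] := leP 0 (s y); first by rewrite (ger0_norm s0) lerDl expR_ge0.
  by rewrite (ltr0_norm s0) mulrN -mulNr lerDr expR_ge0.
have -> : (fun w => barg g (upd t j w)) = (fun w => cexp (- w ^+ 2) * cint nu (fun y => phi y * cexp (w * (s y)%:C))).
  apply/funext => w; rewrite -cintZ//; apply: eq_cint => y; exact: integrandE.
apply: tay2M; last exact: tay2_exponential.
have -> : (fun w : C => cexp (- w ^+ 2)) = (fun w : C => cexp ((-1) * (w * w))).
  by apply/funext => w; rewrite mulN1r.
have h : tay2 (fun w : C => w * w) z := tay2M (tay2_id z) (tay2_id z).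
exact: (@tay2_comp _ (@cexp R) (fun w : C => -1 * (w * w)) z (tay2Z (-1) h) (tay2_cexp _)).
Qed.

End bargmann.

Section bargmann_duality.
Variables (R : realType) (d : nat).
Local Notation C := R[i].
Local Notation leb := (@lebesgue_measure R).
Local Notation nu := (lebesgue_cV R d).
Implicit Types (g : 'cV[R]_d -> C) (t : 'I_d -> C).

Definition phase (x y : 'cV[R]_d) : C := cexp (- ((0 +i* 1) * (dot x y)%:C)).

Lemma phase_prod x y :
  phase x y = \prod_(k < d) cexp (- ((0 +i* 1) * (x k 0 * y k 0)%:C)).
Proof.
rewrite /phase /dot -cexp_sum; congr cexp.
by rewrite sumrN -mulr_sumr -(raddf_sum (real_complex R)).
Qed.

Lemma normc_phase x y : normc (phase x y) = 1.
Proof. by rewrite /phase normc_cexp /= !mul0r !mul1r subr0 oppr0 expR0. Qed.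

Lemma cmeas_phase : cmeas (fun p : 'cV[R]_d * 'cV[R]_d => phase p.1 p.2).
Proof.
apply: cmeas_cexp.
have -> : (fun p : 'cV[R]_d * 'cV[R]_d => - ((0 +i* 1) * (dot p.1 p.2)%:C)) =
  (fun p => (- (0 +i* 1)) * (dot p.1 p.2)%:C) by apply/funext => p; rewrite mulNr.
apply: cmeasM; first exact: cmeas_cst.
apply: cmeas_real; apply: measurable_sum => k; apply: measurable_funM.
  exact: (measurable_comp_fst (measurable_coord k)).
exact: (measurable_comp_snd (measurable_coord k)).
Qed.

Lemma cmeas_phase_l (y : 'cV[R]_d) : cmeas (fun x => phase x y).
Proof.
apply: cmeas_cexp.
have -> : (fun x : 'cV[R]_d => - ((0 +i* 1) * (dot x y)%:C)) =
  (fun x => (- (0 +i* 1)) * (dot x y)%:C) by apply/funext => p; rewrite mulNr.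
apply: cmeasM; first exact: cmeas_cst.
apply: cmeas_real; apply: measurable_sum => k; apply: measurable_funM => //.
exact: measurable_coord.
Qed.

Lemma cintg_phase g (y : 'cV[R]_d) : cintg nu g -> cintg nu (fun x => g x * phase x y).
Proof.
move=> jg; apply: (cintg_dom _ (cintg_normc jg)).
  by apply: cmeasM; [exact: cintg_meas jg|exact: cmeas_phase_l].
by apply: aeW => x; rewrite normcM normc_phase mulr1.
Qed.

Lemma cintg_prod_bargK t : cintg nu (fun y : 'cV[R]_d => \prod_(k < d) bargK (t k) (y k 0)).
Proof. by have [] := @cint_tensor R d (fun k => bargK (t k)) (fun k => cintg_bargK (t k)). Qed.

Lemma normc_bargK_bounded (t : C) (x : R) : normc (bargK t x) <= expR (normc t ^+ 2).
Proof.
case: t => u v; rewrite normc_bargK normc_sqr /= ler_expR -subr_ge0.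
have -> : u ^+ 2 + v ^+ 2 - (2 * u * x - u ^+ 2 + v ^+ 2 - x ^+ 2 / 2) = 2^-1 * (2 * u - x) ^+ 2.
  by field.
by rewrite mulr_ge0 ?sqr_ge0 ?invr_ge0.
Qed.

Lemma cintg_barg g t : cintg nu g -> cintg nu (barg_integrand g t).
Proof.
move=> jg; apply: (cintg_dom _ (rintgZ (\prod_(k < d) expR (normc (t k) ^+ 2)) (cintg_normc jg))).
  exact: (cmeas_barg_integrand t (cintg_meas jg)).
apply: aeW => y; rewrite normcM normc_prod mulrC ler_wpM2r ?normc_ge0//.
by apply: ler_prod => k _; rewrite normc_ge0 normc_bargK_bounded.
Qed.

Let kernel g t (p : 'cV[R]_d * 'cV[R]_d) : C :=
  g p.2 * \prod_(k < d) bargK (t k) (p.1 k 0) * phase p.2 p.1.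

Let cintg_kernel g t : cintg nu g -> cintg (nu \x nu)%E (kernel g t).
Proof.
move=> jg.
have [jP _] := cint_prod2 (cintg_prod_bargK t) jg.
apply: (cintg_dom _ (cintg_normc jP)).
  apply: cmeasM; last first.
    have := @cmeas_comp _ _ _ _ R (fun p : 'cV[R]_d * 'cV[R]_d => (p.2, p.1)) _ (fun p => phase p.1 p.2).
    by apply; [apply: measurable_fun_pair|exact: cmeas_phase].
  have := cintg_meas jP.
  by congr cmeas; apply/funext => p; rewrite mulrC.
by apply: aeW => p; rewrite !normcM normc_phase mulr1 mulrC.
Qed.

Let kernel_inner g t eta : cintg nu g ->
  cint nu (fun y => kernel g t (eta, y)) = barg_integrand (eft g) t eta.
Proof.
move=> jg; rewrite /barg_integrand mulrC /eft -cintZ; last exact: cintg_phase.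
by apply: eq_cint => y; rewrite /kernel /= [g y * _]mulrC mulrA.
Qed.

Lemma cintg_barg_eft g t : cintg nu g -> cintg nu (barg_integrand (eft g) t).
Proof.
move=> jg; have [h _] := cint_fubini1 (cintg_kernel t jg).
have -> // : barg_integrand (eft g) t = (fun eta => cint nu (fun y => kernel g t (eta, y))).
by apply/funext => eta; rewrite kernel_inner.
Qed.

Lemma cmeas_eft g : cintg nu g -> cmeas (eft g).
Proof.
move=> jg; have h := cintg_meas (cintg_barg_eft (fun=> 0) jg).
have -> : eft g = (fun eta => barg_integrand (eft g) (fun=> 0) eta *
    \prod_(k < d) (expR (eta k 0 ^+ 2 / 2))%:C).
  apply/funext => eta; rewrite /barg_integrand -mulrA -big_split /= big1 ?mulr1// => k _.
  rewrite -cexp_real /bargK -cexpD.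
  by rewrite mulr0 mul0r expr0n /= subr0 sub0r addNr cexp0.
apply: cmeasM => //; apply: cmeas_prod => k; apply: cmeas_real.
apply: (measurableT_comp (@measurable_expR R)); apply: measurable_funM => //.
by apply: measurable_funX; exact: measurable_coord.
Qed.

(** The kernel of the Bargmann transform is reproduced by the Fourier transform
    after a rotation of its parameter by a right angle, so the Bargmann
    transforms of a function and of its Fourier transform are rotations of each
    other. *)
Lemma barg_eft g t : cintg nu g ->
  barg (eft g) (fun k => (0 +i* 1) * t k) = (gauss_mass (2^-1 : R))%:C ^+ d * barg g t.
Proof.
move=> jg; pose s k : C := (0 +i* 1) * t k.
have jK := cintg_kernel s jg.
have [_ e1] := cint_fubini1 jK; have e2 := cint_fubini2 jK.
have -> : barg (eft g) s = cint (nu \x nu)%E (kernel g s).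
  by rewrite e1; apply: eq_cint => eta; rewrite kernel_inner.
have h (y : 'cV[R]_d) : cint nu (fun eta => kernel g s (eta, y)) =
    (gauss_mass (2^-1 : R))%:C ^+ d * barg_integrand g t y.
  pose psi k (x : R) : C := bargK (s k) x * cexp (- ((0 +i* 1) * (y k 0 * x)%:C)).
  have jpsi k : cintg leb (psi k).
    apply: (@cintg_dom _ _ _ leb _ (fun x => normc (bargK (s k) x))).
    - apply: cmeasM; first exact: cmeas_bargK.
      apply: cmeas_cexp.
      have -> : (fun x : R => - ((0 +i* 1) * (y k 0 * x)%:C)) = (fun x : R => (- (0 +i* 1)) * (y k 0 * x)%:C).
        by apply/funext => x; rewrite mulNr.
      apply: cmeasM; first exact: cmeas_cst.
      by apply: cmeas_real; apply: measurable_funM.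
    - exact/cintg_normc/cintg_bargK.
    - by apply: aeW => x; rewrite normcM normc_cexp /= !mul0r !mul1r subr0 oppr0 expR0 mulr1.
  have [jP eP] := cint_tensor jpsi.
  have -> : (fun eta => kernel g s (eta, y)) = (fun eta => g y * \prod_(k < d) psi k (eta k 0)).
    by apply/funext => eta; rewrite /kernel /= -mulrA phase_prod -big_split.
  rewrite cintZ// eP /barg_integrand mulrCA; congr (_ * _).
  rewrite (eq_bigr (fun k => (gauss_mass (2^-1 : R))%:C * bargK (t k) (y k 0))).
    by rewrite big_split prodr_const card_ord.
  by move=> k _; exact: bargK_fourier.
by rewrite e2 (eq_cint _ h) cintZ//; exact: cintg_barg.
Qed.

(** The bounds on g and on its Fourier transform limit the growth of the Bargmann
    transform in Re t_j and in Im t_j, and the Phragmen-Lindelof theorem combines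
    the two. *)
Lemma barg_growth g (j : 'I_d) (a lam c c' : R) :
  0 < a < 2 -> 0 <= lam -> 0 <= c -> 0 <= c' -> cintg nu g ->
  subgauss_along j a lam c g -> subgauss_along j a lam c' (eft g) ->
  exists2 M : R, 0 <= M & forall t, normc (barg g t) <=
    M * \prod_(k < d | k != j) expR (normc (t k) ^+ 2) *
      expR (2 `^ a * lam / cos (a * pi / 4) * normc (t j) `^ a).
Proof.
move=> a02 lam0 c0 c'0 jg hg hf.
have mg := cintg_meas jg; have mf := cmeas_eft jg.
have [M1 M10 H1] := barg_bound mg a02 lam0 c0 hg.
have [M2 M20 H2] := barg_bound mf a02 lam0 c'0 hf.
pose gm : R := gauss_mass 2^-1 ^+ d.
have gm0 : 0 < gm by rewrite exprn_gt0// gauss_mass_gt0// half_gt0.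
pose M := M1 + M2 / gm.
have M0 : 0 <= M by rewrite addr_ge0// divr_ge0// ltW.
pose mu := 2 `^ a * lam.
have mu0 : 0 <= mu by rewrite mulr_ge0// powR_ge0.
exists (M * expR (1 + mu)) => [|t]; first by rewrite mulr_ge0// expR_ge0.
pose P := \prod_(k < d | k != j) expR (normc (t k) ^+ 2).
have P0 : 0 <= P by apply: prodr_ge0 => k _; exact: expR_ge0.
have normi (z : C) : normc ((0 +i* 1) * z) = normc z.
  by case: z => x y /=; rewrite !mul0r !mul1r !add0r sqrrN addrC.
have rot u v : (fun k => (0 +i* 1) * upd t j (u +i* v) k) =
    upd (fun k => (0 +i* 1) * t k) j ((- v) +i* u).
  apply/funext => k; rewrite /upd; case: ifP => // _.
  by apply: complex_ext; rewrite /= ?mul0r ?mul1r ?add0r.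
have b1 u v : normc (barg g (upd t j (u +i* v))) <= M * P * expR (v ^+ 2 + mu * `|u| `^ a).
  have := (H1 t u v).2; rewrite -/P -/mu => /le_trans; apply.
  rewrite ler_wpM2r ?expR_ge0// ler_wpM2r//.
  by rewrite lerDl divr_ge0// ltW.
have b2 u v : normc (barg g (upd t j (u +i* v))) <= M * P * expR (u ^+ 2 + mu * `|v| `^ a).
  have e : normc (barg (eft g) (fun k => (0 +i* 1) * upd t j (u +i* v) k)) =
     gm * normc (barg g (upd t j (u +i* v))).
    by rewrite barg_eft// normcM -(rmorphXn (real_complex R)) normc_real ger0_norm// ltW.
  have := (H2 (fun k => (0 +i* 1) * t k) (- v) u).2; rewrite -rot e normrN -/mu.
  rewrite (eq_bigr (fun k => expR (normc (t k) ^+ 2))) => [|k _]; last by rewrite normi.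
  rewrite -/P => h; apply: (@le_trans _ _ (M2 / gm * P * expR (u ^+ 2 + mu * `|v| `^ a))).
    by rewrite -(ler_pM2l gm0) (le_trans h)// !mulrA [gm * M2]mulrC mulfK// lt0r_neq0.
  by rewrite ler_wpM2r ?expR_ge0// ler_wpM2r// lerDr.
have MP0 : 0 <= M * P by rewrite mulr_ge0.
have PL := @phragmen_lindelof R (fun z => barg g (upd t j z)) a mu (M * P) a02 mu0 MP0
  (fun z => tay2_barg t j z mg (fun t' => cintg_barg t' jg)) b1 b2 (t j).
have tE : upd t j (t j) = t by apply/funext => k; rewrite /upd; case: eqVneq => [->|].
move: PL; rewrite /= tE => /le_trans; apply.
by rewrite -/P -/mu [M * P * _]mulrAC.
Qed.

End bargmann_duality.

(** * Hermite coefficients as Taylor coefficients *)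

Section coefficient_extraction.
Variables (R : realType) (d : nat).
Local Notation C := R[i].
Local Notation leb := (@lebesgue_measure R).
Local Notation nu := (lebesgue_cV R d).
Implicit Types (g : 'cV[R]_d -> C) (t : 'I_d -> C).

(** Up to normalization, the Hermite coefficient of index [alpha]. *)
Definition hcoef g (alpha : 'I_d -> nat) : C :=
  cint nu (fun y => g y * \prod_(k < d) (hfun (alpha k) (y k 0))%:C).

Lemma cintg_hcoef g alpha : cintg nu g ->
  cintg nu (fun y => g y * \prod_(k < d) (hfun (alpha k) (y k 0))%:C).
Proof.
move=> jg; apply: (cintg_dom _ (rintgZ (\prod_(k < d) 8 ^+ alpha k) (cintg_normc jg))).
  apply: cmeasM; first exact: cintg_meas jg.
  by apply: cmeas_prod => k; exact: (cmeas_coord k (cmeas_real (measurable_hfun (alpha k)))).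
apply: aeW => y; rewrite normcM normc_prod mulrC; apply: ler_wpM2r; first exact: normc_ge0.
by apply: ler_prod => k _; rewrite normc_ge0 hfun_bounded.
Qed.

(** Cauchy estimates: the Hermite coefficients are the Taylor coefficients of
    the Bargmann transform, which are limits of its averages over roots of unity
    in every variable. *)
Lemma hcoef_cauchy g (alpha : 'I_d -> nat) (r : 'I_d -> R) (B : R) :
  cintg nu g -> (forall k, 0 <= r k) -> 0 <= B ->
  (forall t, (forall k, normc (t k) = r k) -> normc (barg g t) <= B) ->
  (\prod_(k < d) r k ^+ alpha k) * normc (hcoef g alpha) <= B.
Proof.
move=> jg r0 B0 HB.
pose F N (y : 'cV[R]_d) : C := g y * \prod_(k < d) cavg (fun z => bargK z (y k 0)) N.+1 (r k)%:C (alpha k).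
have nr k : normc (r k)%:C = r k by rewrite normc_real ger0_norm.
have boundF N : normc (cint nu (F N)) <= B.
  pose c k (m : 'I_N.+1) : C := N.+1%:R^-1 / zeta R N.+1 m ^+ alpha k.
  pose p (f : {ffun 'I_d -> 'I_N.+1}) k : C := (r k)%:C * zeta R N.+1 (f k).
  have FE y : F N y = \sum_(f : {ffun 'I_d -> 'I_N.+1})
     (\prod_(k < d) c k (f k)) * barg_integrand g (p f) y.
    rewrite /F; rewrite (eq_bigr (fun k => \sum_(m < N.+1) c k m * bargK ((r k)%:C * zeta R N.+1 m) (y k 0))).
      rewrite bigA_distr_bigA mulr_sumr; apply: eq_bigr => f _.
      by rewrite big_split mulrCA.
    move=> k _; rewrite /cavg mulr_sumr; apply: eq_bigr => m _.
    by rewrite /c -[RHS]mulrA; congr (_ * _); rewrite mulrC.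
  have -> : cint nu (F N) = \sum_(f : {ffun 'I_d -> 'I_N.+1}) (\prod_(k < d) c k (f k)) * barg g (p f).
    rewrite (eq_cint _ FE) cint_sum => [|f]; last exact/cintgZ/cintg_barg.
    by apply: eq_bigr => f _; rewrite cintZ//; exact: cintg_barg.
  have nc k m : normc (c k m) = N.+1%:R^-1.
    rewrite /c normcM !normcV normcX zeta_norm expr1n invr1 mulr1.
    by rewrite -(rmorph_nat (real_complex R)) normc_real ger0_norm.
  apply: (le_trans (normc_sum _ _ _)).
  apply: (@le_trans _ _ (\sum_(f : {ffun 'I_d -> 'I_N.+1}) (\prod_(k < d) N.+1%:R^-1) * B)).
    apply: ler_sum => f _; rewrite normcM normc_prod.
    rewrite (eq_bigr (fun=> N.+1%:R^-1)) => [|k _]; last exact: nc.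
    apply: ler_wpM2l; first by apply: prodr_ge0 => k _; rewrite invr_ge0.
    by apply: HB => k; rewrite /p normcM zeta_norm mulr1 nr.
  rewrite -mulr_suml -(bigA_distr_bigA (fun (k : 'I_d) (m : 'I_N.+1) => N.+1%:R^-1)).
  rewrite big1 ?mul1r// => k _.
  by rewrite sumr_const card_ord -[LHS]mulr_natl mulfV// pnatr_eq0.
have lim : ccvg (fun N => cint nu (F N))
   (cint nu (fun y => g y * \prod_(k < d) ((r k)%:C ^+ alpha k * (hfun (alpha k) (y k 0))%:C))).
  pose Q := \prod_(k < d) (expR (r k ^+ 2) * expR (2 * r k ^+ 2)).
  apply: (@dominated_ccvg _ _ _ nu F _ (fun y => Q * normc (g y))).
  - move=> N; apply: cmeasM; first exact: cintg_meas jg.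
    by apply: cmeas_prod => k; exact: (cmeas_coord k (cmeas_cavg_bargK _ _ _)).
  - apply: cmeasM; first exact: cintg_meas jg.
    apply: cmeas_prod => k; apply: cmeasM; first exact: cmeas_cst.
    exact: (cmeas_coord k (cmeas_real (measurable_hfun (alpha k)))).
  - exact: (rintgZ Q (cintg_normc jg)).
  - move=> y; apply: ccvgM; first exact: ccvg_cst.
    by apply: ccvg_prod => k; exact: bargK_extract.
  - apply: aeW => y N; rewrite normcM mulrC; apply: ler_wpM2r; first exact: normc_ge0.
    rewrite normc_prod; apply: ler_prod => k _; rewrite normc_ge0 /=.
    apply: (le_trans (cavg_bargK_bound _ _ _ _)); rewrite nr.
    rewrite ler_wpM2l ?expR_ge0// ler_expR -subr_ge0 -[y k 0 ^+ 2]real_normK ?num_real//.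
    have -> : 2 * r k ^+ 2 - (- (2^-1 * `|y k 0| ^+ 2) + 2 * r k * `|y k 0|) = 2^-1 * (2 * r k - `|y k 0|) ^+ 2.
      by field.
    by rewrite mulr_ge0 ?sqr_ge0 ?invr_ge0.
have := ccvg_norm_le lim boundF.
have jh := cintg_hcoef alpha jg.
have -> : (fun y : 'cV[R]_d => g y * \prod_(k < d) ((r k)%:C ^+ alpha k * (hfun (alpha k) (y k 0))%:C)) =
  (fun y => (\prod_(k < d) (r k)%:C ^+ alpha k) * (g y * \prod_(k < d) (hfun (alpha k) (y k 0))%:C)).
  by apply/funext => y; rewrite big_split mulrCA.
rewrite cintZ// normcM normc_prod.
by rewrite (eq_bigr (fun k => r k ^+ alpha k)) => [|k _]; last rewrite normcX nr.
Qed.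

End coefficient_extraction.

(** * Optimal radii *)

Section optimal_radius.
Variable R : realType.

Lemma fact_le_expn n : n`!%:R * expR 1 ^+ n <= expR 1 * n.+1%:R ^+ n.+1 :> R.
Proof.
elim: n => [|n IH]; first by rewrite fact0 expr0 expr1 !mulr1 ltW// expR_gt1.
have m0 : 0 < n.+1%:R :> R by rewrite ltr0n.
have key : expR 1 * n.+1%:R ^+ n.+2 <= n.+2%:R ^+ n.+2 :> R.
  have e1 : expR 1 = expR (n.+2%:R^-1) ^+ n.+2 :> R.
    by rewrite -expRM_natl -mulr_natl mulfV// pnatr_eq0.
  rewrite e1 -exprMn lerXn2r// ?nnegrE ?mulr_ge0 ?expR_ge0//.
  have := expR_ge1Dx (- n.+2%:R^-1 : R); rewrite expRN => h.
  have E0 : 0 < expR (n.+2%:R^-1 : R) by exact: expR_gt0.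
  rewrite -(ler_pM2l (_ : 0 < (expR n.+2%:R^-1)^-1 :> R)) ?invr_gt0//.
  rewrite mulKf ?gt_eqF//; apply: le_trans (ler_wpM2r (ler0n R n.+2) h).
  by rewrite mulrBl mul1r mulVf ?pnatr_eq0// -[X in _ <= X - 1]natr1 addrK.
apply: (@le_trans _ _ (n.+1%:R * expR 1 * (expR 1 * n.+1%:R ^+ n.+1))).
  rewrite factS natrM exprS.
  have -> : n.+1%:R * n`!%:R * (expR 1 * expR 1 ^+ n) = n.+1%:R * expR 1 * (n`!%:R * expR 1 ^+ n) :> R.
    by ring.
  by rewrite ler_wpM2l// mulr_ge0 ?expR_ge0.
have -> : n.+1%:R * expR 1 * (expR 1 * n.+1%:R ^+ n.+1) = expR 1 * (expR 1 * n.+1%:R ^+ n.+2) :> R.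
  by rewrite [_ ^+ n.+2]exprS; ring.
by rewrite ler_wpM2l ?expR_ge0.
Qed.

(** The minimizer of [expR (L * r `^ q) / r ^+ n], up to a shift of [n] that
    keeps it positive. *)
Definition orad (q L : R) n : R := (n.+1%:R / (q * L)) `^ q^-1.

Lemma orad_bound (q L : R) n : 0 < q -> 0 < L ->
  0 < orad q L n /\
  expR (L * orad q L n `^ q) * n`!%:R `^ q^-1 <=
    orad q L n ^+ n * (expR (2 / q) * n.+1%:R `^ q^-1 * ((q * L) `^ q^-1) ^+ n).
Proof.
move=> q0 L0; have qL0 : 0 < q * L by rewrite mulr_gt0.
have m0 : 0 < n.+1%:R :> R by rewrite ltr0n.
have q1 : 0 <= q^-1 by rewrite invr_ge0 ltW.
split; first by rewrite powR_gt0 ?divr_gt0.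
have -> : L * orad q L n `^ q = n.+1%:R / q.
  rewrite /orad -powRrM mulVf ?gt_eqF// powRr1 ?divr_ge0 ?(ltW qL0)//.
  by field; rewrite !gt_eqF.
have -> : orad q L n ^+ n * (expR (2 / q) * n.+1%:R `^ q^-1 * ((q * L) `^ q^-1) ^+ n) =
    expR (2 / q) * (n.+1%:R ^+ n.+1) `^ q^-1.
  rewrite mulrC -mulrA -mulrA; congr (_ * _).
  rewrite -mulrA -exprMn /orad -powRM ?divr_ge0 ?(ltW qL0)//.
  rewrite [q * L * _]mulrC divfK ?gt_eqF// -powR_mulrn ?powR_ge0// -powRrM.
  by rewrite -exprS -powR_mulrn ?powR_ge0// -powRrM [q^-1 * _]mulrC.
have -> : expR (n.+1%:R / q) = expR q^-1 * (expR 1 ^+ n) `^ q^-1.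
  rewrite -expRM_natl mulr1 -[in RHS]expRM -expRD; congr expR.
  by rewrite -natr1 mulrDl mul1r addrC.
have -> : expR (2 / q) = expR q^-1 * expR 1 `^ q^-1.
  by rewrite -expRM -expRD; congr expR; field; rewrite gt_eqF.
rewrite -!mulrA ler_wpM2l ?expR_ge0// -!powRM ?exprn_ge0 ?expR_ge0//.
apply: ge0_ler_powR; rewrite ?nnegrE ?mulr_ge0 ?exprn_ge0 ?expR_ge0//.
by rewrite mulrC; exact: fact_le_expn.
Qed.

Lemma poly_le_geometric (q rho : R) : 0 < q -> 1 < rho ->
  exists2 K : R, 0 <= K & forall n, n.+1%:R `^ q <= K * rho ^+ n.
Proof.
move=> q0 r1; have r0 : 0 < rho by apply: lt_trans r1.
have c0 : 0 < ln rho by rewrite ln_gt0.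
exists ((q / ln rho) `^ q * rho) => [|n]; first by rewrite mulr_ge0 ?powR_ge0 ?ltW.
have m0 : 0 <= n.+1%:R :> R by [].
have h : n.+1%:R <= q / ln rho * expR (ln rho * n.+1%:R / q).
  have qc : 0 < q / ln rho by rewrite divr_gt0.
  have := ler_wpM2l (ltW qc) (expR_ge1Dx (ln rho * n.+1%:R / q)); apply: le_trans.
  have -> : q / ln rho * (1 + ln rho * n.+1%:R / q) = q / ln rho + n.+1%:R.
    by field; rewrite !gt_eqF.
  by rewrite lerDr ltW.
have := @ge0_ler_powR _ q (ltW q0) _ _ m0 (le_trans m0 h) h => /le_trans; apply.
have qc : 0 <= q / ln rho by rewrite divr_ge0// ltW.
rewrite powRM ?expR_ge0// -[leRHS]mulrA ler_wpM2l ?powR_ge0//.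
rewrite -expRM divfK ?gt_eqF// [ln rho * _]mulrC expRM_natl lnK ?posrE//.
by rewrite exprS.
Qed.

End optimal_radius.

Section coefficient_bound.
Variables (R : realType) (d : nat).
Local Notation C := R[i].
Local Notation nu := (lebesgue_cV R d).
Implicit Types (g : 'cV[R]_d -> C).

(** The normalized size of a Hermite coefficient: the actual coefficient up to
    a factor that does not depend on the index. *)
Definition hsize g (alpha : 'I_d -> nat) : R :=
  normc (hcoef g alpha) * \prod_(k < d) ((alpha k)`!%:R `^ 2^-1 / (2 `^ 2^-1) ^+ alpha k).

Lemma hsize_ge0 g alpha : 0 <= hsize g alpha.
Proof.
apply: mulr_ge0; first exact: normc_ge0.
by apply: prodr_ge0 => k _; rewrite divr_ge0 ?exprn_ge0 ?powR_ge0.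
Qed.

(** Cauchy's estimate with the radius optimal for the order a in the direction [j]
    and with the radii optimal for the order 2 in the other directions, where
    they give no decay. The powers of alpha_k + 1 are absorbed by rho > 1. *)
Lemma hsize_bound_along g (j : 'I_d) (a L rho M : R) :
  0 < a < 2 -> 0 < L -> 1 < rho -> 0 <= M -> cintg nu g ->
  (forall t, normc (barg g t) <= M * \prod_(k < d | k != j) expR (normc (t k) ^+ 2) *
      expR (L * normc (t j) `^ a)) ->
  exists2 K : R, 0 <= K & forall alpha,
    hsize g alpha * (alpha j)`!%:R `^ (a^-1 - 2^-1) <=
      K * rho ^+ mi_size alpha * ((a * L) `^ a^-1 / 2 `^ 2^-1) ^+ alpha j.
Proof.
move=> /andP[a0 a2] L0 rho1 M0 jg HM.
have r0 : 0 < rho by apply: lt_trans rho1.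
have two0 : 0 < 2 :> R by [].
have [K1 K10 hK1] := @poly_le_geometric R 2^-1 rho (half_gt0 R) rho1.
have a10 : 0 < a^-1 by rewrite invr_gt0.
have [K2 K20 hK2] := @poly_le_geometric R a^-1 rho a10 rho1.
exists (M * (\prod_(k < d | k != j) (expR 1 * K1)) * (expR (2 / a) * K2)) => [|alpha].
  by rewrite !mulr_ge0 ?prodr_ge0 ?mulr_ge0 ?expR_ge0// => k _; rewrite mulr_ge0 ?expR_ge0.
pose r k := if k == j then orad a L (alpha k) else orad 2 1 (alpha k).
have rpos k : 0 < r k.
  by rewrite /r; case: ifP => _; [exact: (orad_bound _ a0 L0).1|exact: (orad_bound _ two0 ltr01).1].
pose B := M * \prod_(k < d | k != j) expR (r k ^+ 2) * expR (L * r j `^ a).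
have B0 : 0 <= B by rewrite !mulr_ge0 ?expR_ge0 ?prodr_ge0.
have HB t : (forall k, normc (t k) = r k) -> normc (barg g t) <= B.
  move=> ht; apply: (le_trans (HM t)); rewrite ht /B.
  by rewrite (eq_bigr (fun k => expR (r k ^+ 2))) => [|k _]; rewrite ?ht.
have cau := hcoef_cauchy alpha jg (fun k => ltW (rpos k)) B0 HB.
pose w k : R := if k == j then (alpha k)`!%:R `^ a^-1 else (alpha k)`!%:R `^ 2^-1.
pose E k : R := if k == j then expR (L * r k `^ a) else expR (r k ^+ 2).
pose bd k : R := if k == j then expR (2 / a) * K2 * rho ^+ alpha k * ((a * L) `^ a^-1) ^+ alpha k
   else expR 1 * K1 * rho ^+ alpha k * (2 `^ 2^-1) ^+ alpha k.
have w0 k : 0 <= w k by rewrite /w; case: ifP; rewrite powR_ge0.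
have Ew k : E k * w k <= r k ^+ alpha k * bd k.
  rewrite /E /w /bd /r; case: (k == j).
    apply: (le_trans (orad_bound (alpha k) a0 L0).2).
    rewrite ler_wpM2l ?exprn_ge0 ?powR_ge0// ler_wpM2r ?exprn_ge0 ?powR_ge0//.
    by rewrite -mulrA ler_wpM2l ?expR_ge0.
  have := (orad_bound (alpha k) two0 ltr01).2.
  rewrite divff ?gt_eqF// !mul1r mulr1 powR_mulrn; last first.
    by rewrite powR_ge0.
  move=> /le_trans; apply.
  rewrite ler_wpM2l ?exprn_ge0 ?powR_ge0// ler_wpM2r ?exprn_ge0 ?powR_ge0//.
  by rewrite -mulrA ler_wpM2l ?expR_ge0.
have BE : B = M * \prod_(k < d) E k.
  rewrite /B -mulrA; congr (_ * _); rewrite [RHS](bigD1 j)//= mulrC /E eqxx; congr (_ * _).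
  by apply: eq_bigr => k kj; rewrite (negPf kj).
have main : normc (hcoef g alpha) * \prod_(k < d) w k <= M * \prod_(k < d) bd k.
  have P0 : 0 < \prod_(k < d) r k ^+ alpha k by apply: prodr_gt0 => k _; rewrite exprn_gt0.
  rewrite -(ler_pM2l P0) mulrA; apply: (@le_trans _ _ (B * \prod_(k < d) w k)).
    by rewrite ler_wpM2r ?prodr_ge0.
  rewrite BE -mulrA -big_split /= mulrCA ler_wpM2l// -big_split /=.
  apply: ler_prod => k _; rewrite Ew andbT mulr_ge0//.
  by rewrite /E; case: ifP; rewrite expR_ge0.
have T0 : 0 < \prod_(k < d) (2 `^ 2^-1 : R) ^+ alpha k.
  by apply: prodr_gt0 => k _; rewrite exprn_gt0// powR_gt0.
have e1 : hsize g alpha * (alpha j)`!%:R `^ (a^-1 - 2^-1) =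
   normc (hcoef g alpha) * \prod_(k < d) w k / \prod_(k < d) (2 `^ 2^-1 : R) ^+ alpha k.
  rewrite /hsize big_split /= prodfV -!mulrA; congr (_ * _).
  rewrite mulrCA [RHS]mulrC; congr (_ * _).
  rewrite (bigD1 j)//= [RHS](bigD1 j)//= /w eqxx mulrAC; congr (_ * _); last first.
    by apply: eq_bigr => k kj; rewrite (negPf kj).
  have f0 : (alpha j)`!%:R != 0 :> R by rewrite pnatr_eq0 -lt0n fact_gt0.
  rewrite -powRD; last by rewrite f0 implybT.
  by congr (_ `^ _); rewrite addrC subrK.
rewrite e1 ler_pdivrMr//; apply: (le_trans main); rewrite le_eqVlt; apply/orP; left; apply/eqP.
rewrite -!mulrA; congr (_ * _).
rewrite /mi_size expr_sum (bigD1 j)//= {1}/bd eqxx.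
rewrite (bigD1 (P := xpredT) (F := fun k => rho ^+ alpha k) j)//=.
rewrite (bigD1 (P := xpredT) (F := fun k => (2 `^ 2^-1 : R) ^+ alpha k) j)//=.
rewrite (eq_bigr (fun k => expR 1 * K1 * (rho ^+ alpha k * (2 `^ 2^-1) ^+ alpha k))); last first.
  by move=> k kj; rewrite /bd (negPf kj) -!mulrA.
rewrite !big_split /=.
have h0 : (2 `^ 2^-1 : R) ^+ alpha j != 0 by rewrite expf_neq0// gt_eqF// powR_gt0.
by rewrite exprMn exprVn; field.
Qed.

End coefficient_bound.

(** * Decay of the Hermite coefficients *)

Lemma powR_expn (R : realType) (x s : R) n : 0 <= x -> (x ^+ n) `^ s = x `^ (n%:R * s).
Proof. by move=> x0; rewrite -powR_mulrn// powRrM. Qed.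

Section hermite_decay.
Variables (R : realType) (d : nat).
Hypothesis d_gt0 : (0 < d)%N.
Local Notation C := R[i].
Local Notation leb := (@lebesgue_measure R).
Local Notation nu := (lebesgue_cV R d).
Implicit Types (g : 'cV[R]_d -> C).

Lemma powR_prod (x : 'I_d -> R) (s : R) : (forall k, 0 <= x k) ->
  (\prod_(k < d) x k) `^ s = \prod_(k < d) x k `^ s.
Proof.
move=> x0; suff [] : 0 <= \prod_(k < d) x k /\ (\prod_(k < d) x k) `^ s = \prod_(k < d) x k `^ s by [].
elim/big_rec2: _ => [|k y1 y2 _ [y0 e]].
  by have e1 : (1 : R) `^ s = 1 by rewrite powR1.
by split; [rewrite mulr_ge0|rewrite powRM// e].
Qed.

(** Each one-directional bound is not integrable on its own, but their geometric
    mean is a product of integrable functions of one variable. *)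
Lemma cintg_subgauss g (a lam c : R) : 0 < a < 2 -> 0 <= lam -> 0 <= c -> cmeas g ->
  (forall j, subgauss_along j a lam c g) -> cintg nu g.
Proof.
move=> a02 lam0 c0 mg hg.
have dR : 0 < d%:R :> R by rewrite ltr0n.
have b0 : 0 < 2^-1 / d%:R :> R by rewrite divr_gt0.
have l0 : 0 <= lam / d%:R by rewrite divr_ge0// ltW.
pose psi (k : 'I_d) (x : R) : R := expR (- (2^-1 / d%:R * x ^+ 2) + lam / d%:R * `|x| `^ a + 0 * `|x|).
have [jP _] := @rintg_tensor R d psi (fun k => rintg_subgauss a02 b0 l0 (lexx 0)).
apply: (cintg_dom mg (rintgZ c jP)).
have hall : {ae nu, forall y : 'cV[R]_d, forall j, normc (g y) <=
     c * expR (- (2^-1 * `|y j 0| ^+ 2) + lam * `|y j 0| `^ a)}.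
  by apply: filter_forall => j; exact: hg.
apply: filterS hall => y hy.
rewrite -(@ler_pXn2r R d)// ?nnegrE ?normc_ge0 ?mulr_ge0 ?prodr_ge0//; last first.
  by move=> k _; exact: expR_ge0.
have -> : normc (g y) ^+ d = \prod_(k < d) normc (g y) by rewrite prodr_const card_ord.
apply: (@le_trans _ _ (\prod_(k < d) (c * expR (- (2^-1 * `|y k 0| ^+ 2) + lam * `|y k 0| `^ a)))).
  by apply: ler_prod => k _; rewrite normc_ge0 hy.
rewrite big_split prodr_const card_ord exprMn -prodrXl /=.
rewrite le_eqVlt; apply/orP; left; apply/eqP; congr (_ * _); apply: eq_bigr => k _.
rewrite /psi mul0r addr0 -expRM_natl -[y k 0 ^+ 2]real_normK ?num_real//; congr expR.
by field; rewrite gt_eqF.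
Qed.

(** The bounds obtained in the d directions are combined by their geometric mean. *)
Lemma hsize_decay g (a L h : R) : 0 < a < 2 -> 0 < L -> cintg nu g ->
  (forall j, exists2 M : R, 0 <= M & forall t, normc (barg g t) <=
    M * \prod_(k < d | k != j) expR (normc (t k) ^+ 2) * expR (L * normc (t j) `^ a)) ->
  ((a * L) `^ a^-1 / 2 `^ 2^-1) `^ d%:R^-1 < h ->
  exists2 c : R, 0 < c & forall alpha, hsize g alpha <=
    c * (h ^+ mi_size alpha * (mi_fact alpha)%:R `^ (- (d%:R^-1 * (a^-1 - 2^-1)))).
Proof.
move=> a02 L0 jg HM; have a0 : 0 < a by case/andP: a02.
set h1 := _ / _ => h1h; pose s := a^-1 - 2^-1.
have dR : 0 < d%:R :> R by rewrite ltr0n.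
have h10 : 0 < h1 by rewrite divr_gt0 ?powR_gt0// mulr_gt0.
pose k1 := h1 `^ d%:R^-1; have k10 : 0 < k1 by rewrite powR_gt0.
have k1d : k1 ^+ d = h1.
  by rewrite -powR_mulrn ?powR_ge0// -powRrM mulVf ?gt_eqF// powRr1// ltW.
have h0 : 0 < h by apply: lt_trans h1h.
pose rho := h / k1; have rho1 : 1 < rho by rewrite ltr_pdivlMr// mul1r.
have rho0 : 0 < rho by apply: lt_trans rho1.
have : forall j, exists K : R, 0 <= K /\ forall alpha,
    hsize g alpha * (alpha j)`!%:R `^ s <= K * rho ^+ mi_size alpha * h1 ^+ alpha j.
  move=> j; have [M M0 hM] := HM j.
  by have [K K0 hK] := hsize_bound_along a02 L0 rho1 M0 jg hM; exists K.
move=> /choice[K HK].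
have K0 : 0 <= \prod_(j < d) K j by apply: prodr_ge0 => j _; exact: (HK j).1.
pose c := (\prod_(j < d) K j) `^ d%:R^-1 + 1.
have c0 : 0 < c by rewrite ltr_wpDl// powR_ge0.
have cd : \prod_(j < d) K j <= c ^+ d.
  rewrite [leLHS](_ : _ = ((\prod_(j < d) K j) `^ d%:R^-1) ^+ d).
    by rewrite lerXn2r ?nnegrE ?powR_ge0 ?(ltW c0)// lerDl.
  by rewrite -powR_mulrn ?powR_ge0// -powRrM mulVf ?gt_eqF// powRr1.
exists c => // alpha.
have mf0 : 0 < (mi_fact alpha)%:R :> R by rewrite ltr0n /mi_fact prodn_gt0// => k; rewrite fact_gt0.
pose W := (mi_fact alpha)%:R `^ s : R; have W0 : 0 < W by rewrite powR_gt0.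
have WE : W = \prod_(j < d) (alpha j)`!%:R `^ s by rewrite -powR_prod// -natr_prod.
pose n := mi_size alpha.
have prodbound : hsize g alpha ^+ d * W <= (\prod_(j < d) K j) * (rho ^+ n) ^+ d * h1 ^+ n.
  have -> : hsize g alpha ^+ d * W = \prod_(j < d) (hsize g alpha * (alpha j)`!%:R `^ s).
    by rewrite big_split prodr_const card_ord WE.
  have -> : (\prod_(j < d) K j) * (rho ^+ n) ^+ d * h1 ^+ n = \prod_(j < d) (K j * rho ^+ n * h1 ^+ alpha j).
    by rewrite !big_split prodr_const card_ord /= /n /mi_size [h1 ^+ _]expr_sum.
  apply: ler_prod => j _; rewrite mulr_ge0 ?hsize_ge0 ?powR_ge0//=.
  exact: (HK j).2.
have F0 : 0 <= (mi_fact alpha)%:R `^ (- (d%:R^-1 * s)) :> R by exact: powR_ge0.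
rewrite -(@ler_pXn2r R d)// ?nnegrE ?hsize_ge0//; last first.
  by rewrite !mulr_ge0 ?exprn_ge0// ltW.
have -> : (c * (h ^+ mi_size alpha * (mi_fact alpha)%:R `^ (- (d%:R^-1 * s)))) ^+ d =
    c ^+ d * ((rho ^+ n) ^+ d * h1 ^+ n) / W.
  have hE : (h ^+ n) ^+ d = (rho ^+ n) ^+ d * h1 ^+ n.
    by rewrite -k1d -!exprM [(d * n)%N]mulnC -exprMn divfK ?gt_eqF.
  rewrite exprMn exprMn -/n hE -[RHS]mulrA; congr (_ * (_ * _)).
  rewrite -powR_mulrn// -powRrM /W -powRN; congr (_ `^ _).
  by field; rewrite gt_eqF.
rewrite ler_pdivlMr//; apply: (le_trans prodbound); rewrite -mulrA.
by apply: ler_wpM2r => //; rewrite mulr_ge0 ?exprn_ge0// ltW.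
Qed.

End hermite_decay.

(** The constant produced by the geometric mean is below the one of the theorem,
    because 2 `^ a <= 2 * max (2 `^ (a - 1)) 1 and 2 <= d. *)
Lemma decay_rate_lt (R : realType) (d : nat) (a lam : R) : (2 <= d)%N -> 0 < a < 2 -> 0 < lam ->
  0 < cos (a * pi / 4) /\
  ((a * (2 `^ a * lam / cos (a * pi / 4))) `^ a^-1 / 2 `^ 2^-1) `^ d%:R^-1 <=
  d%:R `^ (d%:R^-1 * (a^-1 + 2^-1)) *
         (a * Num.max (2 `^ (a - 1)) 1 * (cos (a * pi / 4))^-1 * lam) `^ ((a * d%:R)^-1).
Proof.
move=> d2 /andP[a0 a2] l0.
have pi0 : 0 < pi :> R by exact: pi_gt0.
have c0 : 0 < cos (a * pi / 4).
  apply: cos_gt0_pihalf; apply/andP; split.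
    apply: (@lt_trans _ _ 0); first by rewrite oppr_lt0 divr_gt0.
    by rewrite divr_gt0// mulr_gt0.
  rewrite -subr_gt0; have -> : pi / 2 - a * pi / 4 = pi * (2 - a) / 4 by field.
  by rewrite divr_gt0// mulr_gt0// subr_gt0.
split=> //; set cc := cos _ in c0 *.
pose K := a * Num.max (2 `^ (a - 1)) 1 / cc * lam.
have m0 : 0 < Num.max (2 `^ (a - 1)) 1 :> R by rewrite lt_max ltr01 orbT.
have K0 : 0 < K by rewrite mulr_gt0// divr_gt0// mulr_gt0.
have dR : 0 < d%:R :> R by rewrite ltr0n; apply: leq_trans d2.
have dRV : 0 <= d%:R^-1 :> R by rewrite invr_ge0 ltW.
have aV : 0 <= a^-1 by rewrite invr_ge0 ltW.
have h1 : a * (2 `^ a * lam / cc) <= 2 * K.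
  have -> : 2 * K = a * (2 * Num.max (2 `^ (a - 1)) 1 * lam / cc) by rewrite /K; field; rewrite gt_eqF.
  rewrite ler_pM2l// ler_pM2r ?invr_gt0// ler_pM2r//.
  have -> : 2 `^ a = 2 * 2 `^ (a - 1) :> R.
    by rewrite powRB ?pnatr_eq0 ?implybT// powRr1// mulrC divfK// pnatr_eq0.
  by rewrite ler_pM2l// le_max lexx.
rewrite -/K [d%:R^-1 * _]mulrC powRrM.
have -> : K `^ (a * d%:R)^-1 = (K `^ a^-1) `^ d%:R^-1 by rewrite invfM powRrM.
rewrite -powRM ?powR_ge0//; apply: ge0_ler_powR => //; rewrite ?nnegrE ?mulr_ge0 ?powR_ge0//.
have t0 : 0 < 2 `^ 2^-1 :> R by rewrite powR_gt0.
rewrite ler_pdivrMr// [leRHS]mulrAC.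
apply: (@le_trans _ _ ((2 * K) `^ a^-1)).
  apply: ge0_ler_powR => //; rewrite nnegrE; last by rewrite mulr_ge0// ltW.
  by rewrite mulr_ge0 ?(ltW a0)// divr_ge0 ?(ltW c0)// mulr_ge0 ?powR_ge0// ltW.
rewrite powRM ?(ltW K0)//; apply: ler_wpM2r; first exact: powR_ge0.
apply: (@le_trans _ _ (d%:R `^ a^-1)).
  by apply: ge0_ler_powR; rewrite ?nnegrE ?ler_nat// ltW.
rewrite -[leLHS]mulr1; apply: ler_pM; rewrite ?powR_ge0//.
  by rewrite ler_powR ?ler1n ?lerDl ?invr_ge0//; apply: leq_trans d2.
have e1 : 1 `^ 2^-1 = 1 :> R by rewrite powR1.
by rewrite -[leLHS]e1; apply: ge0_ler_powR; rewrite ?nnegrE ?invr_ge0// ler1n.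
Qed.

(** * Diagonal Hermite series *)

Section geometric_majorant.
Variable R : realType.
Variables (v : nat -> R) (c : R).
Hypothesis v_le : forall n, `|v n| <= c * 2^-1 ^+ n.

Lemma sum_geometric_half N : \sum_(0 <= k < N) c * (2^-1 : R) ^+ k = 2 * c * (1 - 2^-1 ^+ N).
Proof.
elim: N => [|N IH]; first by rewrite big_nil expr0 subrr mulr0.
by rewrite big_nat_recr//= IH exprS; field.
Qed.

Let c_ge0 : 0 <= c.
Proof. by have := le_trans (normr_ge0 _) (v_le 0); rewrite expr0 mulr1. Qed.

Lemma normed_series_le N : \sum_(0 <= k < N) `|v k| <= 2 * c.
Proof.
apply: (@le_trans _ _ (\sum_(0 <= k < N) c * (2^-1 : R) ^+ k)); first exact: ler_sum.
by rewrite sum_geometric_half ler_piMr ?mulr_ge0// gerBl exprn_ge0// invr_ge0.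
Qed.

Lemma series_majorant_cvg : cvgn (series v).
Proof.
apply: normed_cvg; apply: (@series_le_cvg _ _ (fun n => c * 2^-1 ^+ n)).
- by move=> n; exact: normr_ge0.
- by move=> n; apply: mulr_ge0; [exact: c_ge0|rewrite exprn_ge0// invr_ge0].
- by [].
apply: (@is_cvg_geometric_series R c 2^-1).
by rewrite ger0_norm ?invr_ge0// invf_lt1// ltr1n.
Qed.

End geometric_majorant.

Section dominated_series.
Variables (R : realType) (d : nat) (a lam c : R).
Hypothesis d_gt0 : (0 < d)%N.
Hypothesis a02 : 0 < a < 2.
Hypothesis lam_ge0 : 0 <= lam.
Local Notation C := R[i].
Local Notation nu := (lebesgue_cV R d).

Definition subgauss (x : R) : R := expR (- (2^-1 * `|x| ^+ 2) + lam * `|x| `^ a).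

Variable v : nat -> 'cV[R]_d -> R.
Hypothesis mv : forall n, measurable_fun setT (v n).
Hypothesis v_le : forall n y j, `|v n y| <= c * 2^-1 ^+ n * subgauss (y j 0).

Let w (y : 'cV[R]_d) : R := limn (series (v ^~ y)).

Let v_le' y j n : `|v n y| <= (c * subgauss (y j 0)) * 2^-1 ^+ n.
Proof. by rewrite mulrAC. Qed.

Lemma dominated_series_cvg y : series (v ^~ y) @ \oo --> w y.
Proof. exact: (series_majorant_cvg (v_le' y (Ordinal d_gt0))). Qed.

Lemma dominated_series_le y j : `|w y| <= 2 * c * subgauss (y j 0).
Proof.
rewrite -mulrA; have h : (fun N => `|series (v ^~ y) N|) @ \oo --> `|w y|.
  by apply: cvg_norm; exact: dominated_series_cvg.
apply: (ler_cvg_to h (cvg_cst _)); apply: nearW => N.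
apply: le_trans (normed_series_le (v_le' y j) N).
exact: ler_norm_sum.
Qed.

Lemma measurable_dominated_series : measurable_fun setT w.
Proof.
apply: (@measurable_fun_cvg _ _ _ _ (fun N y => series (v ^~ y) N)).
  by move=> N; exact: measurable_sum.
by move=> y _; exact: dominated_series_cvg.
Qed.

Let c_ge0 : 0 <= c.
Proof.
have := le_trans (normr_ge0 _) (v_le 0 0 (Ordinal d_gt0)).
by rewrite expr0 mulr1 pmulr_lge0// expR_gt0.
Qed.

Lemma rintg_dominated_series : rintg nu w.
Proof.
have c20 : 0 <= 2 * c by rewrite mulr_ge0.
suff [] : cintg nu (fun y => (w y)%:C) by [].
apply: (cintg_subgauss d_gt0 a02 lam_ge0 c20 (cmeas_real measurable_dominated_series)) => j.
by apply: aeW => y; rewrite normc_real; exact: dominated_series_le.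
Qed.

End dominated_series.

Section diagonal_series.
Variables (R : realType) (d : nat) (a : R) (gam : nat -> R).
Hypothesis d_gt0 : (0 < d)%N.
Hypothesis a02 : 0 < a < 2.
Hypothesis gam_ge0 : forall n, 0 <= gam n.
Local Notation C := R[i].
Local Notation leb := (@lebesgue_measure R).
Local Notation nu := (lebesgue_cV R d).

(** The coefficient for which the normalized size of the Hermite coefficient of
    index (n, ..., n) is gam n * n! `^ (- (1 / a - 1 / 2)). *)
Definition diag_coef n : R :=
  gam n * n`!%:R `^ (- (a^-1 - 2^-1)) * (n`!%:R `^ 2^-1 / (2 `^ 2^-1) ^+ n) ^+ d.

Definition diag_term n (y : 'cV[R]_d) : R := diag_coef n * \prod_(k < d) hfun n (y k 0).

Definition diag_series (y : 'cV[R]_d) : R := limn (series (diag_term ^~ y)).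

Lemma measurable_diag_term n : measurable_fun setT (diag_term n).
Proof.
suff [] : cmeas (fun y => (diag_term n y)%:C) by [].
have -> : (fun y => (diag_term n y)%:C) =
  (fun y : 'cV[R]_d => (diag_coef n)%:C * \prod_(k < d) (hfun n (y k 0))%:C).
  by apply/funext => y; rewrite (rmorphM (real_complex R)) (rmorph_prod (real_complex R)).
apply: cmeasM; first exact: cmeas_cst.
by apply: cmeas_prod => k; exact: (cmeas_coord k (cmeas_real (measurable_hfun n))).
Qed.

Lemma diag_coef_ge0 n : 0 <= diag_coef n.
Proof. by rewrite !mulr_ge0 ?exprn_ge0 ?divr_ge0 ?exprn_ge0 ?powR_ge0. Qed.

Variables (kap c : R).
Hypothesis kap01 : 0 < kap <= 1.
Hypothesis gam_le : forall n, gam n <= c * (kap / (2 * 8 ^+ d)) ^+ n.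

Let lam := kap `^ a / a.

Let lam_ge0 : 0 <= lam.
Proof. by case/andP: a02 => a0 _; rewrite divr_ge0 ?powR_ge0// ltW. Qed.

(** In the direction [j] the sharp bound of the Hermite function is used, and
    in the other directions the uniform one. *)
Lemma diag_term_le n (y : 'cV[R]_d) (j : 'I_d) :
  `|diag_term n y| <= c * 2^-1 ^+ n * subgauss a lam (y j 0).
Proof.
have [k0 k1] := andP kap01.
have f0 : n`!%:R != 0 :> R by rewrite pnatr_eq0 -lt0n fact_gt0.
pose F : R := n`!%:R `^ 2^-1; pose T : R := (2 `^ 2^-1) ^+ n.
have F0 : 0 <= F by exact: powR_ge0.
have T1 : 1 <= T.
  rewrite exprn_ege1//; have e1 : 1 `^ 2^-1 = 1 :> R by rewrite powR1.
  by rewrite -[leLHS]e1; apply: ge0_ler_powR; rewrite ?nnegrE ?invr_ge0// ler1n.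
have T0 : 0 < T by apply: lt_le_trans T1.
pose E := subgauss a lam (y j 0).
have e : `|diag_term n y| = gam n * (T ^+ d)^-1 *
   ((n`!%:R `^ (1 - a^-1) * `|hfun n (y j 0)|) * \prod_(k < d | k != j) (F * `|hfun n (y k 0)|)).
  rewrite /diag_term normrM ger0_norm ?diag_coef_ge0// normr_prod /diag_coef -/F -/T.
  rewrite exprMn exprVn (bigD1 j)//= big_split /= prodr_const.
  rewrite (_ : #|[pred k | k != j]| = d.-1); last by rewrite cardC1 card_ord.
  have -> : n`!%:R `^ (1 - a^-1) = n`!%:R `^ (- (a^-1 - 2^-1)) * F :> R.
    by rewrite /F -powRD ?f0 ?implybT//; congr (_ `^ _); field; case/andP: a02 => a0 _; rewrite gt_eqF.
  have -> : F ^+ d = F * F ^+ d.-1 by rewrite -exprS prednK.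
  by ring.
rewrite e; apply: (@le_trans _ _ (gam n * ((8 / kap) ^+ n * E * (8 ^+ n) ^+ d.-1))).
  rewrite -mulrA ler_wpM2l// -[leRHS]mul1r; apply: ler_pM.
  - by rewrite invr_ge0 exprn_ge0// ltW.
  - rewrite !mulr_ge0 ?powR_ge0 ?prodr_ge0// => k _; by rewrite mulr_ge0.
  - by rewrite invf_le1 ?exprn_gt0// exprn_ege1.
  apply: ler_pM.
  - by rewrite mulr_ge0 ?powR_ge0.
  - by apply: prodr_ge0 => k _; rewrite mulr_ge0.
  - exact: hfun_bound_subgauss.
  have -> : (8 ^+ n) ^+ d.-1 = \prod_(k < d | k != j) (8 ^+ n : R).
    by rewrite prodr_const (_ : #|[pred k | k != j]| = d.-1)// cardC1 card_ord.
  by apply: ler_prod => k _; rewrite mulr_ge0//= hfun_bound.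
have E0 : 0 <= E by exact: expR_ge0.
have q0 : 0 <= (8 / kap) ^+ n * E * (8 ^+ n) ^+ d.-1.
  by rewrite !mulr_ge0 ?exprn_ge0 ?divr_ge0 ?(ltW k0).
apply: (le_trans (ler_wpM2r q0 (gam_le n))); rewrite le_eqVlt; apply/orP; left; apply/eqP.
rewrite -!mulrA; congr (c * _).
have -> : (kap / (2 * 8 ^+ d)) ^+ n * ((8 / kap) ^+ n * (E * (8 ^+ n) ^+ d.-1)) =
  ((kap / (2 * 8 ^+ d)) * (8 / kap) * 8 ^+ d.-1) ^+ n * E.
  by rewrite !exprMn -[in RHS]exprM [(d.-1 * n)%N]mulnC [in RHS]exprM; ring.
congr (_ ^+ n * _); have -> : 8 ^+ d = 8 * 8 ^+ d.-1 :> R by rewrite -exprS prednK.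
field.
by rewrite gt_eqF//= expf_neq0// pnatr_eq0.
Qed.

Let abs_series (y : 'cV[R]_d) : R := limn (series (fun n => `|diag_term n y|)).

Let abs_le n (y : 'cV[R]_d) (j : 'I_d) :
  `| `|diag_term n y| | <= c * 2^-1 ^+ n * subgauss a lam (y j 0).
Proof. by rewrite normr_id; exact: diag_term_le. Qed.

Let rintg_abs_series : rintg nu abs_series.
Proof.
apply: (rintg_dominated_series d_gt0 a02 lam_ge0 _ abs_le) => n.
exact: measurableT_comp (@measurable_absr R) (measurable_diag_term n).
Qed.

Let series_le_abs N y : `|series (diag_term ^~ y) N| <= abs_series y.
Proof.
apply: (@le_trans _ _ (series (fun n => `|diag_term n y|) N)); first exact: ler_norm_sum.
apply: nondecreasing_cvgn_le; last exact: (dominated_series_cvg d_gt0 abs_le).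
by apply: nondecreasing_series => n _ _.
Qed.

Let term_le_abs n y : `|diag_term n y| <= abs_series y.
Proof.
apply: (@le_trans _ _ (series (fun n => `|diag_term n y|) n.+1)).
  by rewrite /series /= big_nat_recr//= lerDr sumr_ge0.
apply: nondecreasing_cvgn_le; last exact: (dominated_series_cvg d_gt0 abs_le).
by apply: nondecreasing_series => k _ _.
Qed.

Lemma cmeas_diag_series : cmeas (fun y => (diag_series y)%:C).
Proof.
by apply: cmeas_real; exact: (measurable_dominated_series d_gt0 measurable_diag_term diag_term_le).
Qed.

Lemma diag_series_le y j : `|diag_series y| <= 2 * c * subgauss a lam (y j 0).
Proof. exact: (dominated_series_le d_gt0 diag_term_le). Qed.

Lemma cint_diag_series (phi : 'cV[R]_d -> C) (B : R) : cmeas phi -> 0 <= B ->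
  (forall y, normc (phi y) <= B) ->
  ccvg (fun N => \sum_(0 <= n < N) cint nu (fun y => (diag_term n y)%:C * phi y))
    (cint nu (fun y => (diag_series y)%:C * phi y)).
Proof.
move=> mphi B0 hB.
have jn n : cintg nu (fun y => (diag_term n y)%:C * phi y).
  apply: (cintg_dom _ (rintgZ B rintg_abs_series)).
    apply: cmeasM => //; exact: (cmeas_real (measurable_diag_term n)).
  apply: aeW => y; rewrite normcM normc_real mulrC.
  by apply: ler_pM; rewrite ?normc_ge0.
have -> : (fun N => \sum_(0 <= n < N) cint nu (fun y => (diag_term n y)%:C * phi y)) =
   (fun N => cint nu (fun y => (series (diag_term ^~ y) N)%:C * phi y)).
  apply/funext => N; rewrite -cint_sum//; apply: eq_cint => y.
  by rewrite /series /= (raddf_sum (real_complex R)) mulr_suml.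
apply: (dominated_ccvg _ _ (rintgZ B rintg_abs_series)).
- move=> N; apply: cmeasM => //; apply: cmeas_real.
  by apply: measurable_sum => n; exact: measurable_diag_term.
- by apply: cmeasM => //; exact: cmeas_diag_series.
- move=> y; apply: ccvgM; last exact: ccvg_cst.
  apply: ccvg_of_components => /=; last exact: cvg_cst.
  exact: (dominated_series_cvg d_gt0 diag_term_le).
- apply: aeW => y N; rewrite normcM normc_real mulrC.
  by apply: ler_pM; rewrite ?normc_ge0.
Qed.

Lemma cintg_diag_series : cintg nu (fun y => (diag_series y)%:C).
Proof.
suff h : rintg nu diag_series by split => //=; exact: (cintg0 nu).1.
exact: (rintg_dominated_series d_gt0 a02 lam_ge0 measurable_diag_term diag_term_le).
Qed.

(** Every Hermite function is an eigenfunction, with an eigenvalue of fixed modulus. *)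
Lemma eft_diag_term n (eta : 'cV[R]_d) :
  normc (cint nu (fun y => (diag_term n y)%:C * phase y eta)) =
    gauss_mass 2^-1 ^+ d * `|diag_term n eta|.
Proof.
pose psi k (x : R) : C := cexp (- ((0 +i* 1) * (eta k 0 * x)%:C)) * (hfun n x)%:C.
have jpsi k : cintg leb (psi k).
  have := cintg_hfun R n; move=> jh.
  apply: (@cintg_dom _ _ _ leb _ (fun x => normc (hfun n x)%:C)).
  - apply: cmeasM; last by apply: cmeas_real; exact: measurable_hfun.
    apply: cmeas_cexp.
    have -> : (fun x : R => - ((0 +i* 1) * (eta k 0 * x)%:C)) = (fun x : R => (- (0 +i* 1)) * (eta k 0 * x)%:C).
      by apply/funext => x; rewrite mulNr.
    apply: cmeasM; first exact: cmeas_cst.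
    by apply: cmeas_real; apply: measurable_funM.
  - exact: cintg_normc.
  - by apply: aeW => x; rewrite normcM normc_cexp /= !mul0r !mul1r subr0 oppr0 expR0 mul1r.
have [jP eP] := cint_tensor jpsi.
have -> : (fun y => (diag_term n y)%:C * phase y eta) =
    (fun y => (diag_coef n)%:C * \prod_(k < d) psi k (y k 0)).
  apply/funext => y; rewrite /diag_term (rmorphM (real_complex R)) (rmorph_prod (real_complex R)).
  rewrite -mulrA phase_prod -big_split; congr (_ * _); apply: eq_bigr => k _.
  by rewrite /psi [eta k 0 * _]mulrC /= mulrC.
rewrite cintZ// eP normcM normc_prod normc_real.
rewrite (eq_bigr (fun k => gauss_mass 2^-1 * `|hfun n (eta k 0)|)); last first.
  move=> k _; have := congr1 (@normc R) (hfun_fourier n (eta k 0)).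
  have ni : normc ((0 : R) +i* (1 : R)) = 1 by rewrite /= expr0n add0r expr1n sqrtr1.
  rewrite normcM normcX ni expr1n mul1r => ->.
  by rewrite normcM !normc_real ger0_norm// ltW// gauss_mass_gt0// half_gt0.
rewrite big_split prodr_const card_ord /= /diag_term [in RHS]normrM normr_prod; exact: mulrCA.
Qed.

Lemma eft_diag_series_le (eta : 'cV[R]_d) j :
  normc (eft (fun y => (diag_series y)%:C) eta) <=
    gauss_mass 2^-1 ^+ d * (2 * c) * subgauss a lam (eta j 0).
Proof.
have gm0 : 0 <= gauss_mass 2^-1 ^+ d :> R by rewrite exprn_ge0// ltW// gauss_mass_gt0// half_gt0.
have h := @cint_diag_series (fun y => phase y eta) 1 (cmeas_phase_l eta) ler01
   (fun y => eq_ind_r (fun z => z <= 1) (lexx 1) (normc_phase y eta)).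
apply: (ccvg_norm_le h) => N; apply: (le_trans (normc_sum _ _ _)).
rewrite (eq_bigr (fun n => gauss_mass 2^-1 ^+ d * `|diag_term n eta|)) => [|n _]; last exact: eft_diag_term.
rewrite -mulr_sumr -!mulrA ler_wpM2l//.
apply: (@normed_series_le _ (diag_term ^~ eta) (c * subgauss a lam (eta j 0))) => n.
by rewrite mulrAC; exact: diag_term_le.
Qed.

Lemma hcoef_diag_series m :
  hcoef (fun y => (diag_series y)%:C) (fun=> m) =
  (diag_coef m)%:C * ((gauss_mass (1 : R))%:C * (2 ^+ m / m`!%:R)) ^+ d.
Proof.
pose phi (y : 'cV[R]_d) : C := \prod_(k < d) (hfun m (y k 0))%:C.
have mphi : cmeas phi.
  by apply: cmeas_prod => k; exact: (cmeas_coord k (cmeas_real (measurable_hfun m))).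
have B0 : 0 <= \prod_(k < d) (8 ^+ m : R) by apply: prodr_ge0.
have hB y : normc (phi y) <= \prod_(k < d) 8 ^+ m.
  rewrite normc_prod; apply: ler_prod => k _; rewrite normc_ge0.
  exact: hfun_bounded.
have h := cint_diag_series mphi B0 hB.
have termE n : cint nu (fun y => (diag_term n y)%:C * phi y) =
   (n == m)%:R * ((diag_coef m)%:C * ((gauss_mass (1 : R))%:C * (2 ^+ m / m`!%:R)) ^+ d).
  pose psi (x : R) : C := (hfun n x)%:C * (hfun m x)%:C.
  have jpsi : cintg leb psi.
    apply: (@cintg_dom _ _ _ leb _ (fun x => 8 ^+ m * normc (hfun n x)%:C)).
    - by apply: cmeasM; apply: cmeas_real; exact: measurable_hfun.
    - by apply: rintgZ; exact: (cintg_normc (cintg_hfun R n)).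
    - apply: aeW => x; rewrite normcM mulrC; apply: ler_wpM2r; first exact: normc_ge0.
      exact: hfun_bounded.
  have [jP eP] := @cint_tensor R d (fun=> psi) (fun=> jpsi).
  have -> : (fun y => (diag_term n y)%:C * phi y) =
    (fun y => (diag_coef n)%:C * \prod_(k < d) psi (y k 0)).
    apply/funext => y; rewrite /diag_term (rmorphM (real_complex R)) (rmorph_prod (real_complex R)).
    by rewrite -mulrA -big_split.
  rewrite cintZ// eP prodr_const card_ord hfun_orthogonal.
  by case: eqVneq => [->|_]; rewrite ?mul1r// !mul0r expr0n (gtn_eqF d_gt0) mulr0.
pose l := (diag_coef m)%:C * ((gauss_mass (1 : R))%:C * (2 ^+ m / m`!%:R)) ^+ d.
apply: (ccvg_unique h); apply: cvg_near_cst; exists m.+1 => // N /= mN.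
rewrite (eq_bigr (fun n => (n == m)%:R * l)) => [|n _]; last exact: termE.
rewrite (bigD1_seq m) ?iota_uniq ?mem_index_iota//= eqxx mul1r big1 => [|n nm].
  by rewrite addr0 subrr normc0.
by rewrite (negPf nm) mul0r.
Qed.

Lemma hsize_diag_series m :
  hsize (fun y => (diag_series y)%:C) (fun=> m) =
  gam m * m`!%:R `^ (- (a^-1 - 2^-1)) * gauss_mass 1 ^+ d.
Proof.
have f0 : 0 < m`!%:R :> R by rewrite ltr0n fact_gt0.
have g0 : 0 <= gauss_mass (1 : R) by exact/ltW/gauss_mass_gt0.
pose F : R := m`!%:R `^ 2^-1; pose T : R := (2 `^ 2^-1) ^+ m.
have FF : F ^+ 2 = m`!%:R by rewrite -powR_mulrn ?powR_ge0// -powRrM mulVf ?pnatr_eq0// powRr1// ltW.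
have TT : T ^+ 2 = 2 ^+ m.
  by rewrite -exprM mulnC exprM -[_ ^+ 2]powR_mulrn ?powR_ge0// -powRrM mulVf ?pnatr_eq0// powRr1.
have T0 : T != 0 by rewrite expf_neq0// gt_eqF// powR_gt0.
have F0 : F != 0 by rewrite gt_eqF// powR_gt0.
rewrite /hsize hcoef_diag_series.
have -> : (gauss_mass (1 : R))%:C * (2 ^+ m / m`!%:R) = (gauss_mass 1 * (2 ^+ m / m`!%:R))%:C :> C.
  rewrite !(rmorphM (real_complex R)) fmorphV (rmorphXn (real_complex R)).
  by rewrite !(rmorph_nat (real_complex R)).
rewrite -(rmorphXn (real_complex R)) -(rmorphM (real_complex R)) normc_real.
rewrite ger0_norm; last first.
  by rewrite mulr_ge0 ?diag_coef_ge0 ?exprn_ge0 ?mulr_ge0// divr_ge0 ?exprn_ge0.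
rewrite prodr_const card_ord /diag_coef -/F -/T.
have e : gauss_mass (1 : R) = (F / T) * (gauss_mass 1 * (2 ^+ m / m`!%:R)) * (F / T).
  by rewrite -FF -TT; field; rewrite T0 F0.
rewrite [in RHS]e; move: (gauss_mass 1 * _) (F / T) (gam m * _) => G p u.
by rewrite !exprMn !mulrA mulrAC.
Qed.

End diagonal_series.

(** * Reduction to the identity matrix *)

Section change_of_frame.
Variables (R : realType) (d : nat) (A : 'M[R]_d).
Hypothesis hA : spd A.
Local Notation C := R[i].
Local Notation nu := (lebesgue_cV R d).
Local Notation B := (sqrtmx A).
Implicit Types (f g : 'cV[R]_d -> C).

Lemma fourier_phase f xi :
  fourier f xi = ((2 * pi) `^ (- (d%:R / 2)))%:C * cint nu (fun x => f x * phase x xi).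
Proof.
rewrite /fourier; congr (_ * _); apply: eq_cint => x; congr (_ * _).
rewrite /phase /cexp /=.
by apply: complex_ext; rewrite /= !mul0r !mul1r subr0 oppr0 expR0 !mul1r add0r.
Qed.

Lemma subgauss_along_weaken j (a lam lam' c c' : R) g : 0 <= c <= c' -> lam <= lam' ->
  subgauss_along j a lam c g -> subgauss_along j a lam' c' g.
Proof.
move=> /andP[c0 cc] ll; apply: filterS => y /le_trans; apply.
apply: ler_pM; rewrite ?expR_ge0//.
by rewrite ler_expR lerD2l ler_wpM2r ?powR_ge0.
Qed.

(** In the coordinates y = B x, where B is the square root of A, the decay
    condition becomes the same condition for the identity matrix. *)
Lemma change_of_frame : exists k1 k2 k3 : R, [/\ 0 < k1, 0 < k2, 0 < k3 &
  [/\ forall g, cintg nu g -> forall xi,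
        normc (fourier (fun x => g (B *m x)) xi) = k1 * normc (eft g (invmx B *m xi)),
      forall g, cintg nu g -> forall alpha,
        normc (hermite_coef A (fun x => g (B *m x)) alpha) = k2 * hsize g alpha &
      forall f : 'cV[R]_d -> \bar R, measurable_fun setT f -> (forall x, (0 <= f x)%E) ->
        (\int[nu]_x f (B *m x)%R = k3%:E * \int[nu]_x f x)%E]].
Proof.
have [hB BB] := sqrtmxP hA; have uB := spd_unitmx hB.
have [c c0 [H1 H2 H3]] := linear_change_of_variables uB.
have pi20 : 0 < 2 * pi :> R by rewrite mulr_gt0// pi_gt0.
pose K : R := (2 * pi) `^ (- (d%:R / 2)); have K0 : 0 < K by rewrite powR_gt0.
pose k2 : R := c * ((\det A) `^ 4^-1 * pi `^ (- (d%:R / 4))).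
have k20 : 0 < k2 by rewrite !mulr_gt0// powR_gt0 ?det_gt0 ?pi_gt0.
exists (K * c), k2, c; split => //; first exact: mulr_gt0.
split=> // [g jg xi|g jg alpha].
  pose psi y := g y * phase y (invmx B *m xi).
  have jpsi : cintg nu psi by exact: cintg_phase.
  have [_ e] := H2 psi jpsi.
  have -> : fourier (fun x => g (B *m x)) xi = (K * c)%:C * eft g (invmx B *m xi).
    rewrite fourier_phase (rmorphM (real_complex R)) -mulrA; congr (_ * _).
    rewrite -e; apply: eq_cint => x; rewrite /psi; congr (_ * _).
    by rewrite /phase dot_mulmx hB.1 mulmxA mulmxV// mul1mx.
  by rewrite normcM normc_real ger0_norm// ltW// mulr_gt0.
pose psi y := g y * \prod_(k < d) (hfun (alpha k) (y k 0))%:C.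
have jpsi : cintg nu psi by exact: cintg_hcoef.
have [jpsiB e] := H2 psi jpsi.
pose q : R := (\det A) `^ 4^-1 * (pi `^ (- (d%:R / 4)) *
   ((2 ^ mi_size alpha * mi_fact alpha)%N%:R) `^ (- 2^-1)) * \prod_(k < d) (alpha k)`!%:R.
have hE x : hermiteA A alpha x = q * \prod_(k < d) hfun (alpha k) ((B *m x) k 0).
  by rewrite /hermiteA hermiteE big_split /q /= !mulrA.
have -> : hermite_coef A (fun x => g (B *m x)) alpha = q%:C * (c%:C * hcoef g alpha).
  rewrite -[c%:C * _]e -cintZ//; apply: eq_cint => x.
  transitivity (g (B *m x) * (hermiteA A alpha x)%:C).
    by congr (_ * _); exact: conjc_real.
  rewrite hE (rmorphM (real_complex R)) (rmorph_prod (real_complex R)).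
  by rewrite /psi mulrCA.
have q0 : 0 <= q by rewrite !mulr_ge0 ?powR_ge0 ?prodr_ge0.
rewrite !normcM !normc_real !ger0_norm ?(ltW c0)// /hsize /k2.
have nat0 (n : nat) : (0 < n)%N -> n%:R != 0 :> R by rewrite pnatr_eq0 lt0n.
have qE : q = (\det A) `^ 4^-1 * pi `^ (- (d%:R / 4)) *
   \prod_(k < d) ((alpha k)`!%:R `^ 2^-1 / (2 `^ 2^-1) ^+ alpha k).
  rewrite /q -!mulrA; congr (_ * (_ * _)).
  have -> : (2 ^ mi_size alpha * mi_fact alpha)%N%:R =
      \prod_(k < d) (2 ^+ alpha k * (alpha k)`!%:R) :> R.
    by rewrite natrM natrX big_split /= /mi_size expr_sum /mi_fact natr_prod.
  rewrite powR_prod => [|k]; last by rewrite mulr_ge0 ?exprn_ge0.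
  rewrite -big_split /=; apply: eq_bigr => k _.
  have f0 : (alpha k)`!%:R != 0 :> R by rewrite nat0 ?fact_gt0.
  rewrite powRM ?exprn_ge0// -mulrA [RHS]mulrC; congr (_ * _).
    rewrite powRN (powR_expn 2^-1 (alpha k) (ler0n R 2)) mulrC powRrM.
    by rewrite (powR_mulrn _ (powR_ge0 2 2^-1)).
  rewrite -[X in _ * X]powRr1 // -powRD; last by rewrite f0 implybT.
  by congr (_ `^ _); field.
by rewrite qE; ring.
Qed.

End change_of_frame.

(** * The decay condition for a general matrix *)

Section decay_of_coefficients.
Variables (R : realType) (d : nat) (A : 'M[R]_d).
Hypothesis hA : spd A.
Hypothesis d2 : (2 <= d)%N.
Local Notation C := R[i].
Local Notation nu := (lebesgue_cV R d).
Local Notation B := (sqrtmx A).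
Implicit Types (f g : 'cV[R]_d -> C).

Lemma hermite_coef_decay f (a lam h : R) : 0 < a < 2 -> in_L2 f -> 0 < lam ->
  decay_cond A a lam f ->
  d%:R `^ (d%:R^-1 * (a^-1 + 2^-1)) *
    (a * Num.max (2 `^ (a - 1)) 1 * (cos (a * pi / 4))^-1 * lam) `^ ((a * d%:R)^-1) < h ->
  exists2 c : R, 0 < c & forall alpha, normc (hermite_coef A f alpha) <=
    c * (h ^+ mi_size alpha * (mi_fact alpha)%:R `^ (- (d%:R^-1 * (a^-1 - 2^-1)))).
Proof.
move=> a02 [mR mI _] lam0 dec hh; have [a0 a2] := andP a02.
have d0 : (0 < d)%N by apply: leq_trans d2.
have [hB BB] := sqrtmxP hA; have uB := spd_unitmx hB.
have uBi : invmx B \in unitmx by rewrite unitmx_inv.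
pose g y := f (invmx B *m y).
have fE : f = (fun x => g (B *m x)) by apply/funext => x; rewrite /g mulKmx.
have mg : cmeas g by exact: (cmeas_comp (measurable_mulmx (invmx B)) (conj mR mI)).
have [_ _ [_ _ chB]] := linear_change_of_variables uB.
have [_ _ [_ _ chBi]] := linear_change_of_variables uBi.
have gb j : exists2 c : R, 0 <= c & subgauss_along j a lam c g.
  have [[c c0 H] _] := dec j; exists c; first exact: ltW.
  apply: filterS (chBi _ H) => y.
  have -> : dot (A *m (invmx B *m y)) (v_vec A j) = y j 0.
    by rewrite (dot_v_vec j _ hA) (mulKVmx uB).
  by [].
have jg : cintg nu g.
  have : forall j, exists c : R, 0 <= c /\ subgauss_along j a lam c g.
    by move=> j; have [c c0 hc] := gb j; exists c.
  move=> /choice[c hc].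
  apply: (@cintg_subgauss _ _ d0 g a lam (\sum_(k < d) c k) a02 (ltW lam0)) => //.
    by apply: sumr_ge0 => k _; exact: (hc k).1.
  move=> j; apply: subgauss_along_weaken (lexx lam) (hc j).2.
  rewrite (hc j).1 (bigD1 j)//= lerDl sumr_ge0// => k _; exact: (hc k).1.
have [k1 [k2 [k3 [k10 k20 _ [hF hH _]]]]] := change_of_frame hA.
have fb j : exists2 c : R, 0 <= c & subgauss_along j a lam c (eft g).
  have [_ [c c0 H]] := dec j; exists (c / k1); first by rewrite divr_ge0// ltW.
  apply: filterS (chB _ H) => y.
  have -> : dot (invmx A *m (B *m y)) (w_vec A j) = y j 0.
    by rewrite (dot_w_vec j _ hA) (mulKmx uB).
  have -> : normc (fourier f (B *m y)) = k1 * normc (eft g y).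
    by rewrite [in LHS]fE (hF _ jg) (mulKmx uB).
  by rewrite mulrC -ler_pdivlMr// mulrAC.
have [c0 cmp] := decay_rate_lt d2 a02 lam0.
pose L := 2 `^ a * lam / cos (a * pi / 4).
have L0 : 0 < L by rewrite divr_gt0// mulr_gt0// powR_gt0.
have HM j : exists2 M : R, 0 <= M & forall t, normc (barg g t) <=
    M * \prod_(k < d | k != j) expR (normc (t k) ^+ 2) * expR (L * normc (t j) `^ a).
  have [c1 c10 h1] := gb j; have [c2 c20 h2] := fb j.
  exact: (barg_growth a02 (ltW lam0) c10 c20 jg h1 h2).
have [c cpos hc] := hsize_decay d0 a02 L0 jg HM (le_lt_trans cmp hh).
exists (k2 * c); first exact: mulr_gt0.
by move=> alpha; rewrite fE hH// -mulrA ler_pM2l.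
Qed.

Lemma subgauss_bounded (a lam : R) : 0 < a < 2 -> 0 <= lam ->
  exists2 K : R, 0 <= K & forall x : R, subgauss a lam x <= K.
Proof.
move=> a02 lam0; have [c c0 hc] := powR_le_sqr a02 (half_gt0 R) lam0.
exists (expR c) => [|x]; first exact: expR_ge0.
rewrite ler_expR; apply: (le_trans (lerD (lexx _) (hc x))).
by rewrite -[x ^+ 2]real_normK ?num_real// addrA addNr add0r.
Qed.

Definition diag_example (a : R) gam (x : 'cV[R]_d) : C := (diag_series a gam (B *m x))%:C.

Section example.
Variables (a : R) (gam : nat -> R).
Hypothesis a02 : 0 < a < 2.
Hypothesis gam_ge0 : forall n, 0 <= gam n.

Let d0 : (0 < d)%N. Proof. exact: leq_trans d2. Qed.

Section rate.
Variables (kap c : R).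
Hypothesis kap01 : 0 < kap <= 1.
Hypothesis c_gt0 : 0 < c.
Hypothesis gam_le : forall n, gam n <= c * (kap / (2 * 8 ^+ d)) ^+ n.

Let lam_ge0 : 0 <= kap `^ a / a.
Proof. by case/andP: a02 => a0 _; rewrite divr_ge0 ?powR_ge0// ltW. Qed.

Let jg : cintg nu (fun y : 'cV[R]_d => (diag_series a gam y)%:C).
Proof. exact: (cintg_diag_series d0 a02 gam_ge0 kap01 gam_le). Qed.

Lemma diag_example_decay (lam : R) : kap `^ a / a <= lam -> decay_cond A a lam (diag_example a gam).
Proof.
move=> kl j; have [hB BB] := sqrtmxP hA; have uB := spd_unitmx hB.
have [k1 [k2 [k3 [k10 k20 _ [hF _ _]]]]] := change_of_frame hA.
have mono (x : R) : subgauss a (kap `^ a / a) x <= subgauss a lam x.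
  by rewrite ler_expR lerD2l ler_wpM2r ?powR_ge0.
split.
  exists (2 * c); first exact: mulr_gt0.
  apply: aeW => x; rewrite dot_v_vec// normc_real.
  apply: (le_trans (diag_series_le d0 a02 gam_ge0 kap01 gam_le (B *m x) j)).
  by rewrite ler_pM2l ?mulr_gt0//; exact: mono.
have gm0 : 0 < gauss_mass 2^-1 ^+ d :> R by rewrite exprn_gt0// gauss_mass_gt0// half_gt0.
exists (k1 * (gauss_mass 2^-1 ^+ d * (2 * c))); first by rewrite !mulr_gt0.
apply: aeW => x; rewrite dot_w_vec//.
have -> : normc (fourier (diag_example a gam) x) = k1 * _ := hF _ jg x.
rewrite -mulrA ler_pM2l//.
apply: (le_trans (eft_diag_series_le d0 a02 gam_ge0 kap01 gam_le (invmx B *m x) j)).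
by rewrite ler_pM2l ?mulr_gt0//; exact: mono.
Qed.

Lemma diag_example_L2 : in_L2 (diag_example a gam).
Proof.
have mg := cintg_meas jg.
have [mR mI] : cmeas (diag_example a gam) by exact: (cmeas_comp (measurable_mulmx B) mg).
split => //.
have [k1 [k2 [k3 [_ _ _ [_ _ hI]]]]] := change_of_frame hA.
pose g2 (y : 'cV[R]_d) : \bar R := (normc (diag_series a gam y)%:C ^+ 2)%:E.
have mn := cmeas_normc mg.
have mg2 : measurable_fun setT g2 by apply/measurable_EFinP; exact: measurable_funX.
have -> : (\int[nu]_x (normc (diag_example a gam x) ^+ 2)%:E = k3%:E * \int[nu]_x g2 x)%E.
  by rewrite -hI// => y; rewrite lee_fin sqr_ge0.
have [K K0 hK] := subgauss_bounded a02 lam_ge0.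
have j2 : rintg nu (fun y : 'cV[R]_d => normc (diag_series a gam y)%:C ^+ 2).
  apply: (rintg_dom _ (rintgZ (2 * c * K) (cintg_normc jg))); first exact: measurable_funX.
  apply: aeW => y; rewrite ger0_norm ?sqr_ge0// expr2 ler_wpM2r ?normc_ge0// normc_real.
  apply: (le_trans (diag_series_le d0 a02 gam_ge0 kap01 gam_le y (Ordinal d0))).
  by rewrite ler_pM2l ?mulr_gt0.
have -> : (\int[nu]_x g2 x = (\int[nu]_x (normc (diag_series a gam x)%:C ^+ 2))%:E)%E.
  by rewrite /Rintegral fineK// integrable_fin_num.
by rewrite -EFinM ltry.
Qed.

End rate.

Lemma diag_example_coef (kap c : R) : 0 < kap <= 1 -> 
  (forall n, gam n <= c * (kap / (2 * 8 ^+ d)) ^+ n) ->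
  exists2 k : R, 0 < k & forall m : nat,
    normc (hermite_coef A (diag_example a gam) (fun=> m)) =
      k * (gam m * m`!%:R `^ (- (a^-1 - 2^-1))).
Proof.
move=> kap01 gam_le; have [k1 [k2 [k3 [k10 k20 _ [_ hH _]]]]] := change_of_frame hA.
have jg := cintg_diag_series d0 a02 gam_ge0 kap01 gam_le.
exists (k2 * gauss_mass 1 ^+ d) => [|m].
  by rewrite mulr_gt0// exprn_gt0// gauss_mass_gt0.
have -> : normc (hermite_coef A (diag_example a gam) (fun=> m)) = k2 * _ := hH _ jg _.
rewrite (hsize_diag_series d0 a02 gam_ge0 kap01 gam_le).
by rewrite -!mulrA; congr (_ * _); rewrite mulrA mulrC.
Qed.

End example.

Lemma mi_size_const m : mi_size (fun _ : 'I_d => m) = (d * m)%N.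
Proof. by rewrite /mi_size sum_nat_const card_ord. Qed.

Lemma mi_fact_const m : mi_fact (fun _ : 'I_d => m) = (m`! ^ d)%N.
Proof. by rewrite /mi_fact prod_nat_const card_ord. Qed.

End decay_of_coefficients.

(** * Weights of the extremal series *)

(** A rate that decays faster than every geometric sequence, but slower than
    every negative power of the factorial. *)
Definition log_rate (R : realType) n : R := (1 + ln n.+1%:R) ^- n.

Section log_rate.
Variable R : realType.

Lemma ln_succ_ge0 n : 0 <= ln n.+1%:R :> R.
Proof. by rewrite ln_ge0// ler1n. Qed.

Lemma log_rate_ge0 n : 0 <= log_rate R n.
Proof. by rewrite /log_rate invr_ge0 exprn_ge0// addr_ge0// ln_succ_ge0. Qed.

Lemma log_rate_le (theta : R) : 0 < theta < 1 ->
  exists2 c : R, 0 < c & forall n, log_rate R n <= c * theta ^+ n.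
Proof.
move=> /andP[t0 t1].
have [N hN] : exists N : nat, expR theta^-1 <= N%:R.
  by exists (Num.bound (expR theta^-1)); rewrite ltW// archi_boundP// expR_ge0.
have tN : 0 < theta ^+ N by rewrite exprn_gt0.
exists (theta ^+ N)^-1 => [|n]; first by rewrite invr_gt0.
have l1 : 1 <= 1 + ln n.+1%:R :> R by rewrite lerDl ln_succ_ge0.
have [nN|Nn] := leqP n N.
  apply: (@le_trans _ _ 1).
    by rewrite /log_rate invf_le1 ?exprn_ege1// exprn_gt0// (lt_le_trans ltr01).
  by rewrite mulrC ler_pdivlMr// mul1r ler_wiXn2l// ltW.
apply: (@le_trans _ _ (theta ^+ n)).
  rewrite /log_rate -exprVn lerXn2r ?nnegrE ?invr_ge0 ?(le_trans ler01 l1)// ?(ltW t0)//.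
  rewrite -[leRHS]invrK lef_pV2 ?posrE ?invr_gt0// ?(lt_le_trans ltr01 l1)//.
  rewrite -[leLHS]expRK; apply: (@le_trans _ _ (ln n.+1%:R)); last by rewrite lerDr.
  rewrite ler_ln ?posrE ?expR_gt0 ?ltr0n//; apply: (le_trans hN).
  by rewrite ler_nat ltnW// ltnW.
rewrite -[leLHS]mul1r ler_wpM2r ?exprn_ge0 ?(ltW t0)//.
by rewrite invf_ge1// exprn_ile1// ltW.
Qed.

(** From m! >= (m / e)^m. With t = 1 + ln (m + 1) the power m!^del exceeds the m-th
    power of an exponential in t, which is eventually larger than 2 h t. *)
Lemma log_rate_unbounded (k del h r : R) : 0 < k -> 0 < del -> 0 < h ->
  exists m, r <= k * (log_rate R m * m`!%:R `^ del / h ^+ m).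
Proof.
move=> k0 del0 h0; pose T := 8 * h * expR (3 * del) / del ^+ 2.
have T0 : 0 < T by rewrite divr_gt0 ?exprn_gt0// mulr_gt0 ?expR_gt0// mulr_gt0.
pose N1 := Num.bound (expR T); pose N2 := Num.bound (`|r| / k).
pose m := (N1 + N2).+1; exists m.
have m1 : expR T <= m.+1%:R.
  apply: (@le_trans _ _ N1%:R); first by rewrite ltW// archi_boundP// expR_ge0.
  by rewrite ler_nat /m; lia.
have m2 : `|r| / k <= m%:R.
  apply: (@le_trans _ _ N2%:R); first by rewrite ltW// archi_boundP// divr_ge0// ltW.
  by rewrite ler_nat /m; lia.
pose t : R := 1 + ln m.+1%:R.
have tT : T <= t.
  rewrite -[leLHS]expRK; apply: (@le_trans _ _ (ln m.+1%:R)); last by rewrite lerDr.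
  by rewrite ler_ln ?posrE ?expR_gt0 ?ltr0n.
have t0 : 0 < t by apply: lt_le_trans tT.
have mpos : 0 < m%:R :> R by rewrite ltr0n.
have e2 : 2 <= expR 1 :> R by have := expR_ge1Dx (1 : R).
have base : expR (t - 3) <= m%:R / expR 1.
  rewrite ler_pdivlMr ?expR_gt0// -expRD.
  have -> : t - 3 + 1 = ln m.+1%:R - 1 by rewrite /t; ring.
  rewrite expRB lnK ?posrE ?ltr0n// ler_pdivrMr ?expR_gt0//.
  apply: (@le_trans _ _ (m%:R * 2)); last by rewrite ler_pM2l.
  by rewrite -natrM ler_nat /m; lia.
have fact_ge : (m%:R / expR 1) ^+ m <= m`!%:R :> R.
  have := exp_fact_le m (ltW mpos); rewrite ler_pdivrMr ?ltr0n ?fact_gt0//.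
  rewrite -[X in expR X]mulr1 expRM_natl exprMn exprVn => h2.
  by rewrite ler_pdivrMr ?exprn_gt0 ?expR_gt0// mulrC.
have growth : 2 * h * t <= expR (del * (t - 3)).
  have hx : (del * t / 2) ^+ 2 <= expR (del * t).
    have u0 : 0 <= del * t / 2 by rewrite divr_ge0// mulr_ge0// ltW.
    by have := exprn_le_expR 2 u0; rewrite [2 * _]mulrC divfK ?pnatr_eq0.
  have -> : expR (del * (t - 3)) = expR (del * t) / expR (3 * del).
    by rewrite -expRB; congr expR; ring.
  rewrite ler_pdivlMr ?expR_gt0//; apply: le_trans hx.
  have d20 : 0 < del ^+ 2 by rewrite exprn_gt0.
  move: tT; rewrite /T ler_pdivrMr// => h3.
  rewrite -subr_ge0.
  have -> : (del * t / 2) ^+ 2 - 2 * h * t * expR (3 * del) = t / 4 * (t * del ^+ 2 - 8 * h * expR (3 * del)).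
    by field.
  by rewrite mulr_ge0 ?divr_ge0 ?(ltW t0)// subr_ge0.
have pw : (2 * h * t) ^+ m <= m`!%:R `^ del.
  apply: (@le_trans _ _ ((expR (t - 3) ^+ m) `^ del)).
    rewrite powR_expn ?expR_ge0// [m%:R * del]mulrC powRrM powR_mulrn ?powR_ge0//.
    by rewrite lerXn2r ?nnegrE ?powR_ge0 ?mulr_ge0 ?(ltW h0) ?(ltW t0)// -expRM [_ * del]mulrC.
  apply: ge0_ler_powR; rewrite ?nnegrE ?exprn_ge0 ?expR_ge0 ?(ltW del0)//.
  apply: le_trans fact_ge.
  by rewrite lerXn2r ?nnegrE ?expR_ge0// divr_ge0 ?expR_ge0.
have tm0 : 0 < t ^+ m by rewrite exprn_gt0.
have hm0 : 0 < h ^+ m by rewrite exprn_gt0.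
have low : 2 ^+ m <= log_rate R m * m`!%:R `^ del / h ^+ m.
  have -> : log_rate R m * m`!%:R `^ del / h ^+ m = m`!%:R `^ del / (h ^+ m * t ^+ m).
    have alg (x y z : R) : x^-1 * z / y = z / (y * x) by rewrite invfM mulrAC mulrC [x^-1 * _]mulrC.
    exact: alg.
  rewrite ler_pdivlMr; last exact: mulr_gt0.
  by rewrite -!exprMn mulrA.
apply: (le_trans (ler_norm r)); rewrite -ler_pdivrMl// mulrC.
apply: (le_trans m2); apply: le_trans low.
by rewrite -natrX ler_nat ltnW// ltn_expl.
Qed.

End log_rate.

(** * Optimality of the decay *)

Section coefficient_rates.
Variables (R : realType) (d : nat) (a : R).
Hypothesis d_gt0 : (0 < d)%N.

Lemma fact_const_powR (m : nat) (x : R) :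
  (mi_fact (fun _ : 'I_d => m))%:R `^ (- (d%:R^-1 * x)) = m`!%:R `^ (- x) :> R.
Proof.
rewrite mi_fact_const natrX powR_expn//; congr (_ `^ _).
by field; rewrite pnatr_eq0 -lt0n.
Qed.

Lemma limsup_constant_ratio (u : ('I_d -> nat) -> \bar R) (k : R) : 0 < k ->
  (forall m, u (fun=> m) = k%:E) -> (0 < mi_limsup u)%E.
Proof.
move=> k0 hu; apply: (@lt_le_trans _ _ k%:E); first by rewrite lte_fin.
apply: le_ereal_inf_tmp => _ [N _ <-]; rewrite -(hu N); apply: ereal_sup_ubound.
exists (fun=> N) => //=; rewrite mi_size_const.
by rewrite leq_pmull.
Qed.

End coefficient_rates.

Theorem theorem4p9 (R : realType) (d : nat) (hd : (2 <= d)%N)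
    (a : R) (ha0 : 0 < a) (ha2 : a < 2)
    (A : 'M[R]_d) (hA : spd A) :
  (* (i) *)
  (forall (f : 'cV[R]_d -> R[i]) (lambda : R),
     in_L2 f -> 0 < lambda -> decay_cond A a lambda f ->
     forall h : R,
       d%:R `^ (d%:R^-1 * (a^-1 + 2^-1)) *
         (a * Num.max (2 `^ (a - 1)) 1 * (cos (a * pi / 4))^-1 * lambda)
           `^ ((a * d%:R)^-1) < h ->
     exists2 C : R, 0 < C &
       forall alpha : 'I_d -> nat,
         normc (hermite_coef A f alpha) <=
           C * (h ^+ mi_size alpha *
                ((mi_fact alpha)%:R `^ (- (d%:R^-1 * (a^-1 - 2^-1))))))
  /\
  (* (ii) *)
  (forall lambda : R, 0 < lambda ->
     exists f : 'cV[R]_d -> R[i],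
       [/\ in_L2 f, decay_cond A a lambda f &
         exists2 h : R, 0 < h &
           (0 < mi_limsup
                  (fun alpha : 'I_d -> nat =>
                     (normc (hermite_coef A f alpha) /
                      (h ^+ mi_size alpha *
                       ((mi_fact alpha)%:R
                          `^ (- (d%:R^-1 * (a^-1 - 2^-1))))))%:E))%E])
  /\
  (* (iii) *)
  (exists f : 'cV[R]_d -> R[i],
     [/\ in_L2 f,
         forall lambda : R, 0 < lambda -> decay_cond A a lambda f &
         forall b h : R, d%:R^-1 * (a^-1 - 2^-1) < b -> 0 < h ->
           ereal_sup
             (range (fun alpha : 'I_d -> nat =>
                (normc (hermite_coef A f alpha) /
                 (h ^+ mi_size alpha *
                  ((mi_fact alpha)%:R `^ (- b))))%:E)) = +oo%E]).
Proof.
have a02 : 0 < a < 2 by rewrite ha0.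
have d0 : (0 < d)%N by apply: leq_trans hd.
have dR : 0 < d%:R :> R by rewrite ltr0n.
pose theta kap : R := kap / (2 * 8 ^+ d).
have q1 : 1 < 2 * 8 ^+ d :> R.
  by rewrite (@lt_le_trans _ _ 2) ?ltr1n// ler_peMr// exprn_ege1// ler1n.
have theta01 kap : 0 < kap <= 1 -> 0 < theta kap < 1.
  move=> /andP[k0 k1]; rewrite divr_gt0 ?(lt_trans ltr01 q1)//=.
  by rewrite ltr_pdivrMr ?(lt_trans ltr01 q1)// mul1r (le_lt_trans k1).
have pick_kap (lam : R) : 0 < lam -> exists2 kap : R, 0 < kap <= 1 & kap `^ a / a <= lam.
  move=> l0; exists (Num.min 1 ((a * lam) `^ a^-1)).
    by rewrite lt_min ltr01 powR_gt0 ?mulr_gt0//= ge_min lexx.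
  have al0 : 0 <= a * lam by rewrite mulr_ge0// ltW.
  have e : a * lam = ((a * lam) `^ a^-1) `^ a by rewrite -powRrM mulVf ?gt_eqF// powRr1.
  rewrite ler_pdivrMr// [lam * a]mulrC [leRHS]e.
  by apply: ge0_ler_powR; rewrite ?nnegrE ?powR_ge0 ?(ltW ha0)// ?le_min ?ler01 ?powR_ge0// ge_min lexx orbT.
split; last split.
- by move=> f lam fL2 lam0 dec h; exact: hermite_coef_decay.
- move=> lam lam0; have [kap kap01 klam] := pick_kap lam lam0.
  have /andP[t0 t1] := theta01 kap kap01.
  (* geometric weights make the ratio constant along the diagonal *)
  pose gam n := theta kap ^+ n.
  have gam0 n : 0 <= gam n by rewrite exprn_ge0// ltW.
  have gamle n : gam n <= 1 * theta kap ^+ n by rewrite mul1r.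
  exists (diag_example A a gam); split.
  + exact: (diag_example_L2 hA hd a02 gam0 kap01 ltr01 gamle).
  + exact: (diag_example_decay hA hd a02 gam0 kap01 ltr01 gamle klam).
  exists (theta kap `^ d%:R^-1); first by rewrite powR_gt0.
  have [k k0 hk] := diag_example_coef hA hd a02 gam0 kap01 gamle.
  apply: (limsup_constant_ratio d0 k0) => m; congr EFin.
  rewrite hk mi_size_const fact_const_powR// exprM -[_ ^+ d]powR_mulrn ?powR_ge0//.
  rewrite -powRrM mulVf ?gt_eqF// powRr1 ?(ltW t0)// mulfK//.
  by rewrite mulf_neq0 ?expf_neq0 ?gt_eqF// powR_gt0// ltr0n fact_gt0.
have lr0 := @log_rate_ge0 R.
(* a weight below every geometric sequence satisfies the bounds for all lambda *)
exists (diag_example A a (@log_rate R)); split.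
- have k01 : 0 < (1 : R) <= 1 by rewrite ltr01 lexx.
  have [c c0 hc] := log_rate_le (theta01 _ k01).
  exact: (diag_example_L2 hA hd a02 lr0 k01 c0 hc).
- move=> lam lam0; have [kap kap01 klam] := pick_kap lam lam0.
  have [c c0 hc] := log_rate_le (theta01 _ kap01).
  exact: (diag_example_decay hA hd a02 lr0 kap01 c0 hc klam).
move=> b h bs h0; have k01 : 0 < (1 : R) <= 1 by rewrite ltr01 lexx.
have [c c0 hc] := log_rate_le (theta01 _ k01).
have [k k0 hk] := diag_example_coef hA hd a02 lr0 k01 hc.
pose del := d%:R * b - (a^-1 - 2^-1).
have del0 : 0 < del by rewrite subr_gt0 -ltr_pdivrMl.
apply: eq_infty => r.
have [m hm] := @log_rate_unbounded R k del (h ^+ d) r k0 del0 (exprn_gt0 _ h0).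
apply: (@le_trans _ _ (k * (log_rate R m * m`!%:R `^ del / h ^+ d ^+ m))%:E); first by rewrite lee_fin.
apply: ereal_sup_ubound; exists (fun=> m) => //; congr EFin.
have f0 : m`!%:R != 0 :> R by rewrite pnatr_eq0 -lt0n fact_gt0.
rewrite hk mi_size_const mi_fact_const natrX powR_expn// exprM invfM -powRN.
have e : m`!%:R `^ del = m`!%:R `^ (d%:R * b) * m`!%:R `^ (- (a^-1 - 2^-1)) :> R.
  by rewrite -powRD// f0 implybT.
have alg (x y z l : R) : k * (l * x) * (y * z) = k * (l * (z * x) * y) by ring.
by rewrite e mulrN opprK; exact: alg.
Qed.
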